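(* Let $P\subset N_{\mathbb{R}}\cong\mathbb{R}^2$ be a convex lattice polygon with a unimodular triangulation, $v$ an interior vertex, $\Sigma_v$ its fan, $\vartheta$ a semi-integral support function on $\Sigma_v$, and $C$, $\tilde\vartheta_\epsilon$, $D\vartheta$, $\gamma$ as in the context. Suppose $\vartheta$ (resp. $-\vartheta$) is strictly convex. Then for $\epsilon>0$ sufficiently small, for every $b\in C$ either $(d\tilde\vartheta_\epsilon)_b\in\gamma(\partial\bar C)$ or the Hessian of $\tilde\vartheta_\epsilon$ at $b$ is positive definite (resp. negative definite). In particular the image $D\vartheta(\bar C)$ is the closed convex polygon whose boundary is $\gamma(\partial\bar C)$.
   Context: $N$ is a rank 2 lattice with dual $M$. A unimodular triangulation subdivides $P$ into elementary lattice triangles. For the interior vertex $v$, $\Sigma_v$ is the complete fan in $N_{\mathbb{R}}$ formed by the tangent cones at $v$ of the triangles and edges of the triangulation containing $v$; its rays are generated by primitive $n_1,\dots,n_r$. A semi-integral support function on $\Sigma_v$ is a continuous $\vartheta:N_{\mathbb{R}}\to\mathbb{R}$, linear on each maximal cone, with $\vartheta(n_j)\in\tfrac12+\mathbb{Z}$ for all $j$. It is strictly convex if it is convex and its restrictions to any two adjacent maximal cones are distinct linear functions. We regard $\vartheta$ as the function $x\mapsto\vartheta(x-v)$ on $N_{\mathbb{R}}$. Fix an inner product with norm $\|\cdot\|$ on $N_{\mathbb{R}}$ and for $\epsilon>0$ let $\mu_\epsilon(x)=A_\epsilon^{-1}\exp\big(1/(\|x\|^2-\epsilon^2)\big)$ for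 $\|x\|<\epsilon$, $\mu_\epsilon(x)=0$ otherwise, with $A_\epsilon$ chosen so that $\int\mu_\epsilon=1$; set $\tilde\vartheta_\epsilon(x)=\int_{N_{\mathbb{R}}}\vartheta(x-y-v)\mu_\epsilon(y)\,dy$. Let $C$ be the open polygon whose vertices are, in cyclic order around $v$, the barycenters of the edges and of the triangles of the triangulation that contain $v$ (barycenters of edges and triangles alternating). Define $D\vartheta:\bar C\to M_{\mathbb{R}}$ by $b\mapsto(d\tilde\vartheta_\epsilon)_b$ and $\gamma=D\vartheta|_{\partial\bar C}$. *)

(* Defs.v *)
From HB Require Import structures.
From mathcomp Require Import all_boot all_order all_algebra.
From mathcomp Require Import all_classical all_reals all_analysis.
Import Order.TTheory GRing.Theory Num.Theory numFieldNormedType.Exports.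

Set Implicit Arguments.
Unset Strict Implicit.
Unset Printing Implicit Defensive.

Local Open Scope classical_set_scope.
Local Open Scope ring_scope.

(* The lattice N = Z^2, N_R = R^2 (= R * R); M_R is identified with R * R via
   the dual basis, m acting by [lin m x = m.1 * x.1 + m.2 * x.2]. *)
Definition lpt := (int * int)%type.
Definition ltri := (lpt * lpt * lpt)%type.
Definition tverts (T : ltri) : seq lpt := [:: T.1.1; T.1.2; T.2].

Definition detZ (p q : lpt) : int := p.1 * q.2 - p.2 * q.1.

Definition unimodular_tri (T : ltri) : Prop :=
  `| detZ (T.1.2.1 - T.1.1.1, T.1.2.2 - T.1.1.2)
          (T.2.1 - T.1.1.1, T.2.2 - T.1.1.2) | = 1.

Section Defs.
Variable R : realType.

Definition toR (p : lpt) : R * R := (p.1%:~R, p.2%:~R).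

Definition lin (m : R * R) (x : R * R) : R := m.1 * x.1 + m.2 * x.2.

Definition conv_hull (s : seq (R * R)) : set (R * R) :=
  [set x | exists w : nat -> R,
     [/\ (forall i, (i < size s)%N -> 0 <= w i),
         \sum_(i < size s) w i = 1 &
         x = \sum_(i < size s) w i *: s`_i]].

Definition tri_set (T : ltri) : set (R * R) := conv_hull (map toR (tverts T)).

Definition convex_fun (f : R * R -> R) : Prop :=
  forall x y t, 0 <= t <= 1 -> f (t *: x + (1 - t) *: y) <= t * f x + (1 - t) * f y.

Definition T0 : ltri := ((0, 0), (0, 0), (0, 0)).
Definition unimodular_triangulation (P : set (R * R)) (Ts : seq ltri) : Prop :=
  [/\ P = [set x | exists2 T, T \in Ts & tri_set T x],
      (forall T, T \in Ts -> unimodular_tri T) &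
      (forall i j, (i < size Ts)%N -> (j < size Ts)%N -> i <> j ->
         ~ perm_eq (tverts (nth T0 Ts i)) (tverts (nth T0 Ts j)) /\
         tri_set (nth T0 Ts i) `&` tri_set (nth T0 Ts j)
         = conv_hull (map toR [seq p <- tverts (nth T0 Ts i)
                                 | p \in tverts (nth T0 Ts j)]))].

Definition interior_vertex (P : set (R * R)) (Ts : seq ltri) (v : lpt) : Prop :=
  (exists2 T, T \in Ts & v \in tverts T) /\ interior P (toR v).

Definition star_tri (Ts : seq ltri) (v w w' : lpt) : Prop :=
  exists2 T, T \in Ts & perm_eq (tverts T) [:: v; w; w'].

Definition cone2 (a b : R * R) : set (R * R) :=
  [set x | exists s t, [/\ 0 <= s, 0 <= t & x = s *: a + t *: b]].

(* maximal cone of Sigma_v: tangent cone at v of the triangle {v,w,w'} *)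
Definition tcone (v w w' : lpt) : set (R * R) :=
  cone2 (toR w - toR v) (toR w' - toR v).

Definition support_fun (Ts : seq ltri) (v : lpt) (th : R * R -> R) : Prop :=
  continuous th /\
  forall w w', star_tri Ts v w w' ->
    exists m : R * R, forall x, tcone v w w' x -> th x = lin m x.

(* semi-integral: values in 1/2 + Z on the primitive ray generators w - v *)
Definition semi_integral_support (Ts : seq ltri) (v : lpt) (th : R * R -> R) : Prop :=
  support_fun Ts v th /\
  forall w w', star_tri Ts v w w' ->
    exists k : int, th (toR w - toR v) = k%:~R + 2^-1.

(* strictly convex: convex, and distinct linear functions on adjacent maximal
   cones (the cones of two distinct triangles sharing the edge [v,w]) *)
Definition strictly_convex_support (Ts : seq ltri) (v : lpt) (th : R * R -> R) : Prop :=
  convex_fun th /\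
  forall w w1 w2, star_tri Ts v w w1 -> star_tri Ts v w w2 -> w1 <> w2 ->
    forall m1 m2 : R * R,
      (forall x, tcone v w w1 x -> th x = lin m1 x) ->
      (forall x, tcone v w w2 x -> th x = lin m2 x) -> m1 <> m2.

(* inner product on N_R given by a positive definite symmetric matrix
   [[q.1.1, q.1.2], [q.1.2, q.2]] *)
Definition inner_prod (q : R * R * R) (x y : R * R) : R :=
  q.1.1 * x.1 * y.1 + q.1.2 * (x.1 * y.2 + x.2 * y.1) + q.2 * x.2 * y.2.
Definition is_inner (q : R * R * R) : Prop :=
  0 < q.1.1 /\ 0 < q.1.1 * q.2 - q.1.2 ^+ 2.
Definition normsq (q : R * R * R) (x : R * R) : R := inner_prod q x x.

Definition leb2 := ((@lebesgue_measure R) \x (@lebesgue_measure R))%E.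

Definition bump (q : R * R * R) (e : R) (x : R * R) : R :=
  if normsq q x < e ^+ 2 then expR (1 / (normsq q x - e ^+ 2)) else 0.
Definition A_eps (q : R * R * R) (e : R) : R := Rintegral leb2 setT (bump q e).
Definition mu_eps (q : R * R * R) (e : R) (x : R * R) : R :=
  (A_eps q e)^-1 * bump q e x.

Definition theta_tilde (q : R * R * R) (e : R) (th : R * R -> R) (v : lpt)
    (x : R * R) : R :=
  Rintegral leb2 setT (fun y => th (x - y - toR v) * mu_eps q e y).

Definition d1 (f : R * R -> R) (b : R * R) : R := derive1 (fun t => f (t, b.2)) b.1.
Definition d2 (f : R * R -> R) (b : R * R) : R := derive1 (fun t => f (b.1, t)) b.2.
Definition dif (f : R * R -> R) (b : R * R) : R * R := (d1 f b, d2 f b).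
Definition hess_form (f : R * R -> R) (b : R * R) (xi : R * R) : R :=
  xi.1 ^+ 2 * d1 (d1 f) b + xi.1 * xi.2 * (d2 (d1 f) b + d1 (d2 f) b)
  + xi.2 ^+ 2 * d2 (d2 f) b.
Definition hess_posdef (f : R * R -> R) (b : R * R) : Prop :=
  forall xi, xi != 0 -> 0 < hess_form f b xi.
Definition hess_negdef (f : R * R -> R) (b : R * R) : Prop :=
  forall xi, xi != 0 -> hess_form f b xi < 0.

(* closure of C: the union, over the triangles {v,w,w'} containing v, of the
   triangles (v, barycenter of [v,w], barycenter of {v,w,w'}); these are the
   pieces of the polygon whose vertices are, in cyclic order around v, the
   barycenters of the edges and triangles containing v. *)
Definition Cbar (Ts : seq ltri) (v : lpt) : set (R * R) :=
  [set x | exists w w', star_tri Ts v w w' /\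
     conv_hull [:: toR v; 2^-1 *: (toR v + toR w);
                   3^-1 *: (toR v + toR w + toR w')] x].
Definition Copen (Ts : seq ltri) (v : lpt) : set (R * R) := interior (Cbar Ts v).
Definition Cbdry (Ts : seq ltri) (v : lpt) : set (R * R) := Cbar Ts v `\` Copen Ts v.

Definition thm_conclusion (Ts : seq ltri) (v : lpt) (q : R * R * R)
   (th : R * R -> R) (hdef : (R * R -> R) -> R * R -> Prop) : Prop :=
  exists2 e0 : R, 0 < e0 & forall e, 0 < e < e0 ->
    let f := theta_tilde q e th v in
    let gamma_img := dif f @` Cbdry Ts v in
    (forall b, Copen Ts v b -> gamma_img (dif f b) \/ hdef f b) /\
    (exists s : seq (R * R),
       [/\ dif f @` Cbar Ts v = conv_hull s,
           interior (conv_hull s) !=set0 &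
           conv_hull s `\` interior (conv_hull s) = gamma_img]).

End Defs.

(* Main.v *)
Require Import Defs.
From HB Require Import structures.
From mathcomp Require Import all_boot all_order all_algebra.
From mathcomp Require Import all_classical all_reals all_analysis.
From mathcomp Require Import measurable_realfun ring lra zify.
Import Order.TTheory GRing.Theory Num.Theory numFieldNormedType.Exports.
Set Implicit Arguments.
Unset Strict Implicit.
Unset Printing Implicit Defensive.
Local Open Scope classical_set_scope.
Local Open Scope ring_scope.

(** Let [K] be the polygon of all [m] with [m(n_j) <= theta(n_j)] for all rays. By
    subadditivity of [theta] the gradient of the smoothing [f] lies in [K]. If the
    [epsilon]-ball around [b] meets two non-parallel rays of the fan, the kink of [theta]
    along each of them forces [f(b + h xi) + f(b - h xi) - 2 f(b) >= c h^2] for every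
    direction [xi], and the Hessian is positive definite. Otherwise [theta] is additive
    along a single ray [n_j] on the whole ball, so that [df_b(n_j) = theta(n_j)] and [df_b]
    lies on the boundary of [K]. For small [epsilon] the second case occurs at every
    boundary point of [C]; hence the boundary of [C] is mapped into that of [K], and onto
    it by the intermediate value theorem on each edge. An interior point [m] of [K] is the
    gradient of [f] at a minimizer of [f - m] over the closure of [C], which cannot be a
    boundary point. The concave case follows by negating [theta]. *)

(** * Smoothness of the bump function *)

(** The dichotomy holds at every point of the plane and for every [epsilon]; smallness of [epsilon]
    serves to identify [gamma] with the boundary of [K]. It does so because a boundary point of [C]
    on the piece next to the ray of [a] has coefficient at least [1/3] on [a], so that a small ball
    around it sees only the two cones along that ray. Since [theta] has kinks, all derivatives are
    put on the kernel, and the Hessian is estimated from second differences: a kink contributes a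
    height of order [h] on a strip of width of order [h], hence order [h^2]. No cyclic order of the
    rays is used: neighbouring cones are recognised by opposite signs of two determinants. The
    lattice enters through the proof that the triangles at [v] give such a fan, where unimodularity
    forces a triangle reaching [v] to have [v] as a vertex. That [K] is a polygon is obtained by
    writing it as the convex hull of the linear pieces of [theta]. *)

Section Beta.
Variable R : realType.
Implicit Types (s : R) (k : nat).

(* The bump is [beta 0] of [e ^+ 2 - |x|^2]. Every [beta k] is flat at [0], and the
   family is closed under differentiation, so the bump is smooth across its boundary. *)
Definition beta k s : R := if 0 < s then s^-1 ^+ k * expR (- s^-1) else 0.

Lemma beta_ge0 k s : 0 <= beta k s.
Proof.
rewrite /beta; case: ifP => // s0.
by rewrite mulr_ge0 ?expR_ge0// exprn_ge0// invr_ge0 ltW.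
Qed.

(** With [x = s^-1] this is [x^k / k! <= exp x]. It bounds the kernels and also yields the flatness
    at [0]. *)
Lemma beta_le_fact k s : beta k s <= k`!%:R.
Proof.
rewrite /beta; case: ifP => // s0.
have si : 0 < s^-1 by rewrite invr_gt0.
rewrite expRN ler_pdivrMr ?expR_gt0//.
case: k => [|k].
  by rewrite expr0 fact0 mul1r -expR0 ler_expR ltW.
have kf : (0 : R) < (k.+1)`!%:R by rewrite ltr0n fact_gt0.
rewrite mulrC -ler_pdivrMr//.
by apply: le_trans (expR_ge1Dxn k (ltW si)); rewrite lerDr.
Qed.

Lemma betaMl k s : s * beta k.+1 s = beta k s.
Proof.
rewrite /beta; case: ifP => // [s0|]; last by rewrite mulr0.
by rewrite exprS !mulrA mulfV ?mul1r// gt_eqF.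
Qed.

Lemma is_derive_beta k s :
  is_derive s 1 (beta k) (beta k.+2 s - k%:R * beta k.+1 s).
Proof.
have [s0|s0|->] := ltgtP s 0.
- have -> : beta k.+2 s - k%:R * beta k.+1 s = 0.
    by rewrite /beta !ltNge ltW//= mulr0 subr0.
  apply: (@near_eq_is_derive _ R^o R^o (cst 0)).
    near=> t; rewrite /beta ltNge ltW//; near: t.
    exact: lt_nbhsl.
- have sn : s != 0 by rewrite gt_eqF.
  apply: (@near_eq_is_derive _ R^o R^o (fun t => t^-1 ^+ k * expR (- t^-1))).
    near=> t; rewrite /beta ifT//; near: t; exact: lt_nbhsr.
  have dV : is_derive s 1 (fun t : R => t^-1) (- s^-1 ^+ 2).
    have := @is_deriveV _ id s 1 1 sn (is_derive_id _ _).
    by rewrite /GRing.scale/= mulr1 exprVn.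
  have dE : is_derive s 1 (fun t : R => expR (- t^-1)) (expR (- s^-1) * s^-1 ^+ 2).
    have dN : is_derive s 1 (fun t : R => - t^-1) (s^-1 ^+ 2).
      by have := is_deriveN dV; rewrite opprK.
    exact: (@is_derive1_comp _ expR (fun t : R => - t^-1)).
  have dM := is_deriveM (is_deriveX k dV) dE.
  rewrite (_ : (fun t : R^o => _) =
      (fun t : R => t^-1) ^+ k * (fun t : R => expR (- t^-1))); last first.
    by apply/funext => t; rewrite !fctE.
  apply: (is_derive_eq dM); rewrite !fctE /beta s0 /GRing.scale/=.
  clear dM dE dV s0 sn; set E := expR _; set z := s^-1; move: E z => E z.
  by case: k => [|k]; rewrite ?exprS ?expr0 /=; ring.
- have -> : beta k.+2 0 - k%:R * beta k.+1 0 = 0.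
    by rewrite /beta ltxx mulr0 subr0.
  suff : (fun h : R => h^-1 *: (beta k (h *: 1 + 0) - beta k 0)) @ 0^' --> (0 : R).
    move=> h0; apply: DeriveDef; first by apply/cvg_ex; exists 0.
    by apply/cvg_lim.
  apply/cvgrPdist_le => e e0.
  near=> h.
  have hn : h != 0 by near: h; exact: nbhs_dnbhs_neq.
  rewrite sub0r normrN addr0 /GRing.scale/= mulr1 {2}/beta ltxx subr0.
  (* Two uses of [betaMl] give [beta k h = h^2 * beta k.+2 h], so the difference quotient is
     [h * beta k.+2 h], of size at most [|h| * (k+2)!]. *)
  rewrite -betaMl -betaMl !mulrA mulVf// mul1r normrM.
  rewrite (ger0_norm (beta_ge0 _ _)).
  apply: (@le_trans _ _ (`|h| * (k.+2)`!%:R)).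
    by rewrite ler_wpM2l// beta_le_fact.
  have kf : (0 : R) < (k.+2)`!%:R by rewrite ltr0n fact_gt0.
  rewrite -ler_pdivlMr//.
  near: h; apply: nbhs_dnbhs; apply: (@nbhs0_le _ R^o).
  by rewrite divr_gt0.
Unshelve. all: by end_near. Qed.

Lemma continuous_beta k : continuous (beta k).
Proof.
move=> s; have [d _] := is_derive_beta k s.
exact/differentiable_continuous/derivable1_diffP.
Qed.

End Beta.

(** * Lebesgue measure on the plane *)

Section Leb2.
Variable R : realType.
Let mu := @lebesgue_measure R.
Implicit Types (A B : set R).
Let T2 := (measurableTypeR R * measurableTypeR R)%type.
Let nu := @leb2 R.

Lemma measurable_shift1 (c : R) :
  measurable_fun setT (fun x : measurableTypeR R => (x + c : measurableTypeR R)).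
Proof. exact: (@measurable_funD _ (measurableTypeR R) R setT id (cst c)). Qed.

(** The pushforward under the translation agrees with Lebesgue measure on half-open intervals, which
    determine it. *)
Lemma lebesgue_measure_shift (c : R) A : measurable A ->
  mu ((fun x => x + c) @^-1` A) = mu A.
Proof.
move=> mA; symmetry.
pose f (x : measurableTypeR R) : measurableTypeR R := x + c.
have mf : measurable_fun setT f by exact: measurable_shift1.
pose m1 : {measure set (measurableTypeR R) -> \bar R} := pushforward mu f.
pose m' := m1 mf.
apply: (@lebesgue_measure_unique _ m') => // X.
have m'E (Y : set R) : m' Y = mu (f @^-1` Y) by [].
rewrite m'E => /ocitvP [->|[[a b] /= ab ->]].
  by rewrite preimage_set0 [RHS]measure0 measure0.
have -> : f @^-1` `]a, b]%classic = `](a - c), (b - c)]%classic.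
  by apply/seteqP; split => x /=; rewrite !in_itv/= ltrBlDr lerBrDr.
rewrite /mu !lebesgue_measure_itv/= !lte_fin ltrD2r ab -!EFinB; congr EFin; ring.
Qed.

Lemma measurable_shift2 (w : R * R) :
  measurable_fun setT (fun x : T2 => (x + w : T2)).
Proof.
apply/measurable_fun_pairP; split => /=.
  exact: (measurable_funD measurable_fst (measurable_cst w.1)).
exact: (measurable_funD measurable_snd (measurable_cst w.2)).
Qed.

Lemma leb2_shift (w : R * R) (X : set T2) : measurable X ->
  nu ((fun x => x + w) @^-1` X) = nu X.
Proof.
move=> mX; symmetry.
pose f (x : T2) : T2 := x + w.
pose m1 : {measure set T2 -> \bar R} := pushforward nu f.
pose m' := m1 (measurable_shift2 w).
apply: (product_measure_unique (m' := m')) => // A B mA mB.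
have -> : m' (A `*` B) =
   nu (((fun x => x + w.1) @^-1` A) `*` ((fun x => x + w.2) @^-1` B)) by [].
rewrite /nu /leb2 product_measure1E.
- by congr (_ * _)%E; exact: lebesgue_measure_shift.
- by rewrite -[X in measurable X]setTI; exact: measurable_shift1.
- by rewrite -[X in measurable X]setTI; exact: measurable_shift1.
Qed.

Lemma Rintegral_leb2_shift (w : R * R) (f : T2 -> R) :
  measurable_fun setT f -> nu.-integrable setT (EFin \o (fun x => f (x + w))) ->
  Rintegral nu setT (fun x => f (x + w)) = Rintegral nu setT f.
Proof.
move=> mf intf; congr fine.
pose s (x : T2) : T2 := x + w.
pose m1 : {measure set T2 -> \bar R} := pushforward nu s.
pose m' := m1 (measurable_shift2 w).
have mf1 : measurable_fun setT (EFin \o f) by exact/measurable_EFinP.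
have /= h := integral_pushforward (measurable_shift2 w) (mu := nu) (D := setT)
  (f := EFin \o f) mf1 intf measurableT.
transitivity (\int[m']_(y in setT) (EFin \o f) y)%E; first exact/esym.
by apply: eq_measure_integral => A mA _; exact: leb2_shift.
Qed.

Definition box2 (r : R) : set T2 := `[- r, r]%classic `*` `[- r, r]%classic.

Lemma box2P r y : box2 r y <-> `|y.1| <= r /\ `|y.2| <= r.
Proof. by rewrite /box2 /= !in_itv/= -!ler_norml. Qed.

Lemma measurable_box2 r : measurable (box2 r).
Proof. by apply: measurableX; exact: measurable_itv. Qed.

Lemma leb2_box2_fin r : (nu (box2 r) < +oo)%E.
Proof.
rewrite /nu /leb2 product_measure1E ?measurable_itv//.
have h : (mu `[(- r)%R, r]%classic < +oo)%E.
  by rewrite /mu lebesgue_measure_itv/=; case: ifP => // _; rewrite -EFinB ltry.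
by rewrite lte_mul_pinfty// ge0_fin_numE.
Qed.

End Leb2.

(** * Convolution with a compactly supported kernel *)

Section Cnv.
Variable R : realType.
Let T2 := (measurableTypeR R * measurableTypeR R)%type.
Let nu := @leb2 R.
Implicit Types (G k : R * R -> R).

Definition cnv G k (x : R * R) : R :=
  Rintegral nu setT (fun y => G (x - y) * k y).

Definition loc_bounded G :=
  measurable_fun (setT : set T2) G /\
  forall r, exists C, forall x, box2 r x -> `|G x| <= C.

Definition kernel k :=
  measurable_fun (setT : set T2) k /\
  exists r C, forall y, `|k y| <= C /\ (~ box2 r y -> k y = 0).

Lemma measurable_reflect2 (x : R * R) :
  measurable_fun setT (fun y : T2 => (x - y : T2)).
Proof.
apply/measurable_fun_pairP; split => /=.
  exact: (measurable_funB (measurable_cst x.1) measurable_fst).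
exact: (measurable_funB (measurable_cst x.2) measurable_snd).
Qed.

Lemma box2_sub (r : R) (x y : R * R) : box2 r y ->
  box2 (r + `|x.1| + `|x.2|) (x - y).
Proof.
move=> /box2P[y1 y2]; apply/box2P => /=.
have := ler_normB x.1 y.1; have := ler_normB x.2 y.2.
have := normr_ge0 x.1; have := normr_ge0 x.2.
by split; lra.
Qed.

Lemma kernel_shift k (w : R * R) : kernel k -> kernel (fun y => k (y + w)).
Proof.
move=> [mk [r [C h]]]; split.
  exact: (measurableT_comp mk (measurable_shift2 w)).
exists (r + `|w.1| + `|w.2|), C => y; split; first by case: (h (y + w)).
move=> nb; apply: (h (y + w)).2 => /box2P[/= b1 b2]; apply: nb.
apply/box2P.
have := ler_normB (y.1 + w.1) w.1; have := ler_normB (y.2 + w.2) w.2.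
rewrite !addrK.
have := normr_ge0 w.1; have := normr_ge0 w.2.
by split; lra.
Qed.

Lemma kernelD k1 k2 : kernel k1 -> kernel k2 -> kernel (fun y => k1 y + k2 y).
Proof.
move=> [m1 [r1 [C1 h1]]] [m2 [r2 [C2 h2]]]; split.
  exact: measurable_funD.
exists (Num.max r1 r2), (C1 + C2) => y; split.
  by rewrite (le_trans (ler_normD _ _))// lerD//; [case: (h1 y)|case: (h2 y)].
move=> nb; rewrite (h1 y).2 ?(h2 y).2 ?addr0// => /box2P[b1 b2]; apply: nb; apply/box2P;
  by rewrite !le_max b1 b2 ?orbT.
Qed.

(** Every integrability claim below reduces to this: the integrand of a convolution is itself
    bounded with bounded support. *)
Lemma kernelMl G k : loc_bounded G -> kernel k -> kernel (fun y => G y * k y).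
Proof.
move=> [mG bG] [mk [r [C h]]]; split; first exact: measurable_funM.
have [D hD] := bG r.
exists r, (`|D| * `|C|) => y; split; last by move=> /(h y).2 ->; rewrite mulr0.
have [b|nb] := pselect (box2 r y); last first.
  by rewrite (h y).2// mulr0 normr0 mulr_ge0.
rewrite normrM ler_pM//.
  exact: le_trans (hD _ b) (ler_norm _).
exact: le_trans (h y).1 (ler_norm _).
Qed.

Lemma kernelZ (a : R) k : kernel k -> kernel (fun y => a * k y).
Proof.
apply: kernelMl; split; first exact: measurable_cst.
by move=> r; exists `|a|.
Qed.

Lemma kernel_integrable k : kernel k -> nu.-integrable setT (EFin \o k).
Proof.
move=> [mk [r [C h]]].
have -> : EFin \o k = (EFin \o k) \_ (box2 r).
  apply/funext => y; rewrite patchE; case: ifPn => // /negP yb /=.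
  by rewrite (h y).2// => yb'; apply: yb; rewrite inE.
apply/(integrable_mkcond _ _).1; first exact: measurable_box2.
apply: measurable_bounded_integrable.
- exact: measurable_box2.
- exact: leb2_box2_fin.
- exact: measurable_funS mk.
- exists C; split; first exact: num_real.
  by move=> M CM y _ /=; apply: le_trans (h y).1 (ltW CM).
Qed.

Lemma loc_bounded_reflect G (x : R * R) :
  loc_bounded G -> loc_bounded (fun y => G (x - y)).
Proof.
move=> [mG bG]; split; first exact: (measurableT_comp mG (measurable_reflect2 x)).
move=> r; have [C h] := bG (r + `|x.1| + `|x.2|); exists C => y yr.
exact/h/box2_sub.
Qed.

Lemma kernel_cnv G k (x : R * R) : loc_bounded G -> kernel k ->
  kernel (fun y => G (x - y) * k y).
Proof. by move=> bG kk; apply: kernelMl => //; exact: loc_bounded_reflect. Qed.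

Lemma cnv_integrable G k (x : R * R) : loc_bounded G -> kernel k ->
  nu.-integrable setT (EFin \o (fun y => G (x - y) * k y)).
Proof. by move=> bG kk; apply: kernel_integrable; exact: kernel_cnv. Qed.

Lemma cnvD G k1 k2 x : loc_bounded G -> kernel k1 -> kernel k2 ->
  cnv G (fun y => k1 y + k2 y) x = cnv G k1 x + cnv G k2 x.
Proof.
move=> bG h1 h2; rewrite /cnv -RintegralD//; try exact: cnv_integrable.
by apply: eq_Rintegral => y _; rewrite mulrDr.
Qed.

Lemma cnvZ G k a x : loc_bounded G -> kernel k ->
  cnv G (fun y => a * k y) x = a * cnv G k x.
Proof.
move=> bG h; rewrite /cnv -RintegralZl//; last exact: cnv_integrable.
by apply: eq_Rintegral => y _; rewrite mulrCA.
Qed.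

Lemma cnvN G k x : loc_bounded G -> kernel k ->
  cnv (fun z => - G z) k x = - cnv G k x.
Proof.
move=> bG h; rewrite -[RHS]mulN1r /cnv -RintegralZl//; last exact: cnv_integrable.
by apply: eq_Rintegral => y _; rewrite mulN1r mulNr.
Qed.

(** Translation invariance moves the displacement of the point onto the kernel, which is the smooth
    factor. *)
Lemma cnv_shift G k (x w : R * R) : loc_bounded G -> kernel k ->
  cnv G k (x + w) = cnv G (fun y => k (y + w)) x.
Proof.
move=> bG h.
rewrite /cnv -(@Rintegral_leb2_shift _ w).
- by apply: eq_Rintegral => y _; congr (G _ * _); rewrite (addrC y) addrKA.
- exact: (kernel_cnv _ bG h).1.
- apply: kernel_integrable; apply: (@kernel_shift (fun y => G (x + w - y) * k y)).
  exact: kernel_cnv.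
Qed.

(* All derivatives fall on the kernel: [G] need not even be continuous. *)
Lemma is_derive0_cnv G k k' (xi x : R * R) : loc_bounded G -> kernel k -> kernel k' ->
  (forall y (t : R), is_derive t 1 (fun s : R => k (y + s *: xi)) (k' (y + t *: xi))) ->
  is_derive (0 : R) 1 (fun t : R => cnv G k (x + t *: xi)) (cnv G k' x).
Proof.
move=> bG hk hk' dk.
pose f (t : R) (y : T2) := G (x - y) * k (y + t *: xi).
have -> : (fun t : R => cnv G k (x + t *: xi)) = fun t => Rintegral nu setT (f t).
  by apply/funext => t; rewrite cnv_shift.
have df y (t : R) : is_derive t 1 (f ^~ y) (G (x - y) * k' (y + t *: xi)).
  exact: (is_deriveZ (G (x - y)) (dk y t)).
have [mk' [r [C hC]]] := hk'.
have [mG bdG] := bG.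
(* The box of size [r'] contains the supports of all shifted kernels with [|t| < 1]; [D] then bounds
   [G] at the corresponding points [x - y], which gives a dominating function independent of [t]. *)
pose r' := r + `|xi.1| + `|xi.2|.
have [D hD] := bdG (r' + `|x.1| + `|x.2|).
pose H (y : T2) : R := `|D| * `|C| * \1_(box2 r') y.
have I0 : `](-1 : R), 1[%classic 0 by rewrite /= in_itv/=; lra.
have intf t : `](-1 : R), 1[%classic t -> nu.-integrable setT (EFin \o f t).
  by move=> _; apply: cnv_integrable => //; exact: kernel_shift.
have derf (t : R) y : `](-1 : R), 1[%classic t -> setT y -> derivable (f^~ y) t 1.
  by move=> _ _; case: (df y t).
have H0 y : 0 <= H y by rewrite /H !mulr_ge0.
have intH : nu.-integrable setT (EFin \o H).
  apply: kernel_integrable; split.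
    apply: measurable_funM => //; apply: measurable_indic; exact: measurable_box2.
  exists r', (`|D| * `|C|) => y; rewrite /H indicE; split.
    by case: (y \in _); rewrite ?mulr1 ?mulr0 ?normr0 ?mulr_ge0// ger0_norm ?mulr_ge0.
  by move=> nb; rewrite memNset// mulr0.
have ubH (t : R) y : `](-1 : R), 1[%classic t -> setT y -> `|partial1of2 f t y| <= H y.
  move=> /=; rewrite in_itv/= => /andP[t1 t2] _.
  have -> : partial1of2 f t y = G (x - y) * k' (y + t *: xi).
    by rewrite /partial1of2 derive1E; have [_ ->] := df y t.
  have [b|nb] := pselect (box2 r (y + t *: xi)); last first.
    by rewrite (hC _).2// mulr0 normr0 H0.
  have b' : box2 r' y.
    move/box2P : b => [/= b1 b2]; apply/box2P.
    have := ler_normB (y.1 + t * xi.1) (t * xi.1).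
    have := ler_normB (y.2 + t * xi.2) (t * xi.2).
    rewrite !addrK !normrM.
    have t3 : `|t| <= 1 by rewrite ler_norml; lra.
    have := ler_wpM2r (normr_ge0 xi.1) t3; have := ler_wpM2r (normr_ge0 xi.2) t3.
    rewrite !mul1r.
    have := normr_ge0 xi.1; have := normr_ge0 xi.2.
    rewrite /GRing.scale/= in b1 b2 *.
    by rewrite /r'; split; lra.
  rewrite /H indicE mem_set// mulr1 normrM ler_pM//.
    by apply: le_trans (hD _ _) (ler_norm _); exact: box2_sub.
  by apply: le_trans (hC _).1 (ler_norm _).
apply: DeriveDef.
  exact: (derivable_under_integral measurableT I0 intf derf H0 intH ubH).
rewrite -derive1E (differentiation_under_integral measurableT I0 intf derf H0 intH ubH).
apply: eq_Rintegral => y _; rewrite /partial1of2 derive1E.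
by have [_ ->] := df y 0; rewrite scale0r addr0.
Qed.

Lemma is_derive_cnv G k k' (xi x : R * R) (t : R) : loc_bounded G -> kernel k -> kernel k' ->
  (forall y (t : R), is_derive t 1 (fun s : R => k (y + s *: xi)) (k' (y + t *: xi))) ->
  is_derive t 1 (fun s : R => cnv G k (x + s *: xi)) (cnv G k' (x + t *: xi)).
Proof.
move=> bG hk hk' dk.
have h := is_derive0_cnv (x + t *: xi) bG hk hk' dk.
have -> : (fun s : R => cnv G k (x + s *: xi)) =
    (fun u : R => cnv G k (x + t *: xi + u *: xi)) \o (fun s => s - t).
  by apply/funext => s /=; rewrite -addrA -scalerDl (addrC t) subrK.
have ds : is_derive t 1 (fun s : R => s - t) (1 : R).
  by have := is_deriveB (is_derive_id t (1 : R)) (is_derive_cst t t (1 : R)); rewrite subr0.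
have h' : is_derive (t - t) 1 (fun u : R => cnv G k (x + t *: xi + u *: xi)) (cnv G k' (x + t *: xi)).
  by rewrite subrr.
have := @is_derive1_comp _ _ (fun s : R => s - t) _ _ _ h' ds.
by rewrite mulr1.
Qed.

End Cnv.

(** * Comparison of the inner product norm with the coordinates *)

Section InnerProduct.
Variables (R : realType) (q : R * R * R).
Hypothesis hq : is_inner q.

(** Completing the square: with [D] the determinant of [q], [D * y.1^2] plus a square equals
    [q.2 * normsq q y], and symmetrically for [y.2]. *)
Lemma normsq_small : exists2 c : R, 0 < c & forall (y : R * R) (e : R), 0 < e ->
  normsq q y < e ^+ 2 -> `|y.1| <= c * e /\ `|y.2| <= c * e.
Proof.
have [q1 qD] := hq; pose D := q.1.1 * q.2 - q.1.2 ^+ 2.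
have q2 : 0 < q.2.
  rewrite -(pmulr_rgt0 _ q1); apply: le_lt_trans (sqr_ge0 q.1.2) _.
  by rewrite -subr_gt0.
(* This choice avoids a square root: [c^2 >= c - 1], and [D * (c - 1) = q.1.1 + q.2] dominates both
   diagonal entries. *)
pose c := 1 + (q.1.1 + q.2) / D.
have c1 : 1 <= c.
  by rewrite lerDl divr_ge0//; [rewrite addr_ge0// ltW|exact: ltW].
exists c; first by apply: lt_le_trans c1.
move=> y e e0 yq.
have h (z w r : R) : 0 < r -> r <= q.1.1 + q.2 ->
    D * z ^+ 2 + w ^+ 2 = r * normsq q y -> `|z| <= c * e.
  move=> r0 rle hzw.
  have ce : 0 <= c * e by rewrite mulr_ge0// ltW// (lt_le_trans _ c1).
  rewrite -(ler_pXn2r (n := 2))// ?nnegrE// real_normK ?num_real//.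
  rewrite -(ler_pM2l qD) -/D.
  apply: (@le_trans _ _ (r * e ^+ 2)).
    apply: (@le_trans _ _ (r * normsq q y)); last by rewrite ler_pM2l// ltW.
    by rewrite -hzw lerDl sqr_ge0.
  apply: (@le_trans _ _ ((q.1.1 + q.2) * e ^+ 2)).
    by rewrite ler_wpM2r// sqr_ge0.
  have -> : D * (c * e) ^+ 2 = D * c ^+ 2 * e ^+ 2 by ring.
  apply: ler_wpM2r; first exact: sqr_ge0.
  have -> : q.1.1 + q.2 = D * (c - 1).
    by rewrite /c addrAC subrr add0r mulrC divfK// gt_eqF.
  rewrite ler_pM2l//; nra.
split.
  apply: (h _ (q.1.2 * y.1 + q.2 * y.2) q.2) => //; first by lra.
  by rewrite /normsq /inner_prod /D; ring.
apply: (h _ (q.1.1 * y.1 + q.1.2 * y.2) q.1.1) => //; first by lra.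
by rewrite /normsq /inner_prod /D; ring.
Qed.

Lemma inner_prodE (x y : R * R) : inner_prod q x y =
  lin (q.1.1 * y.1 + q.1.2 * y.2, q.1.2 * y.1 + q.2 * y.2) x.
Proof. by rewrite /inner_prod /lin /=; ring. Qed.

End InnerProduct.

Section LocBounded.
Variable R : realType.
Implicit Types G H : R * R -> R.

Lemma loc_bounded_cst (a : R) : loc_bounded (fun=> a).
Proof. by split; [exact: measurable_cst|move=> r; exists `|a|]. Qed.

Lemma loc_bounded_lin (m : R * R) : loc_bounded (lin m).
Proof.
split.
  apply: measurable_funD.
    exact: (measurable_funM (measurable_cst m.1) measurable_fst).
  exact: (measurable_funM (measurable_cst m.2) measurable_snd).
move=> r; exists (`|m.1| * r + `|m.2| * r) => x /box2P[x1 x2].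
by rewrite (le_trans (ler_normD _ _))// lerD// normrM ler_wpM2l.
Qed.

Lemma loc_boundedM G H : loc_bounded G -> loc_bounded H ->
  loc_bounded (fun x => G x * H x).
Proof.
move=> [mG bG] [mH bH]; split; first exact: measurable_funM.
move=> r; have [C hC] := bG r; have [D hD] := bH r; exists (C * D) => x xr.
by rewrite normrM ler_pM// ?hC ?hD.
Qed.

Lemma loc_bounded_max G H : loc_bounded G -> loc_bounded H ->
  loc_bounded (fun x => Num.max (G x) (H x)).
Proof.
move=> [mG bG] [mH bH]; split; first exact: measurable_maxr.
move=> r; have [C hC] := bG r; have [D hD] := bH r; exists (C + D) => x xr.
have := hC _ xr; have := hD _ xr; rewrite !ler_norml => /andP[? ?] /andP[? ?].
by rewrite /Num.max; case: ifP => _; lra.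
Qed.

End LocBounded.

(** * The normalized bump and its directional derivatives as kernels *)

Section BumpKernel.
Variables (R : realType) (q : R * R * R) (e : R).
Hypotheses (hq : is_inner q) (e0 : 0 < e).
Let Q := normsq q.
Let B := inner_prod q.

Lemma bumpE y : Defs.bump q e y = beta 0 (e ^+ 2 - Q y).
Proof.
rewrite /Defs.bump /beta subr_gt0; case: ifP => // _.
by rewrite expr0 !mul1r -invrN opprB.
Qed.

Lemma kernel_beta k : kernel (fun y => beta k (e ^+ 2 - Q y)).
Proof.
split.
  apply: (measurableT_comp (continuous_measurable_fun (@continuous_beta R k))).
  apply: (measurable_funB (measurable_cst (e ^+ 2))).
  rewrite (_ : Q = fun y => lin (q.1.1, q.1.2) y * y.1 + lin (q.1.2, q.2) y * y.2).
    apply: measurable_funD; apply: measurable_funM => //.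
    - exact: (loc_bounded_lin _).1.
    - exact: (loc_bounded_lin _).1.
  by apply/funext => y; rewrite /Q /normsq /inner_prod /lin/=; ring.
have [c c0 hc] := normsq_small hq.
exists (c * e), k`!%:R => y; rewrite ger0_norm ?beta_ge0// beta_le_fact; split=> // nb.
rewrite /beta; case: ifPn => //; rewrite subr_gt0 => yq; exfalso; apply: nb.
by apply/box2P; exact: hc.
Qed.

Let A := A_eps q e.

(** [Dmu xi] is the derivative of [mu_eps] along [xi], and [DDmu xi eta] that of [Dmu xi] along
    [eta]. The indices come from [beta 0' = beta 2] and [beta 2' = beta 4 - 2 * beta 3], composed
    with [e^2 - Q], whose derivative along [xi] is [-2 * B y xi]. *)
Definition Dmu (xi y : R * R) : R :=
  A^-1 * ((- 2 * B y xi) * beta 2 (e ^+ 2 - Q y)).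

Definition DDmu (xi eta y : R * R) : R :=
  A^-1 * ((4 * (B y xi * B y eta)) * beta 4 (e ^+ 2 - Q y) +
   ((- 8 * (B y xi * B y eta)) * beta 3 (e ^+ 2 - Q y) +
    (- 2 * B xi eta) * beta 2 (e ^+ 2 - Q y))).

Lemma loc_bounded_inner (xi : R * R) : loc_bounded (B^~ xi).
Proof.
rewrite (_ : B^~ xi = lin (q.1.1 * xi.1 + q.1.2 * xi.2, q.1.2 * xi.1 + q.2 * xi.2)).
  exact: loc_bounded_lin.
by apply/funext => y; rewrite /B inner_prodE.
Qed.

Lemma mu_epsE y : mu_eps q e y = A^-1 * beta 0 (e ^+ 2 - Q y).
Proof. by rewrite /mu_eps bumpE. Qed.

Lemma kernel_mu : kernel (mu_eps q e).
Proof.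
rewrite (_ : mu_eps q e = fun y => A^-1 * beta 0 (e ^+ 2 - Q y)); last first.
  by apply/funext => y; rewrite mu_epsE.
by apply: kernelZ; exact: kernel_beta.
Qed.

Lemma kernel_Dmu (xi : R * R) : kernel (Dmu xi).
Proof.
apply: kernelZ; apply: kernelMl; last exact: kernel_beta.
apply: loc_boundedM; [exact: loc_bounded_cst|exact: loc_bounded_inner].
Qed.

Lemma kernel_DDmu (xi eta : R * R) : kernel (DDmu xi eta).
Proof.
apply: kernelZ; apply: kernelD; last apply: kernelD.
- apply: kernelMl; last exact: kernel_beta.
  apply: loc_boundedM; first exact: loc_bounded_cst.
  by apply: loc_boundedM; exact: loc_bounded_inner.
- apply: kernelMl; last exact: kernel_beta.
  apply: loc_boundedM; first exact: loc_bounded_cst.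
  by apply: loc_boundedM; exact: loc_bounded_inner.
- by apply: kernelMl; [exact: loc_bounded_cst|exact: kernel_beta].
Qed.

Lemma is_derive_quad (a b c t : R) :
  is_derive t 1 (fun s : R => a + b * s + c * s ^+ 2) (b + 2 * c * t).
Proof.
have d1 := is_deriveD (is_derive_cst a t 1) (is_deriveZ b (is_derive_id t (1 : R))).
have d2 := is_deriveZ c (is_deriveX 2 (is_derive_id t (1 : R))).
apply: (is_derive_eq (is_deriveD d1 d2)).
by rewrite /GRing.scale/= expr1; ring.
Qed.

Lemma is_derive_level (y xi : R * R) (t : R) :
  is_derive t 1 (fun s : R => e ^+ 2 - Q (y + s *: xi)) (- 2 * B (y + t *: xi) xi).
Proof.
rewrite (_ : (fun s : R => _) =
  fun s => (e ^+ 2 - Q y) + (- 2 * B y xi) * s + (- Q xi) * s ^+ 2); last first.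
  by apply/funext => s; rewrite /Q /B /normsq /inner_prod /= /GRing.scale/=; ring.
apply: (is_derive_eq (is_derive_quad _ _ _ _)).
by rewrite /Q /B /normsq /inner_prod /= /GRing.scale/=; ring.
Qed.

Lemma is_derive_beta_level k (y xi : R * R) (t : R) :
  is_derive t 1 (fun s : R => beta k (e ^+ 2 - Q (y + s *: xi)))
    ((beta k.+2 (e ^+ 2 - Q (y + t *: xi)) - k%:R * beta k.+1 (e ^+ 2 - Q (y + t *: xi)))
     * (- 2 * B (y + t *: xi) xi)).
Proof.
exact: (is_derive1_comp (is_derive_beta k _) (is_derive_level y xi t)).
Qed.

Lemma is_derive_mu (y xi : R * R) (t : R) :
  is_derive t 1 (fun s : R => mu_eps q e (y + s *: xi)) (Dmu xi (y + t *: xi)).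
Proof.
rewrite (_ : (fun s : R => _) =
    A^-1 \*: (fun s : R => beta 0 (e ^+ 2 - Q (y + s *: xi)))); last first.
  by apply/funext => s; rewrite mu_epsE.
apply: (is_derive_eq (is_deriveZ A^-1 (is_derive_beta_level 0 y xi t))).
by rewrite /Dmu /GRing.scale/=; ring.
Qed.

Lemma is_derive_Dmu (xi eta y : R * R) (t : R) :
  is_derive t 1 (fun s : R => Dmu xi (y + s *: eta)) (DDmu xi eta (y + t *: eta)).
Proof.
have dB : is_derive t 1 (fun s : R => - 2 * B (y + s *: eta) xi) (- 2 * B xi eta).
  rewrite (_ : (fun s : R => _) =
     fun s => (- 2 * B y xi) + (- 2 * B xi eta) * s + 0 * s ^+ 2); last first.
    by apply/funext => s; rewrite /B /inner_prod /= /GRing.scale/=; ring.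
  apply: (is_derive_eq (is_derive_quad _ _ _ _)).
  by ring.
have d := is_deriveZ A^-1 (is_deriveM dB (is_derive_beta_level 2 y eta t)).
apply: (is_derive_eq d).
by rewrite /DDmu /GRing.scale/=; ring.
Qed.

Lemma Dmu_lin (xi y : R * R) :
  Dmu xi y = xi.1 * Dmu (1, 0) y + xi.2 * Dmu (0, 1) y.
Proof. by rewrite /Dmu /B /inner_prod/=; ring. Qed.

Lemma DDmu_quad (xi y : R * R) :
  DDmu xi xi y = xi.1 ^+ 2 * DDmu (1, 0) (1, 0) y +
   (xi.1 * xi.2 * (DDmu (1, 0) (0, 1) y + DDmu (0, 1) (1, 0) y) +
    xi.2 ^+ 2 * DDmu (0, 1) (0, 1) y).
Proof. by rewrite /DDmu /B /inner_prod/=; ring. Qed.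

End BumpKernel.

(** * Convex support functions on a complete plane fan *)

Section Plane.
Variable R : realType.
Local Notation V := (R * R)%type.
Implicit Types (x y a b c m : V) (s t : R).

Definition det2 a b : R := a.1 * b.2 - a.2 * b.1.

Lemma vecP x y : x.1 = y.1 -> x.2 = y.2 -> x = y.
Proof. by case: x => ? ?; case: y => ? ? /= -> ->. Qed.

Lemma linD m x y : lin m (x + y) = lin m x + lin m y.
Proof. by rewrite /lin /=; ring. Qed.

Lemma linZ m s x : lin m (s *: x) = s * lin m x.
Proof. by rewrite /lin /= /GRing.scale /=; ring. Qed.

Lemma linDl m m' x : lin (m + m') x = lin m x + lin m' x.
Proof. by rewrite /lin /=; ring. Qed.

Lemma linZl s m x : lin (s *: m) x = s * lin m x.
Proof. by rewrite /lin /= /GRing.scale /=; ring. Qed.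

Lemma linNl m x : lin (- m) x = - lin m x.
Proof. by rewrite /lin /=; ring. Qed.

Lemma coordE a b x : det2 a b != 0 ->
  x = (det2 x b / det2 a b) *: a + (det2 a x / det2 a b) *: b.
Proof.
move=> D0; apply: vecP; rewrite /= /GRing.scale /=;
  move: D0; rewrite /det2 => D0; by field.
Qed.

Lemma coord_inj a b s t s' t' : det2 a b != 0 ->
  s *: a + t *: b = s' *: a + t' *: b -> s = s' /\ t = t'.
Proof.
move=> D0 h.
have h1 : det2 (s *: a + t *: b) b = det2 (s' *: a + t' *: b) b by rewrite h.
have h2 : det2 a (s *: a + t *: b) = det2 a (s' *: a + t' *: b) by rewrite h.
split; apply: (mulIf D0); move: h1 h2; rewrite /det2 /= /GRing.scale /= => h1 h2; lra.
Qed.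

(** The linear form with value [u] at [a] and [v] at [b], by Cramer's rule. *)
Definition cramer a b (u v : R) : V :=
  ((u * b.2 - v * a.2) / det2 a b, (a.1 * v - b.1 * u) / det2 a b).

Lemma cramerl a b u v : det2 a b != 0 -> lin (cramer a b u v) a = u.
Proof. by rewrite /lin /cramer /= /det2 => D0; field. Qed.

Lemma cramerr a b u v : det2 a b != 0 -> lin (cramer a b u v) b = v.
Proof. by rewrite /lin /cramer /= /det2 => D0; field. Qed.

Lemma lin_inj a b m m' : det2 a b != 0 -> lin m a = lin m' a -> lin m b = lin m' b ->
  m = m'.
Proof.
move=> D0 ha hb; apply: vecP; apply: (mulfI D0); move: ha hb;
  rewrite /lin /det2 => ha hb.
  transitivity (b.2 * (m.1 * a.1 + m.2 * a.2) - a.2 * (m.1 * b.1 + m.2 * b.2)); first by ring.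
  by rewrite ha hb; ring.
transitivity (a.1 * (m.1 * b.1 + m.2 * b.2) - b.1 * (m.1 * a.1 + m.2 * a.2)); first by ring.
by rewrite ha hb; ring.
Qed.

(** Coordinates along the segment from [(s, t)], in the closed quadrant, to [(p, r)], outside it:
    when the first coordinate vanishes, the other is still nonnegative. Read in a cone, the segment
    leaves through one of the two bounding rays. *)
Lemma segment_exit s t p r : 0 <= s -> 0 <= t -> p < 0 \/ r < 0 ->
  exists2 u : R, 0 <= u <= 1 &
   ((1 - u) * s + u * p = 0 /\ 0 <= (1 - u) * t + u * r) \/
   ((1 - u) * t + u * r = 0 /\ 0 <= (1 - u) * s + u * p).
Proof.
move=> s0 t0.
(* The cross-multiplied inequality says [s / (s - p) <= t / (t - r)]: the first coordinate is the
   earlier one to vanish. *)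
wlog : s t p r s0 t0 / p < 0 /\ (r < 0 -> s * (t - r) <= t * (s - p)).
  move=> H h.
  have [rn|r0] := ltP r 0; last first.
    have pn : p < 0 by case: h => //; rewrite ltNge r0.
    by apply: H => //; split => //; rewrite ltNge r0.
  have [pn|p0] := ltP p 0; last first.
    have [||u u01 hu] := H t s r p t0 s0; [by split => //; rewrite ltNge p0|by left|].
    by exists u => //; case: hu; [right|left].
  have [le|lt] := leP (s * (t - r)) (t * (s - p)).
    by apply: H => //; left.
  have [||u u01 hu] := H t s r p t0 s0; [by split => // _; exact: ltW|by left|].
  by exists u => //; case: hu; [right|left].
move=> [pn hr] _.
have sp : 0 < s - p by lra.
exists (s / (s - p)).
  by rewrite divr_ge0 ?(ltW sp)//= ler_pdivrMr// mul1r; lra.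
have spn : s - p != 0 by exact: lt0r_neq0.
left; split; first by field.
rewrite (_ : _ + _ = (- p * t + s * r) / (s - p)); last by field.
rewrite divr_ge0 ?(ltW sp)//.
have [/hr h|r0] := ltP r 0; first by lra.
by nra.
Qed.

End Plane.

Section Fan.
Variable R : realType.
Local Notation V := (R * R)%type.
Implicit Types (x y a b c d m : V) (s t h : R).

(* [E] lists every maximal cone twice, as the ordered pairs [(a, b)] and [(b, a)] of
   its generators. *)
Record fan (E : seq (V * V)) : Prop := Fan {
  fan_sym : forall a b, (a, b) \in E -> (b, a) \in E;
  fan_det : forall a b, (a, b) \in E -> det2 a b != 0;
  fan_complete : forall x, exists a b s t,
    [/\ (a, b) \in E, 0 <= s, 0 <= t & x = s *: a + t *: b];
  fan_opp : forall a b, (a, b) \in E ->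
    exists2 c, (a, c) \in E & det2 a b * det2 a c < 0;
  fan_agree : forall a b c d s t s' t', (a, b) \in E -> (c, d) \in E ->
    0 < s -> 0 <= t -> 0 <= s' -> 0 <= t' ->
    s *: a + t *: b = s' *: c + t' *: d ->
    (a = c /\ s = s') \/ (a = d /\ s = t') }.

(** The gradient of [theta] on the cone of [a] and [b]; these forms are the vertices of [K]. *)
Definition piece (th : V -> R) a b : V := cramer a b (th a) (th b).

Record strict_support (E : seq (V * V)) (th : V -> R) : Prop := StrictSupport {
  sup_lin : forall a b s t, (a, b) \in E -> 0 <= s -> 0 <= t ->
    th (s *: a + t *: b) = s * th a + t * th b;
  sup_convex : convex_fun th;
  sup_strict : forall a b c, (a, b) \in E -> (a, c) \in E ->
    det2 a b * det2 a c < 0 -> piece th a b <> piece th a c }.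

Variables (E : seq (V * V)) (th : V -> R).
Hypotheses (fE : fan E) (sth : strict_support E th).

Lemma piecel a b : (a, b) \in E -> lin (piece th a b) a = th a.
Proof. by move=> /(fan_det fE) D; exact: cramerl. Qed.

Lemma piecer a b : (a, b) \in E -> lin (piece th a b) b = th b.
Proof. by move=> /(fan_det fE) D; exact: cramerr. Qed.

Lemma th_homog s x : 0 <= s -> th (s *: x) = s * th x.
Proof.
move=> s0; have [a [b [u [v [ab u0 v0 ->]]]]] := fan_complete fE x.
rewrite scalerDr !scalerA !(sup_lin sth ab)// ?mulr_ge0//; ring.
Qed.

Lemma th_subadd x y : th (x + y) <= th x + th y.
Proof.
have h := sup_convex sth (2 *: x) (2 *: y) (t := 2^-1).
have : th (2^-1 *: (2 *: x) + (1 - 2^-1) *: (2 *: y)) <=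
   2^-1 * th (2 *: x) + (1 - 2^-1) * th (2 *: y) by apply: h; lra.
have -> : (1 - 2^-1 : R) = 2^-1 by lra.
rewrite !th_homog// !scalerA mulVf// !scale1r; lra.
Qed.

Lemma th_add_ray a b s t h : (a, b) \in E -> 0 <= s -> 0 <= t -> 0 <= h ->
  th (s *: a + t *: b + h *: a) = th (s *: a + t *: b) + h * th a.
Proof.
move=> ab s0 t0 h0.
have -> : s *: a + t *: b + h *: a = (s + h) *: a + t *: b.
  by rewrite scalerDl addrAC.
by rewrite !(sup_lin sth ab)// ?addr_ge0//; ring.
Qed.

Lemma piece_cone a b s t : (a, b) \in E -> 0 <= s -> 0 <= t ->
  th (s *: a + t *: b) = lin (piece th a b) (s *: a + t *: b).
Proof.
by move=> ab s0 t0; rewrite (sup_lin sth ab)// linD !linZ piecel// piecer.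
Qed.

(** Adding a large multiple of [a + b] moves [x] into the cone of [a] and [b], where [th] is the
    linear piece; subadditivity then carries the comparison back to [x]. *)
Lemma piece_le a b x : (a, b) \in E -> lin (piece th a b) x <= th x.
Proof.
move=> ab; have D := fan_det fE ab.
rewrite (coordE x D); set p := _ / _; set r := _ / _.
pose N := `|p| + `|r|.
have N0 : 0 <= N by rewrite addr_ge0.
have hp : 0 <= p + N by have := ler_norm (- p); rewrite normrN /N; have := normr_ge0 r; lra.
have hr : 0 <= r + N by have := ler_norm (- r); rewrite normrN /N; have := normr_ge0 p; lra.
have := th_subadd (p *: a + r *: b) (N *: a + N *: b).
have -> : p *: a + r *: b + (N *: a + N *: b) = (p + N) *: a + (r + N) *: b.
  by rewrite !scalerDl addrACA.
rewrite (sup_lin sth ab hp hr) (sup_lin sth ab N0 N0) linD !linZ piecel// piecer//; lra.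
Qed.

Definition polar m := forall a b, (a, b) \in E -> lin m a <= th a.

Lemma polar_piece a b : (a, b) \in E -> polar (piece th a b).
Proof. by move=> ab c d cd; exact: piece_le. Qed.

(** Equality at [c] would make the two adjacent pieces agree on the basis [a], [c], against
    strictness. *)
Lemma piece_lt a b c : (a, b) \in E -> (a, c) \in E -> det2 a b * det2 a c < 0 ->
  lin (piece th a b) c < th c.
Proof.
move=> ab ac D; rewrite lt_neqAle piece_le// andbT; apply/eqP => h.
apply: (sup_strict sth ab ac D).
apply: (lin_inj (fan_det fE ac)); first by rewrite !piecel.
by rewrite h piecer.
Qed.

Lemma opp_coord a b c : det2 a b * det2 a c < 0 ->
  exists k l : R, 0 < l /\ c = k *: a - l *: b.
Proof.
move=> D; have D0 : det2 a b != 0 by apply/eqP => h; move: D; rewrite h mul0r ltxx.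
exists (det2 c b / det2 a b), (- (det2 a c / det2 a b)); split; last first.
  by rewrite scaleNr opprK; exact: coordE.
have -> : - (det2 a c / det2 a b) = - (det2 a b * det2 a c) / det2 a b ^+ 2.
  by field.
by rewrite divr_gt0 ?oppr_gt0// exprn_even_gt0.
Qed.

(** On the line [lin m a = th a] the form [m] is determined by [lin m b]. The constraint at [b]
    bounds this number above by the value of the piece on [(a, b)]; the constraint at
    [c = k a - l b] bounds it below by the value of the piece on [(a, c)]. *)
Lemma face_segment a b c m : (a, b) \in E -> (a, c) \in E -> det2 a b * det2 a c < 0 ->
  polar m -> lin m a = th a ->
  exists2 t, 0 <= t <= 1 & m = (1 - t) *: piece th a b + t *: piece th a c.
Proof.
move=> ab ac D Km ma.
have [k [l [l0 cE]]] := opp_coord D.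
have mb := Km _ _ (fan_sym fE ab); have mc := Km _ _ (fan_sym fE ac).
have bc : lin (piece th a c) b < th b.
  by apply: piece_lt => //; rewrite mulrC.
pose t := (th b - lin m b) / (th b - lin (piece th a c) b).
have den : 0 < th b - lin (piece th a c) b by rewrite subr_gt0.
have cE' : lin (piece th a c) c = th c by rewrite piecer.
have lincE m' : lin m' c = k * lin m' a - l * lin m' b.
  by rewrite cE /lin /= /GRing.scale /=; ring.
rewrite lincE piecel// in cE'; rewrite lincE ma -cE' in mc.
exists t.
  rewrite /t divr_ge0 ?(ltW den)//= ?subr_ge0// ler_pdivrMr// mul1r.
  have : l * lin (piece th a c) b <= l * lin m b by lra.
  by rewrite ler_pM2l//; lra.
apply: (lin_inj (fan_det fE ab)).
  by rewrite linDl !linZl !piecel// ma; ring.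
rewrite linDl !linZl piecer// /t; field; exact: lt0r_neq0.
Qed.

Definition additive_along a x := forall h, 0 <= h -> th (x + h *: a) = th x + h * th a.

Lemma additive_cone a b s t : (a, b) \in E -> 0 <= s -> 0 <= t ->
  additive_along a (s *: a + t *: b).
Proof. by move=> ab s0 t0 h h0; exact: th_add_ray ab _ _ _. Qed.

(** The value [s = 0] is allowed, so a set containing the origin meets every ray. *)
Definition meets_ray (D : set V) a :=
  exists b s, [/\ (a, b) \in E, 0 <= s & D (s *: a)].

Definition segment_closed (D : set V) :=
  forall x y t, D x -> D y -> 0 <= t <= 1 -> D ((1 - t) *: x + t *: y).

(** If [x], on the same side of the line of [a] as [b], had a negative coefficient on [a], the
    segment from [s *: a] to [x] would cross the ray of [b] inside [D]. Hence [x] is in the cone of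
    [a] and [b]. *)
Lemma additive_half (D : set V) a b s x :
  segment_closed D -> (a, b) \in E -> 0 <= s -> D (s *: a) ->
  ~ meets_ray D b -> D x -> 0 <= det2 a x / det2 a b -> additive_along a x.
Proof.
move=> cD ab s0 Ds nb Dx r0; have Dab := fan_det fE ab.
move: r0 (coordE x Dab); set p := det2 x b / _; set r := det2 a x / _ => r0 xE.
rewrite xE in Dx *; clearbody p r; clear xE.
have [p0|pn] := leP 0 p; first exact: additive_cone.
have sp : 0 < s - p by lra.
have e1 : 1 - s / (s - p) = - p / (s - p).
  by rewrite -{1}(divff (lt0r_neq0 sp)) -mulrBl; congr (_ / _); ring.
exfalso; apply: nb; exists a, (s / (s - p) * r); split.
- exact: (fan_sym fE ab).
- by rewrite mulr_ge0// divr_ge0// ltW.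
- have := cD _ _ (s / (s - p)) Ds Dx.
  have -> : (1 - s / (s - p)) *: (s *: a) + (s / (s - p)) *: (p *: a + r *: b) =
     (s / (s - p) * r) *: b.
    rewrite scalerDr !scalerA addrA -scalerDl e1 mulrAC -[s / _ * p]mulrAC -mulrDl.
    by rewrite (_ : - p * s + s * p = 0) ?mul0r ?scale0r ?add0r//; ring.
  by apply; rewrite divr_ge0 ?(ltW sp)//= ler_pdivrMr// mul1r; lra.
Qed.

(* Applied to the ball of radius [e] around [b]: the first case makes the Hessian of the
   smoothing definite at [b], the second puts its gradient on the edge dual to [a]. *)
Lemma ray_dichotomy (D : set V) (x0 : V) : segment_closed D -> D x0 ->
  (exists a b, [/\ meets_ray D a, meets_ray D b & det2 a b != 0]) \/
  (exists a b, (a, b) \in E /\ forall x, D x -> additive_along a x).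
Proof.
move=> cD Dx0.
have [[a [b [s [ab s0 Ds]]]]|none] := pselect (exists a, meets_ray D a).
- have [two|ntwo] := pselect (exists a b, [/\ meets_ray D a, meets_ray D b & det2 a b != 0]).
    by left.
  right; exists a, b; split => // x Dx.
  have nm c : (a, c) \in E -> ~ meets_ray D c.
    move=> ac mc; apply: ntwo; exists a, c; split => //; last exact: (fan_det fE ac).
    by exists b, s.
  have [c ac Dbc] := fan_opp fE ab.
  have [h|h] := leP 0 (det2 a x / det2 a b).
    exact: (additive_half cD ab s0 Ds (nm _ ab) Dx h).
  apply: (additive_half cD ac s0 Ds (nm _ ac) Dx).
  have Dab := fan_det fE ab; have Dac := fan_det fE ac.
  have -> : det2 a x / det2 a c =
     (det2 a x / det2 a b) * (det2 a b * det2 a c) / (det2 a c) ^+ 2 by field; rewrite Dac Dab.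
  by rewrite divr_ge0 ?sqr_ge0// mulr_le0// ltW.
(* With no ray met, [D] stays in one cone containing [x0]: a segment leaving it would cross a
   bounding ray. *)
- have [a [b [s [t [ab s0 t0 x0E]]]]] := fan_complete fE x0.
  right; exists a, b; split => // x Dx.
  have Dab := fan_det fE ab.
  move: Dx; rewrite (coordE x Dab); set p := _ / _; set r := det2 a _ / _ => Dx.
  have [[p0 r0]|pr] := pselect (0 <= p /\ 0 <= r); first exact: additive_cone.
  have h : p < 0 \/ r < 0.
    have [p0|] := leP 0 p; last by left.
    by have [r0|] := leP 0 r; [case: pr|right].
  have [u u01 hu] := segment_exit s0 t0 h.
  exfalso; apply: none.
  have := cD _ _ _ Dx0 Dx u01; rewrite x0E.
  have -> : (1 - u) *: (s *: a + t *: b) + u *: (p *: a + r *: b) =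
     ((1 - u) * s + u * p) *: a + ((1 - u) * t + u * r) *: b.
    by rewrite !scalerDr !scalerA addrACA -!scalerDl.
  case: hu => -[-> ge0]; rewrite scale0r ?addr0 ?add0r => Du.
    by exists b, a, ((1 - u) * t + u * r); split => //; exact: (fan_sym fE ab).
  by exists a, b, ((1 - u) * s + u * p); split.
Qed.

(** Requiring the property for all smaller radii makes the minimum of the individual thresholds
    admissible. *)
Lemma finite_threshold (T : eqType) (S : seq T) (P : T -> R -> Prop) :
  (forall p, p \in S -> exists2 r : R, 0 < r & forall r', 0 < r' <= r -> P p r') ->
  exists2 r : R, 0 < r & forall p, p \in S -> forall r', 0 < r' <= r -> P p r'.
Proof.
elim: S => [_|p S IH h]; first by exists 1.
have [r1 r10 h1] := h p (mem_head _ _).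
have [|r2 r20 h2] := IH; first by move=> p' p'S; apply: h; rewrite inE p'S orbT.
exists (Num.min r1 r2) => [|p']; first by rewrite lt_min r10.
rewrite inE => /orP[/eqP ->|p'S] r' /andP[r'0]; rewrite le_min => /andP[? ?].
  by apply: h1; rewrite r'0.
by apply: h2; rewrite // r'0.
Qed.

Lemma coord_bound a b : det2 a b != 0 -> exists2 C : R, 0 < C & forall (x : V) (r : R),
  `|x.1| <= r -> `|x.2| <= r ->
  `|det2 x b / det2 a b| <= C * r /\ `|det2 a x / det2 a b| <= C * r.
Proof.
move=> D; pose S := `|a.1| + `|a.2| + `|b.1| + `|b.2|.
have D0 : 0 < `|det2 a b| by rewrite normr_gt0.
have S0 : 0 <= S by rewrite !addr_ge0.
exists ((1 + S) / `|det2 a b|); first by rewrite divr_gt0//; lra.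
move=> x r x1 x2.
have r0 : 0 <= r by apply: le_trans x1.
have n1 (u v w z : R) : `|u| <= r -> `|v| <= r -> `|w| + `|z| <= S ->
    `|(u * w - v * z) / det2 a b| <= (1 + S) / `|det2 a b| * r.
  move=> ur vr wz; rewrite normf_div mulrAC ler_pM2r ?invr_gt0//.
  apply: le_trans (ler_normB _ _) _; rewrite !normrM.
  have := ler_wpM2r (normr_ge0 w) ur; have := ler_wpM2r (normr_ge0 z) vr.
  have := ler_wpM2r r0 wz; lra.
have := normr_ge0 a.1; have := normr_ge0 a.2; have := normr_ge0 b.1; have := normr_ge0 b.2.
move=> *; split; first by apply: n1 => //; rewrite /S; lra.
rewrite (_ : det2 a x = x.2 * a.1 - x.1 * a.2); last by rewrite /det2; ring.
by apply: n1 => //; rewrite /S; lra.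
Qed.

(* [0 <= t <= s] and [2 * s + t = 1] describe the segment from [a / 2] to [(a + b) / 3],
   the barycenters of the edge [0, a] and of the triangle [0, a, b]. *)
Lemma additive_bdry : exists2 r : R, 0 < r & forall a b s t y, (a, b) \in E ->
  0 <= t <= s -> 2 * s + t = 1 -> `|y.1| <= r -> `|y.2| <= r ->
  additive_along a (s *: a + t *: b - y).
Proof.
have [[a b] /= abE|r r0 hr] := @finite_threshold _ E (fun p r => forall s t y,
  0 <= t <= s -> 2 * s + t = 1 -> `|y.1| <= r -> `|y.2| <= r ->
  additive_along p.1 (s *: p.1 + t *: p.2 - y)); last first.
  by exists r => // a b s t y ab; apply: (hr _ ab); rewrite r0 lexx.
have Dab := fan_det fE abE.
have [c ac Dbc] := fan_opp fE abE.
have [k [l [l0 cE]]] := opp_coord Dbc.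
have [C C0 hC] := coord_bound Dab.
have bE : b = (k / l) *: a - l^-1 *: c.
  rewrite cE scalerBr !scalerA mulVf ?lt0r_neq0// scale1r (mulrC l^-1).
  by rewrite opprB addrC subrK.
pose N := 1 + `|k / l|.
have N0 : 0 < N by rewrite /N; have := normr_ge0 (k / l); lra.
(* The budget is [s >= 1/3]. The perturbation [y] takes at most [1/6] from the coefficient of [a];
   if it also pushes the point across the ray of [a], rewriting [b] in terms of [a] and [c] takes at
   most another [1/6]. *)
exists (6^-1 / (C * N)); first by rewrite divr_gt0// ?mulr_gt0//; lra.
move=> r /andP[r0 rle] s t y /andP[t0 ts] st y1 y2.
have CNr : C * r * N <= 6^-1 by move: rle; rewrite ler_pdivlMr ?mulr_gt0// => ?; lra.
have [] := hC y r y1 y2; move: (coordE y Dab).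
set u := _ / _; set v := det2 a _ / _ => yE hu hv.
have Cr : 0 < C * r by rewrite mulr_gt0.
have Cr6 : C * r <= 6^-1.
  apply: le_trans CNr; rewrite ler_peMr ?(ltW Cr)// /N lerDl//.
have Ckl : C * r * `|k / l| <= 6^-1.
  by apply: le_trans CNr; rewrite ler_pM2l// /N; lra.
have xE : s *: a + t *: b - y = (s - u) *: a + (t - v) *: b.
  by rewrite yE opprD addrACA -!scalerBl.
have s3 : 3^-1 <= s by lra.
have u6 : u <= 6^-1 by apply: le_trans (ler_norm _) _; lra.
have [tv|vt] := leP 0 (t - v).
  by rewrite xE; apply: additive_cone => //; lra.
have -> : s *: a + t *: b - y = (s - u - (v - t) * (k / l)) *: a + ((v - t) / l) *: c.
  rewrite xE {1}bE scalerBr !scalerA addrA -scalerDl -scaleNr.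
  by congr (_ *: _ + _ *: _); ring.
apply: additive_cone => //; last by rewrite divr_ge0 ?(ltW l0)//; lra.
have vC : v - t <= C * r by have := ler_norm v; lra.
have : (v - t) * (k / l) <= C * r * `|k / l|.
  apply: (@le_trans _ _ ((v - t) * `|k / l|)).
    by rewrite ler_wpM2l ?ler_norm//; lra.
  by rewrite ler_wpM2r.
by lra.
Qed.

(** The inequalities cut out the triangle [0], [a / 2], [(a + b) / 3]; the other half of the polygon
    inside this cone comes from the pair [(b, a)]. *)
Definition star_polygon x := exists a b s t,
  [/\ (a, b) \in E, 0 <= t <= s, 2 * s + t <= 1 & x = s *: a + t *: b].

(** By [fan_agree] the positive coefficients of a point do not depend on the cone used to write it,
    so after dilation twice the larger plus the smaller exceeds [1] in every representation. *)
Lemma star_polygon_bdry a b s t (eta : R) : (a, b) \in E -> 0 <= t <= s ->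
  2 * s + t = 1 -> 0 < eta -> ~ star_polygon ((1 + eta) *: (s *: a + t *: b)).
Proof.
move=> ab /andP[t0 ts] st eta0 [c [d [s' [t' [cd /andP[t'0 ts'] st' h]]]]].
rewrite scalerDr !scalerA in h.
have e1 : 0 < 1 + eta by lra.
have s0 : 0 < s by lra.
have s'0 : 0 <= s' by exact: le_trans ts'.
have es : 0 < (1 + eta) * s by rewrite mulr_gt0.
have et : 0 <= (1 + eta) * t by rewrite mulr_ge0// ltW.
have big : 1 < 2 * ((1 + eta) * s) + (1 + eta) * t.
  by rewrite mulrCA -mulrDr st mulr1; lra.
have [[ac ss]|[ad ss]] := fan_agree fE ab cd es et s'0 t'0 h; last first.
  have := ler_wpM2l (ltW e1) ts; lra.
have [tz|tn] := eqVneq t 0; first by move: big; rewrite tz mulr0; lra.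
have et' : 0 < (1 + eta) * t by rewrite mulr_gt0// lt_def tn.
have h' : (1 + eta) * t *: b + (1 + eta) * s *: a = s' *: c + t' *: d by rewrite addrC.
have [[bc _]|[bd tt]] := fan_agree fE (fan_sym fE ab) cd et' (ltW es) s'0 t'0 h'.
  by have := fan_det fE ab; rewrite ac bc /det2 mulrC subrr eqxx.
by lra.
Qed.

(** Each cone [(c, d)] is treated separately. If it contains the point, the strict inequality leaves
    room there; if not, some coordinate of the point is negative and stays so nearby, so the cone is
    not reached. *)
Lemma star_polygon_interior a b s t : (a, b) \in E -> 0 <= t <= s ->
  2 * s + t < 1 -> exists2 r : R, 0 < r & forall z : V, `|z.1| < r -> `|z.2| < r ->
  star_polygon (s *: a + t *: b + z).
Proof.
move=> ab /andP[t0 ts] st; set x := s *: a + t *: b.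
have s0 : 0 <= s by exact: le_trans ts.
have [[c d] /= cd|r r0 hr] := @finite_threshold _ E (fun p r => forall z u v,
  `|z.1| < r -> `|z.2| < r -> 0 <= v -> v <= u -> x + z = u *: p.1 + v *: p.2 ->
  2 * u + v <= 1); last first.
  exists r => // z z1 z2.
  have [c [d [u [v [cd u0 v0 zE]]]]] := fan_complete fE (x + z).
  have [vu|uv] := leP v u.
    exists c, d, u, v; split => //; first by rewrite v0.
    by apply: (hr (c, d) cd r _ z u v); rewrite ?r0 ?lexx.
  exists d, c, v, u; split => //; last by rewrite zE addrC.
  - exact: (fan_sym fE cd).
  - by rewrite u0 ltW.
  - apply: (hr (d, c) (fan_sym fE cd) r _ z v u); rewrite ?r0 ?lexx// ?(ltW uv)//.
    by rewrite zE addrC.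
have D := fan_det fE cd.
have [C C0 hC] := coord_bound D.
move: (coordE x D); set s' := _ / _; set t' := det2 c _ / _ => xE.
have uvE (z : V) u v : x + z = u *: c + v *: d ->
    u = s' + det2 z d / det2 c d /\ v = t' + det2 c z / det2 c d.
  rewrite {1}xE {1}(coordE z D) addrACA -!scalerDl => /esym.
  exact: coord_inj.
have [[s'0 t'0]|neg] := pselect (0 <= s' /\ 0 <= t').
  have st' : 2 * s' + t' < 1.
    (* Positive coordinates in the basis [c], [d] are among [s] and [t], attached to distinct
       generators, so at worst they are [s] and [t] exchanged. *)
    have hs : 0 < s' -> (c = a /\ s' = s) \/ (c = b /\ s' = t).
      by move=> s'p; apply: (fan_agree fE cd ab s'p t'0 s0 t0); exact: esym.
    have ht : 0 < t' -> (d = a /\ t' = s) \/ (d = b /\ t' = t).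
      move=> t'p; apply: (fan_agree fE (fan_sym fE cd) ab t'p s'0 s0 t0).
      by rewrite addrC; exact: esym.
    have cNd : c <> d.
      by move=> h; move: D; rewrite h /det2 mulrC subrr eqxx.
    have [sz|/hs hs'] := leP s' 0; have [tz|/ht ht'] := leP t' 0.
    - lra.
    - by case: ht' => -[_ ?]; lra.
    - by case: hs' => -[_ ?]; lra.
    - case: hs' => -[ca ?]; case: ht' => -[da ?]; try lra.
      by case: cNd; rewrite ca da.
  exists ((1 - (2 * s' + t')) / (4 * C)).
    by rewrite divr_gt0// ?mulr_gt0//; lra.
  move=> r /andP[r0 rle] z u v z1 z2 v0 vu /uvE[-> ->].
  have [] := hC z r (ltW z1) (ltW z2).
  move: rle; rewrite ler_pdivlMr ?mulr_gt0// => rle.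
  rewrite !ler_norml => /andP[_ h1] /andP[_ h2].
  have Cr : 0 < C * r by rewrite mulr_gt0.
  by lra.
pose g := - (Num.min s' t').
have g0 : 0 < g.
  rewrite /g oppr_gt0 gt_min; have [s'0|] := leP 0 s'; last by [].
  by have [t'0|] := leP 0 t'; [case: neg|].
exists (g / (2 * C)); first by rewrite divr_gt0// mulr_gt0.
move=> r /andP[r0 rle] z u v z1 z2 v0 vu /uvE[uE vE].
exfalso.
have [] := hC z r (ltW z1) (ltW z2).
move: rle; rewrite ler_pdivlMr ?mulr_gt0// => rle.
rewrite !ler_norml => /andP[_ h1] /andP[_ h2].
have u0 : 0 <= u by exact: le_trans vu.
have : - g = s' \/ - g = t'.
  by rewrite /g opprK /Num.min; case: ifP; [left|right].
by case=> ?; lra.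
Qed.

End Fan.

(** * Second differences and strips *)

Section Calculus.
Variable R : realType.
Implicit Types (f g : R -> R) (d c h : R).

Lemma is_derive_right_le f d c (r : R) : is_derive (0 : R) 1 f d -> 0 < r ->
  (forall h, 0 < h < r -> f h <= f 0 + h * c) -> d <= c.
Proof.
move=> [df dfE] r0 hf; rewrite leNgt; apply/negP => cd.
have /cvgrPdist_lt hc : (fun h : R => h^-1 *: (f (h *: 1 + 0) - f 0)) @ 0^' --> d.
  by rewrite -dfE.
have dc : 0 < d - c by rewrite subr_gt0.
have [e /= e0 he] := hc _ dc.
pose h := Num.min (e / 2) (r / 2).
have h0 : 0 < h by rewrite lt_min !divr_gt0.
have he' : h < e by rewrite gt_min; apply/orP; left; lra.
have hr : h < r by rewrite gt_min; apply/orP; right; lra.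
have := he h; rewrite /ball_ /= sub0r normrN gtr0_norm// => /(_ he' (lt0r_neq0 h0)).
rewrite addr0 /GRing.scale /= mulr1.
have : h^-1 * (f h - f 0) <= c.
  by rewrite mulrC ler_pdivrMr// lerBlDl mulrC; apply: hf; rewrite h0.
by move=> ? /(le_lt_trans (ler_norm _)); lra.
Qed.

Lemma is_derive_right_eq f d c : is_derive (0 : R) 1 f d ->
  (forall h, 0 <= h -> f h = f 0 + h * c) -> d = c.
Proof.
move=> df hf; apply/eqP; rewrite eq_le; apply/andP; split.
  by apply: (is_derive_right_le df (ltr01)) => h /andP[h0 _]; rewrite hf// ltW.
rewrite -lerN2; apply: (is_derive_right_le (is_deriveN df) (ltr01)) => h /andP[h0 _].
by change (- f h <= - f 0 + h * - c); rewrite (hf h (ltW h0)); lra.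
Qed.

(** If [d < k], put [c = (k - d) / 2]. Near [0] the function [f t + f (- t) - (d + c) * t^2] has
    nonpositive derivative for [t > 0], so the second difference is at most [(k - c) * h^2], a
    contradiction. Only differentiability of [g] at [0] is needed. *)
Lemma second_derive_ge f g d (k r : R) : (forall t : R, is_derive t 1 f (g t)) ->
  is_derive (0 : R) 1 g d -> 0 < r ->
  (forall h, 0 < h < r -> k * h ^+ 2 <= f h + f (- h) - 2 * f 0) -> k <= d.
Proof.
move=> df [dg dgE] r0 hf; rewrite leNgt; apply/negP => dk.
have /cvgrPdist_lt hc : (fun h : R => h^-1 *: (g (h *: 1 + 0) - g 0)) @ 0^' --> d.
  by rewrite -dgE.
pose c := (k - d) / 2.
have c0 : 0 < c by rewrite divr_gt0// subr_gt0.
have [e /= e0 he] := hc _ c0.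
have hg h : 0 < `|h| < e -> `|g h - g 0 - d * h| <= c * `|h|.
  move=> /andP[h0 hle].
  have hn : h != 0 by rewrite -normr_gt0.
  have := he h; rewrite /ball_ /= sub0r normrN => /(_ hle hn).
  rewrite addr0 /GRing.scale /= mulr1 => /ltW.
  rewrite -(ler_pM2r h0) -normrM mulrBl mulrAC mulVf// mul1r.
  by rewrite -normrN opprB.
pose h := Num.min (e / 2) (r / 2).
have h0 : 0 < h by rewrite lt_min !divr_gt0.
have he' : h < e by rewrite gt_min; apply/orP; left; lra.
have hr : h < r by rewrite gt_min; apply/orP; right; lra.
pose F (t : R) := f t + f (- t) - (d + c) * t ^+ 2.
have dF (t : R) : is_derive t 1 F (g t - g (- t) - (d + c) * (2 * t)).
  have dN : is_derive t 1 (fun t : R => f (- t)) (- g (- t)).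
    have dn : is_derive t 1 (fun t : R => - t) (-1).
      exact: is_deriveNid.
    have := @is_derive1_comp _ f (fun t : R => - t) _ _ _ (df (- t)) dn.
    by rewrite mulrN1.
  have dF := is_deriveB (is_deriveD (df t) dN)
    (is_deriveZ (d + c) (is_deriveX 2 (is_derive_id t (1 : R)))).
  by apply: (is_derive_eq dF); rewrite /GRing.scale /= expr1; ring.
have cF : {within `[0, h], continuous F}.
  apply: derivable_within_continuous => t _.
  by case: (dF t).
have [t] := @MVT _ F (fun t => g t - g (- t) - (d + c) * (2 * t)) 0 h h0 (fun t _ => dF t) cF.
rewrite in_itv /= => /andP[t0 th] Fh.
have t_e : 0 < `|t| < e by rewrite gtr0_norm// t0 (lt_trans th).
have nt_e : 0 < `|- t| < e by rewrite normrN.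
have := hg _ t_e; have := hg _ nt_e; rewrite normrN (gtr0_norm t0) !ler_norml.
move=> /andP[g1 g2] /andP[g3 g4].
have Fle : F h <= F 0.
  rewrite -subr_le0 Fh subr0 mulr_le0_ge0// ?(ltW h0)//; lra.
have := hf h; rewrite h0 hr => /(_ isT).
move: Fle; rewrite /F oppr0 expr0n /= mulr0 subr0.
have : 0 < h ^+ 2 by rewrite exprn_gt0.
move: (h ^+ 2) => h2 h20.
have -> : d + c = k - c by rewrite /c; lra.
rewrite mulrBl; have : 0 < c * h2 by rewrite mulr_gt0.
lra.
Qed.

End Calculus.

Section Leb2Bounds.
Variable R : realType.
Let T2 := (measurableTypeR R * measurableTypeR R)%type.
Let nu := @leb2 R.

Lemma Rintegral_ge_measure (F : R * R -> R) (S : set T2) (r c : R) : kernel F ->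
  (forall y, 0 <= F y) -> measurable S -> S `<=` box2 r ->
  0 <= c -> (forall y, S y -> c <= F y) -> c * fine (nu S) <= Rintegral nu setT F.
Proof.
move=> kF F0 mS Sr c0 hS.
rewrite -(Rintegral_cst nu mS) Rintegral_mkcond.
apply: le_Rintegral => //.
- apply: kernel_integrable; split.
    apply: (measurable_restrict _ _ _).1 => //.
  exists r, c => y; rewrite patchE; split.
    by case: ifP => _; rewrite ?normr0// ger0_norm.
  by move=> nb; rewrite ifF//; apply/negbTE/negP => yS; apply/nb/Sr; rewrite inE in yS.
- exact: kernel_integrable.
- move=> y _; rewrite patchE; case: ifPn => [yS|_]; last exact: F0.
  by apply: hS; rewrite inE in yS.
Qed.

(** A sheared rectangle: all vertical sections over [[p, p']] have length [l], so the area follows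
    by integrating sections, whatever the slope [be]. *)
Definition parallelogram (p p' l al be : R) : set T2 :=
  [set y | p <= y.1 <= p' /\ al + be * y.1 <= y.2 <= al + be * y.1 + l].

Lemma measurable_parallelogram p p' l al be :
  measurable (parallelogram p p' l al be).
Proof.
pose g (y : T2) : R := y.2 - be * y.1.
have mg : measurable_fun setT g.
  apply: measurable_funB; first exact: measurable_snd.
  exact: (measurable_funM (measurable_cst be) measurable_fst).
have -> : parallelogram p p' l al be =
    ((setT `&` fst @^-1` `[p, p']%classic) `&` (setT `&` g @^-1` `[al, (al + l)]%classic)).
  apply/seteqP; split => y; rewrite /parallelogram /g /= !in_itv /=.
    by move=> [-> /andP[? ?]]; split => //; split => //; apply/andP; split; lra.
  by move=> [[_ ->] [_ /andP[? ?]]]; split => //; apply/andP; split; lra.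
apply: measurableI.
  by apply: (measurable_fst measurableT); exact: measurable_itv.
by apply: (mg measurableT); exact: measurable_itv.
Qed.

Lemma leb2_parallelogram p p' l al be : p <= p' -> 0 <= l ->
  nu (parallelogram p p' l al be) = ((p' - p) * l)%:E.
Proof.
move=> pp l0; rewrite /nu /leb2 /product_measure1 /=.
transitivity (\int[@lebesgue_measure R]_x (l%:E * (\1_(`[p, p']%classic) x)%:E))%E.
  apply: eq_integral => x _ /=; rewrite indicE.
  have [xI|xI] := boolP (x \in `[p, p']%classic).
    rewrite (_ : xsection _ _ = `[al + be * x, al + be * x + l]%classic).
      rewrite lebesgue_measure_itv /= lte_fin mule1; case: ifPn => [_|].
        by rewrite -EFinB addrC addKr.
      by rewrite -leNgt gerDl => l0'; congr EFin; apply/eqP; rewrite eq_le l0.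
    apply/seteqP; split => y; rewrite /xsection /= inE /parallelogram /= in_itv /=.
      by case.
    by move=> ?; split => //; move: xI; rewrite inE /= in_itv.
  rewrite (_ : xsection _ _ = set0) ?measure0 ?mule0//.
  apply/seteqP; split => y //; rewrite /xsection /= inE /parallelogram /= => -[h _].
  by move: xI; rewrite notin_setE /= in_itv /= h.
rewrite integralZl//; last first.
  exact: integrable_indic_itv.
transitivity (l%:E * @lebesgue_measure R (`[p, p']%classic `&` setT))%E.
  by congr (_ * _)%E; apply: integral_indic => //; exact: measurable_itv.
rewrite setIT lebesgue_measure_itv /= lte_fin.
case: ifPn => [_|]; first by rewrite -EFinB -EFinM mulrC.
rewrite -leNgt => p'p; have -> : p' = p by apply/eqP; rewrite eq_le p'p pp.
by rewrite subrr mul0r mule0.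
Qed.

(** The strip contains a parallelogram with length of order [1] and width of order [h]. A vertical
    strip, [n.2 = 0], needs a rectangle of its own; otherwise the slope is [- n.1 / n.2]. *)
Lemma strip_measure (n y0 : R * R) (r : R) : n != 0 -> 0 < r ->
  exists c h0 : R, [/\ 0 < c, 0 < h0 & forall h, 0 < h < h0 ->
    exists S : set T2, [/\ measurable S, c * h <= fine (nu S) &
      forall y, S y -> [/\ `|y.1 - y0.1| <= r, `|y.2 - y0.2| <= r &
        `|lin n (y0 - y)| <= h]]].
Proof.
move=> n0 r0.
have [n2|n2] := eqVneq n.2 0.
  have n1 : n.1 != 0.
    by apply: contra n0 => /eqP n1; apply/eqP; exact: vecP.
  have n1p : 0 < `|n.1| by rewrite normr_gt0.
  exists (4 * r / `|n.1|), (r * `|n.1|); split; rewrite ?divr_gt0 ?mulr_gt0//.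
  move=> h /andP[h0 hr].
  have hl : h / `|n.1| < r by rewrite ltr_pdivrMr.
  have hl0 : 0 < h / `|n.1| by rewrite divr_gt0.
  exists (parallelogram (y0.1 - h / `|n.1|) (y0.1 + h / `|n.1|) (2 * r) (y0.2 - r) 0); split.
  - exact: measurable_parallelogram.
  - rewrite leb2_parallelogram /=; [|by lra|by lra].
    by rewrite [leRHS](_ : _ = 4 * r / `|n.1| * h)//; ring.
  - move=> y [/andP[y1 y2] /andP[y3 y4]].
    rewrite mul0r addr0 in y3 y4.
    split; [by rewrite ler_norml; lra|by rewrite ler_norml; lra|].
    rewrite /lin n2 mul0r addr0 /= normrM mulrC -ler_pdivlMr//.
    by rewrite ler_norml; lra.
have n2p : 0 < `|n.2| by rewrite normr_gt0.
pose k := n.1 / n.2.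
have k0 : 0 <= `|k| by [].
(* Chosen with [(1 + |k|) * r1 = r / 2]: the slope uses at most half of the vertical allowance [r],
   the thickness [h / |n.2|] the other half. *)
pose r1 := r / 2 / (1 + `|k|).
have k1 : 0 < 1 + `|k| by lra.
have r10 : 0 < r1 by rewrite divr_gt0//; lra.
have kr1 : `|k| * r1 + r1 = r / 2.
  by rewrite /r1; field; exact: lt0r_neq0.
exists (4 * r1 / `|n.2|), (r / 2 * `|n.2|); split; rewrite ?divr_gt0 ?mulr_gt0//.
move=> h /andP[h0 hr].
have hl : h / `|n.2| < r / 2 by rewrite ltr_pdivrMr.
have hl0 : 0 < h / `|n.2| by rewrite divr_gt0.
exists (parallelogram (y0.1 - r1) (y0.1 + r1) (2 * (h / `|n.2|))
  (y0.2 + k * y0.1 - h / `|n.2|) (- k)); split.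
- exact: measurable_parallelogram.
- rewrite leb2_parallelogram /=; [|by lra|by lra].
  by rewrite [leRHS](_ : _ = 4 * r1 / `|n.2| * h)//; ring.
- move=> y [/andP[y1 y2] /andP[y3 y4]].
  have kr0 : 0 <= `|k| * r1 by rewrite mulr_ge0// ltW.
  have y1r : `|y.1 - y0.1| <= r1 by rewrite ler_norml; lra.
  have ky : `|k * (y.1 - y0.1)| <= `|k| * r1 by rewrite normrM ler_wpM2l.
  split; first by lra.
    by move: ky; rewrite !ler_norml => /andP[? ?]; lra.
  have -> : lin n (y0 - y) = n.2 * (k * (y0.1 - y.1) + (y0.2 - y.2)).
    by rewrite /lin /k /=; field.
  rewrite normrM mulrC -ler_pdivlMr// ler_norml; lra.
Qed.

End Leb2Bounds.

(** * The smoothed support function *)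

Lemma quadratic_bound (R : realType) (w1 w2 a b c z1 z2 r : R) :
  0 <= r -> r <= 1 -> `|z1| <= r -> `|z2| <= r ->
  w1 * z1 + w2 * z2 + (a * (z1 * z1) + 2 * b * (z1 * z2) + c * (z2 * z2)) <=
  (1 + `|w1| + `|w2| + `|a| + 2 * `|b| + `|c|) * r.
Proof.
move=> r0 r1 hz1 hz2.
have hm (d z : R) : `|z| <= r -> d * z <= `|d| * r.
  by move=> zr; apply: le_trans (ler_norm _) _; rewrite normrM ler_wpM2l.
have hz (z z' : R) : `|z| <= r -> `|z'| <= r -> `|z * z'| <= r.
  move=> zr zr'; rewrite normrM; apply: (@le_trans _ _ (r * 1)); last by rewrite mulr1.
  by rewrite ler_pM// (le_trans zr').
have h1 := hm w1 z1 hz1; have h2 := hm w2 z2 hz2; have h3 := hm a _ (hz _ _ hz1 hz1).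
have h4 := hm (2 * b) _ (hz _ _ hz1 hz2); have h5 := hm c _ (hz _ _ hz2 hz2).
rewrite (normrM 2) (ger0_norm (ler0n _ 2)) in h4.
rewrite !mulrDl mul1r; lra.
Qed.

(** Use the piece of larger slope forwards and that of smaller slope backwards: their sum is
    [A1 + A2 + k], while [A1 + A2 >= 2 * t - k / 2] because [t] is one of two values at distance at
    most [k / 2]. *)
Lemma second_diff_kink (R : realType) (A1 A2 x1 x2 tp tm t k : R) :
  A1 + x1 <= tp -> A1 - x1 <= tm -> A2 + x2 <= tp -> A2 - x2 <= tm ->
  `|A1 - A2| <= k / 2 -> x1 - x2 = k \/ x2 - x1 = k -> t = A1 \/ t = A2 ->
  k / 2 <= tp + tm - 2 * t.
Proof.
move=> h1 h2 h3 h4; rewrite ler_norml => /andP[h5 h6].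
by move=> [h7|h7] [->|->]; lra.
Qed.

Section SmoothedSupport.
Variable R : realType.
Local Notation V := (R * R)%type.
Let T2 := (measurableTypeR R * measurableTypeR R)%type.
Let nu := @leb2 R.
Variables (E : seq (V * V)) (th : V -> R) (q : R * R * R) (e : R) (v0 : V).
Hypotheses (fE : fan E) (sth : strict_support E th) (hq : is_inner q) (e0 : 0 < e).
Implicit Types (x y a b xi : V).

(** By [piece_le] the support function is the maximum of its finitely many linear pieces, which
    settles measurability and boundedness together. *)
Lemma loc_bounded_th : loc_bounded th.
Proof.
have [a [b [_ [_ [ab _ _ _]]]]] := fan_complete fE 0.
pose F (s : seq (V * V)) (x : V) : R :=
  foldr (fun p acc => Num.max (lin (piece th p.1 p.2) x) acc) (lin (piece th a b) x) s.
have lbF s : loc_bounded (F s).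
  elim: s => [|p s IH]; first exact: loc_bounded_lin.
  exact: (loc_bounded_max (loc_bounded_lin _) IH).
suff -> : th = F E by [].
apply/funext => x; apply/eqP; rewrite eq_le; apply/andP; split.
  have [c [d [s [t [cd s0 t0 xE]]]]] := fan_complete fE x.
  have thx : th x = lin (piece th c d) x.
    by rewrite xE; exact: (piece_cone fE sth cd s0 t0).
  rewrite thx; move: cd; rewrite /F; elim: E => // p S IH.
  rewrite inE /= le_max => /orP[/eqP <-|/IH ->]; first by rewrite lexx.
  by rewrite orbT.
have : {subset E <= E} by [].
rewrite /F; elim: {1 3}E => [_|p S IH sub] /=; first exact: (piece_le fE sth).
rewrite ge_max IH ?andbT; last by move=> z zS; apply: sub; rewrite inE zS orbT.
apply: (piece_le fE sth); apply: sub; rewrite inE.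
by rewrite -surjective_pairing eqxx.
Qed.

Lemma loc_bounded_thv : loc_bounded (fun z => th (z - v0)).
Proof.
have [mt bt] := loc_bounded_th; split.
  exact: (measurableT_comp mt (measurable_shift2 (- v0))).
move=> r; have [C hC] := bt (r + `|v0.1| + `|v0.2|); exists C => x xr.
apply: hC; move/box2P : xr => [x1 x2]; apply/box2P => /=.
have := ler_normB x.1 v0.1; have := ler_normB x.2 v0.2.
have := normr_ge0 v0.1; have := normr_ge0 v0.2.
by split; lra.
Qed.

Lemma level_nbhd y0 : normsq q y0 < e ^+ 2 -> exists r c : R, [/\ 0 < r, 0 < c &
  forall y, `|y.1 - y0.1| <= r -> `|y.2 - y0.2| <= r ->
    normsq q y < e ^+ 2 /\ c <= Defs.bump q e y].
Proof.
move=> y0e; pose s := e ^+ 2 - normsq q y0.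
have s0 : 0 < s by rewrite subr_gt0.
pose w1 := 2 * (q.1.1 * y0.1 + q.1.2 * y0.2); pose w2 := 2 * (q.1.2 * y0.1 + q.2 * y0.2).
pose L := 1 + `|w1| + `|w2| + `|q.1.1| + 2 * `|q.1.2| + `|q.2|.
have L0 : 0 < L.
  rewrite /L; have := normr_ge0 w1; have := normr_ge0 w2; have := normr_ge0 q.1.1.
  by have := normr_ge0 q.1.2; have := normr_ge0 q.2; lra.
(* Within this radius [normsq] grows by at most half of the slack [s], so the bump stays above its
   value at level [s / 2]. *)
pose r := Num.min 1 (s / 2 / L).
have r0 : 0 < r by rewrite lt_min ltr01 !divr_gt0.
have r1 : r <= 1 by rewrite ge_min lexx.
have rL : L * r <= s / 2 by rewrite mulrC -ler_pdivlMr// ge_min lexx orbT.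
exists r, (expR (- (s / 2)^-1)); split => //; first exact: expR_gt0.
move=> y y1 y2.
have key : normsq q y <= normsq q y0 + s / 2.
  apply: (@le_trans _ _ (normsq q y0 + L * r)); last by rewrite lerD2l.
  pose z1 := y.1 - y0.1; pose z2 := y.2 - y0.2.
  have -> : normsq q y = normsq q y0 + (w1 * z1 + w2 * z2 +
      (q.1.1 * (z1 * z1) + 2 * q.1.2 * (z1 * z2) + q.2 * (z2 * z2))).
    by rewrite /normsq /inner_prod /w1 /w2 /z1 /z2; ring.
  rewrite lerD2l.
  exact: quadratic_bound (ltW r0) r1 y1 y2.
have sE : s = e ^+ 2 - normsq q y0 by [].
have h : s / 2 <= e ^+ 2 - normsq q y by lra.
split; first by lra.
rewrite bumpE /beta; case: ifPn => [_|]; last by rewrite -leNgt; lra.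
rewrite expr0 mul1r ler_expR lerN2 lef_pV2 ?posrE//; lra.
Qed.

Lemma normsq0 : normsq q (0 : V) = 0.
Proof. by rewrite /normsq /inner_prod /=; ring. Qed.

Lemma kernel_bump : kernel (Defs.bump q e).
Proof.
rewrite (_ : Defs.bump q e = fun y => beta 0 (e ^+ 2 - normsq q y)).
  exact: kernel_beta.
by apply/funext => y; rewrite bumpE.
Qed.

Lemma bump_ge0 y : 0 <= Defs.bump q e y.
Proof. by rewrite bumpE beta_ge0. Qed.

Lemma A_eps_gt0 : 0 < A_eps q e.
Proof.
have [|r [c [r0 c0 h]]] := @level_nbhd 0; first by rewrite normsq0 exprn_gt0.
have := @Rintegral_ge_measure _ (Defs.bump q e) (parallelogram (- r) r (2 * r) (- r) 0) r c.
rewrite leb2_parallelogram /=; [|lra|lra] => hh.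
apply: lt_le_trans (hh _ _ _ _ _ _).
- by rewrite !mulr_gt0//; lra.
- exact: kernel_bump.
- exact: bump_ge0.
- exact: measurable_parallelogram.
- move=> y [y1 /andP[y2 y3]]; rewrite mul0r addr0 in y2 y3; apply/box2P.
  by rewrite !ler_norml y1; split => //; lra.
- exact: ltW.
- move=> y [y1 /andP[y2 y3]]; rewrite mul0r addr0 in y2 y3; apply: (h _ _ _).2;
  by rewrite subr0 ler_norml; lra.
Qed.

Lemma mu_eps_ge0 y : 0 <= mu_eps q e y.
Proof. by rewrite mulr_ge0 ?bump_ge0// invr_ge0 ltW// A_eps_gt0. Qed.

Lemma mu_eps_out y : ~ normsq q y < e ^+ 2 -> mu_eps q e y = 0.
Proof. by move=> /negP/negbTE h; rewrite /mu_eps /Defs.bump h mulr0. Qed.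

Lemma Rintegral_mu_eps : Rintegral nu setT (mu_eps q e) = 1.
Proof.
rewrite /mu_eps RintegralZl//; last exact: (kernel_integrable kernel_bump).
by rewrite -/(A_eps q e) mulVf// gt_eqF// A_eps_gt0.
Qed.

Definition smoothed := cnv (fun z => th (z - v0)) (mu_eps q e).

Let lbG := loc_bounded_thv.
Let kmu := kernel_mu hq e0.

(** The passage of inequalities from [th] to its smoothing: only the ball of radius [e] is seen, and
    the constant survives because the kernel has mass one. *)
Lemma smoothed_le x x' (c : R) :
  (forall y, normsq q y < e ^+ 2 -> th (x - y - v0) <= th (x' - y - v0) + c) ->
  smoothed x <= smoothed x' + c.
Proof.
move=> h.
have -> : smoothed x' + c =
    Rintegral nu setT (fun y => th (x' - y - v0) * mu_eps q e y + c * mu_eps q e y).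
  rewrite RintegralD//; last 2 first.
  - exact: (cnv_integrable x' lbG kmu).
  - exact: (kernel_integrable (kernelZ c kmu)).
  rewrite RintegralZl//; last exact: (kernel_integrable kmu).
  by rewrite Rintegral_mu_eps mulr1.
apply: le_Rintegral => //.
- exact: (cnv_integrable x lbG kmu).
- exact: (kernel_integrable (kernelD (kernel_cnv x' lbG kmu) (kernelZ c kmu))).
- move=> y _; rewrite -mulrDl.
  have [yQ|yQ] := pselect (normsq q y < e ^+ 2); last by rewrite mu_eps_out// !mulr0.
  by rewrite ler_wpM2r ?mu_eps_ge0// h.
Qed.

Lemma d1_dir (f g : V -> R) : (forall x, is_derive (0 : R) 1
  (fun t : R => f (x + t *: ((1, 0) : V))) (g x)) -> d1 f = g.
Proof.
move=> h; apply/funext => x; rewrite /d1.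
have hx := h x.
have -> : (fun t => f (t, x.2)) =
   (fun t : R => f (x + t *: ((1, 0) : V))) \o (fun s : R => s - x.1).
  apply/funext => t /=; congr f; apply: vecP => /=; rewrite /GRing.scale /=; ring.
have ds : is_derive x.1 1 (fun s : R => s - x.1) (1 : R).
  by have := is_deriveB (is_derive_id x.1 (1 : R)) (is_derive_cst x.1 x.1 (1 : R)); rewrite subr0.
have hx' : is_derive (x.1 - x.1) 1 (fun t : R => f (x + t *: ((1, 0) : V))) (g x).
  by rewrite subrr.
have [_] := @is_derive1_comp _ _ (fun s : R => s - x.1) _ _ _ hx' ds.
by rewrite mulr1 derive1E.
Qed.

Lemma d2_dir (f g : V -> R) : (forall x, is_derive (0 : R) 1
  (fun t : R => f (x + t *: ((0, 1) : V))) (g x)) -> d2 f = g.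
Proof.
move=> h; apply/funext => x; rewrite /d2.
have hx := h x.
have -> : (fun t => f (x.1, t)) =
   (fun t : R => f (x + t *: ((0, 1) : V))) \o (fun s : R => s - x.2).
  apply/funext => t /=; congr f; apply: vecP => /=; rewrite /GRing.scale /=; ring.
have ds : is_derive x.2 1 (fun s : R => s - x.2) (1 : R).
  by have := is_deriveB (is_derive_id x.2 (1 : R)) (is_derive_cst x.2 x.2 (1 : R)); rewrite subr0.
have hx' : is_derive (x.2 - x.2) 1 (fun t : R => f (x + t *: ((0, 1) : V))) (g x).
  by rewrite subrr.
have [_] := @is_derive1_comp _ _ (fun s : R => s - x.2) _ _ _ hx' ds.
by rewrite mulr1 derive1E.
Qed.

Section Derivatives.
Variable G : V -> R.
Hypothesis bG : loc_bounded G.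
Let f := cnv G (mu_eps q e).

Lemma is_derive_f x xi (t : R) :
  is_derive t 1 (fun s : R => f (x + s *: xi)) (cnv G (Dmu q e xi) (x + t *: xi)).
Proof.
apply: (@is_derive_cnv _ G _ _ xi x t bG (kernel_mu hq e0) (kernel_Dmu hq e0 xi)).
by move=> y s; exact: (is_derive_mu q e y xi s).
Qed.

Lemma is_derive_Df x xi eta (t : R) :
  is_derive t 1 (fun s : R => cnv G (Dmu q e xi) (x + s *: eta))
    (cnv G (DDmu q e xi eta) (x + t *: eta)).
Proof.
apply: (@is_derive_cnv _ G _ _ eta x t bG (kernel_Dmu hq e0 xi) (kernel_DDmu hq e0 xi eta)).
exact: is_derive_Dmu.
Qed.

Lemma d1f : d1 f = cnv G (Dmu q e (1, 0)).
Proof.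
apply: d1_dir => x; have := is_derive_f x (1, 0) 0.
by rewrite scale0r addr0.
Qed.

Lemma d2f : d2 f = cnv G (Dmu q e (0, 1)).
Proof.
apply: d2_dir => x; have := is_derive_f x (0, 1) 0.
by rewrite scale0r addr0.
Qed.

(** [Dmu] is linear in the direction, so each directional derivative is the pairing of the direction
    with the pair of partial derivatives; no differentiability in two variables is invoked. *)
Lemma lin_dif x xi : lin (dif f x) xi = cnv G (Dmu q e xi) x.
Proof.
have -> : Dmu q e xi = fun y => xi.1 * Dmu q e (1, 0) y + xi.2 * Dmu q e (0, 1) y.
  by apply/funext => y; rewrite Dmu_lin.
have kD z := kernel_Dmu hq e0 z.
rewrite (cnvD x bG (kernelZ xi.1 (kD (1, 0))) (kernelZ xi.2 (kD (0, 1)))).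
rewrite (cnvZ xi.1 x bG (kD (1, 0))) (cnvZ xi.2 x bG (kD (0, 1))).
by rewrite /lin /dif /= d1f d2f; ring.
Qed.

Lemma hess_formE x xi : hess_form f x xi = cnv G (DDmu q e xi xi) x.
Proof.
have dd1 xi' : d1 (cnv G (Dmu q e xi')) = cnv G (DDmu q e xi' (1, 0)).
  by apply: d1_dir => z; have := is_derive_Df z xi' (1, 0) 0; rewrite scale0r addr0.
have dd2 xi' : d2 (cnv G (Dmu q e xi')) = cnv G (DDmu q e xi' (0, 1)).
  by apply: d2_dir => z; have := is_derive_Df z xi' (0, 1) 0; rewrite scale0r addr0.
rewrite /hess_form d1f d2f !dd1 !dd2.
have -> : DDmu q e xi xi = fun y => xi.1 ^+ 2 * DDmu q e (1, 0) (1, 0) y +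
   (xi.1 * xi.2 * (DDmu q e (1, 0) (0, 1) y + DDmu q e (0, 1) (1, 0) y) +
    xi.2 ^+ 2 * DDmu q e (0, 1) (0, 1) y).
  by apply/funext => y; rewrite DDmu_quad.
have kD z w := kernel_DDmu hq e0 z w.
have kDD := kernelD (kD (1, 0) (0, 1)) (kD (0, 1) (1, 0)).
rewrite (cnvD x bG (kernelZ (xi.1 ^+ 2) (kD (1, 0) (1, 0)))
  (kernelD (kernelZ (xi.1 * xi.2) kDD) (kernelZ (xi.2 ^+ 2) (kD (0, 1) (0, 1))))).
rewrite (cnvD x bG (kernelZ (xi.1 * xi.2) kDD) (kernelZ (xi.2 ^+ 2) (kD (0, 1) (0, 1)))).
rewrite (cnvZ (xi.1 ^+ 2) x bG (kD (1, 0) (1, 0))) (cnvZ (xi.2 ^+ 2) x bG (kD (0, 1) (0, 1))).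
rewrite (cnvZ (xi.1 * xi.2) x bG kDD) (cnvD x bG (kD (1, 0) (0, 1)) (kD (0, 1) (1, 0))).
by rewrite addrA.
Qed.

Lemma is_derive_lin x xi (t : R) :
  is_derive t 1 (fun s : R => f (x + s *: xi)) (lin (dif f (x + t *: xi)) xi).
Proof. by rewrite lin_dif; exact: is_derive_f. Qed.

Lemma is_derive_lin0 x xi :
  is_derive (0 : R) 1 (fun s : R => f (x + s *: xi)) (lin (dif f x) xi).
Proof. by have := is_derive_lin x xi 0; rewrite scale0r addr0. Qed.

Lemma continuous_lin_dif x xi eta : continuous (fun s : R => lin (dif f (x + s *: eta)) xi).
Proof.
move=> t; rewrite (_ : (fun s : R => _) = fun s : R => cnv G (Dmu q e xi) (x + s *: eta)).
  have [d _] := is_derive_Df x xi eta t.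
  exact/differentiable_continuous/derivable1_diffP.
by apply/funext => s; rewrite lin_dif.
Qed.

End Derivatives.

Lemma grad_polar x : polar E th (dif smoothed x).
Proof.
move=> a b ab.
apply: (is_derive_right_le (is_derive_lin0 lbG x a) ltr01) => h /andP[h0 _] /=.
rewrite scale0r addr0; apply: smoothed_le => y _.
have -> : x + h *: a - y - v0 = (x - y - v0) + h *: a.
  by rewrite -!addrA; congr (_ + _); rewrite addrC -!addrA.
apply: le_trans (th_subadd fE sth _ _) _.
by rewrite (th_homog fE sth a (ltW h0)).
Qed.

Lemma grad_face x a b : (a, b) \in E ->
  (forall y, normsq q y < e ^+ 2 -> additive_along th a (x - y - v0)) ->
  lin (dif smoothed x) a = th a.
Proof.
move=> ab ha.
apply: (is_derive_right_eq (is_derive_lin0 lbG x a)) => h h0 /=.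
have hE y : x + h *: a - y - v0 = (x - y - v0) + h *: a.
  by rewrite -!addrA; congr (_ + _); rewrite addrC -!addrA.
rewrite scale0r addr0; apply/eqP; rewrite eq_le; apply/andP; split.
  by apply: smoothed_le => y yQ; rewrite hE (ha _ yQ _ h0).
rewrite -lerBrDr; apply: smoothed_le => y yQ.
by rewrite hE (ha _ yQ _ h0) addrK.
Qed.

Lemma th_bound : exists2 L : R, 0 < L & forall x, th x <= L * (`|x.1| + `|x.2|).
Proof.
pose N := `|th (1, 0)| + `|th (-1, 0)| + `|th (0, 1)| + `|th (0, -1)|.
have h1 (a b : V) (t : R) : b = - a -> `|th a| + `|th b| <= N -> th (t *: a) <= N * `|t|.
  move=> bE hN; have [t0|t0] := leP 0 t.
    rewrite (th_homog fE sth)// ger0_norm// mulrC ler_wpM2r//.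
    by have := ler_norm (th a); have := normr_ge0 (th b); lra.
  have -> : t *: a = (- t) *: b by rewrite bE scalerN scaleNr opprK.
  rewrite (th_homog fE sth) ?oppr_ge0 ?(ltW t0)// ltr0_norm// mulrC ler_wpM2r//; first by lra.
  by have := ler_norm (th b); have := normr_ge0 (th a); lra.
have n1 := normr_ge0 (th (1, 0)); have n2 := normr_ge0 (th (-1, 0)).
have n3 := normr_ge0 (th (0, 1)); have n4 := normr_ge0 (th (0, -1)).
exists (N + 1); first by rewrite /N; lra.
move=> x.
have xE : x = x.1 *: ((1, 0) : V) + x.2 *: ((0, 1) : V).
  by apply: vecP; rewrite /= /GRing.scale /=; ring.
rewrite {1}xE; apply: le_trans (th_subadd fE sth _ _) _.
have := h1 (1, 0) (-1, 0) x.1 _ _; have := h1 (0, 1) (0, -1) x.2 _ _.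
have e1 : ((-1, 0) : V) = - (1, 0) by apply: vecP => /=; rewrite ?oppr0.
have e2 : ((0, -1) : V) = - (0, 1) by apply: vecP => /=; rewrite ?oppr0.
have l1 : `|th (1, 0)| + `|th (-1, 0)| <= N by rewrite /N; lra.
have l2 : `|th (0, 1)| + `|th (0, -1)| <= N by rewrite /N; lra.
move=> /(_ e2 l2) k2 /(_ e1 l1) k1.
have := normr_ge0 x.1; have := normr_ge0 x.2; lra.
Qed.

(** Subadditivity and the growth bound make [th] Lipschitz, and smoothing keeps the constant. Joint
    continuity is what the compactness argument will require. *)
Lemma continuous_smoothed : continuous smoothed.
Proof.
have [L L0 hL] := th_bound.
have lip x x' : smoothed x <= smoothed x' + L * (`|x.1 - x'.1| + `|x.2 - x'.2|).
  apply: smoothed_le => y _.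
  have -> : x - y - v0 = (x' - y - v0) + (x - x').
    by apply: vecP => /=; ring.
  by apply: le_trans (th_subadd fE sth _ _) _; rewrite lerD2l; exact: hL.
move=> x; apply/cvgrPdist_le => eps eps0.
exists (ball x.1 (eps / (2 * L)), ball x.2 (eps / (2 * L))).
  by split; apply: nbhsx_ballx; rewrite divr_gt0 ?mulr_gt0.
move=> [z1 z2] [/= b1 b2].
rewrite /ball /= in b1 b2.
have h1 : L * `|x.1 - z1| <= eps / 2.
  by move: b1; rewrite ltr_pdivlMr ?mulr_gt0// => /ltW; lra.
have h2 : L * `|x.2 - z2| <= eps / 2.
  by move: b2; rewrite ltr_pdivlMr ?mulr_gt0// => /ltW; lra.
have := lip x (z1, z2); have := lip (z1, z2) x.
rewrite /= (distrC z1) (distrC z2) !mulrDr ler_norml; lra.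
Qed.

(** By subadditivity and homogeneity the integrand of the second difference is nonnegative
    everywhere, so the integral is at least its part over [S]. *)
Lemma smoothed_second_diff x w (S : set T2) (r c d : R) :
  measurable S -> S `<=` box2 r -> 0 <= c -> 0 <= d ->
  (forall y, S y -> c <= mu_eps q e y /\
     d <= th (x + w - y - v0) + th (x - w - y - v0) - 2 * th (x - y - v0)) ->
  d * c * fine (nu S) <= smoothed (x + w) + smoothed (x - w) - 2 * smoothed x.
Proof.
move=> mS Sr c0 d0 hS.
pose G y := (th (x + w - y - v0) * mu_eps q e y + th (x - w - y - v0) * mu_eps q e y) -
  2 * (th (x - y - v0) * mu_eps q e y).
have k1 := kernel_cnv (x + w) lbG kmu; have k2 := kernel_cnv (x - w) lbG kmu.
have k3 := kernelZ 2 (kernel_cnv x lbG kmu).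
have kG : kernel G.
  rewrite (_ : G = fun y => (th (x + w - y - v0) * mu_eps q e y +
      th (x - w - y - v0) * mu_eps q e y) + -1 * (2 * (th (x - y - v0) * mu_eps q e y))).
    exact: (kernelD (kernelD k1 k2) (kernelZ (-1) k3)).
  by apply/funext => y; rewrite mulN1r.
have -> : smoothed (x + w) + smoothed (x - w) - 2 * smoothed x = Rintegral nu setT G.
  rewrite /smoothed /cnv -(RintegralZl _ measurableT (kernel_integrable (kernel_cnv x lbG kmu))).
  rewrite -(RintegralD measurableT (kernel_integrable k1) (kernel_integrable k2)).
  by rewrite -(RintegralB measurableT (kernel_integrable (kernelD k1 k2)) (kernel_integrable k3)).
have GE y : G y = (th (x + w - y - v0) + th (x - w - y - v0) - 2 * th (x - y - v0)) * mu_eps q e y.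
  by rewrite /G; ring.
apply: (Rintegral_ge_measure kG _ mS Sr); rewrite ?mulr_ge0//.
  move=> y; rewrite GE mulr_ge0 ?mu_eps_ge0//.
  have := th_subadd fE sth (x + w - y - v0) (x - w - y - v0).
  have -> : x + w - y - v0 + (x - w - y - v0) = 2 *: (x - y - v0).
    by apply: vecP; rewrite /= /GRing.scale /=; ring.
  by rewrite (th_homog fE sth) ?ler0n//; lra.
move=> y /hS[h1 h2]; rewrite GE.
by apply: ler_pM.
Qed.

(* The two linear pieces along the ray through [a] differ by [n], and [lin n a = 0]. On
   the strip [|lin n z| <= h * kap / 2] of area of order [h] the second difference of
   [th] with step [h *: xi] is at least [h * kap / 2], where [kap = |lin n xi|]; by
   convexity it is nonnegative elsewhere. So that of the smoothing is at least [K * h ^+ 2]. *)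
Lemma hess_ray x xi a b s : (a, b) \in E -> 0 < s ->
  normsq q (x - v0 - s *: a) < e ^+ 2 -> det2 a xi != 0 ->
  0 < hess_form smoothed x xi.
Proof.
move=> ab s0 yQ Dxi; set y0 := x - v0 - s *: a in yQ.
have [c ac Dbc] := fan_opp fE ab.
have Dab := fan_det fE ab; have Dac := fan_det fE ac.
pose m1 := piece th a b; pose m2 := piece th a c; pose n := m1 - m2.
have linn z : lin n z = lin m1 z - lin m2 z by rewrite /n linDl linNl.
have na : lin n a = 0 by rewrite linn (piecel th fE ab) (piecel th fE ac) subrr.
have nxi : lin n xi != 0.
  apply/eqP => h; apply: (sup_strict sth ab ac Dbc).
  apply: (lin_inj Dxi); first by rewrite (piecel th fE ab) (piecel th fE ac).
  by apply/eqP; rewrite -subr_eq0 -linn h.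
have nb : 0 < lin n b.
  by rewrite linn (piecer th fE ab) subr_gt0 (piece_lt fE sth ac ab)// mulrC.
have nc : lin n c < 0.
  by rewrite linn (piecer th fE ac) subr_lt0; exact: (piece_lt fE sth ab ac Dbc).
have nz0 : n != 0.
  by apply: contra nxi => /eqP ->; rewrite /lin /= !mul0r addr0.
have [r1 [c1 [r10 c10 hr1]]] := level_nbhd yQ.
have [Cb Cb0 hCb] := coord_bound Dab.
have [Cc Cc0 hCc] := coord_bound Dac.
(* Keeping [(Cb + Cc) * r <= s] leaves the coefficient on [a] nonnegative, so around [s *: a] only
   the two cones along [a] occur, and the sign of [lin n z] tells which. *)
pose r := Num.min r1 (s / (Cb + Cc)).
have r0 : 0 < r by rewrite lt_min r10 divr_gt0// addr_gt0.
have rr1 : r <= r1 by rewrite ge_min lexx.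
have rC : (Cb + Cc) * r <= s.
  by rewrite mulrC -ler_pdivlMr ?addr_gt0// ge_min lexx orbT.
have cone z : `|z.1| <= r -> `|z.2| <= r ->
    th (s *: a + z) = lin m1 (s *: a + z) /\ 0 <= lin n z \/
    th (s *: a + z) = lin m2 (s *: a + z) /\ lin n z <= 0.
  move=> z1 z2.
  have side d C : (a, d) \in E -> det2 a d != 0 -> 0 < C -> C * r <= s ->
      `|det2 z d / det2 a d| <= C * r -> 0 <= det2 a z / det2 a d ->
      th (s *: a + z) = lin (piece th a d) (s *: a + z).
    move=> ad Dad C0 Cr zC zd.
    have -> : s *: a + z = (s + det2 z d / det2 a d) *: a + (det2 a z / det2 a d) *: d.
      by rewrite {1}(coordE z Dad) addrA -scalerDl.
    apply: (piece_cone fE sth ad) => //.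
    by move: zC; rewrite ler_norml => /andP[? ?]; lra.
  have lnz d : (a, d) \in E -> det2 a d != 0 ->
      lin n z = det2 a z / det2 a d * lin n d.
    by move=> ad Dad; rewrite {1}(coordE z Dad) linD !linZ na mulr0 add0r.
  have Cb' : Cb * r <= s by apply: le_trans rC; rewrite mulrDl lerDl mulr_ge0 ?ltW.
  have Cc' : Cc * r <= s by apply: le_trans rC; rewrite mulrDl lerDr mulr_ge0 ?ltW.
  have [h|h] := leP 0 (lin n z).
    left; split=> //; apply: (side b Cb) => //; first exact: (hCb _ _ z1 z2).1.
    by rewrite (lnz b ab Dab) pmulr_lge0 in h.
  right; split; last exact: ltW.
  apply: (side c Cc) => //; first exact: (hCc _ _ z1 z2).1.
  by rewrite (lnz c ac Dac) nmulr_llt0 in h; last exact: nc; exact: ltW.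
pose kap := `|lin n xi|.
have kap0 : 0 < kap by rewrite normr_gt0.
have [c2 [h0 [c20 h00 hS]]] := strip_measure y0 nz0 r0.
pose A1 := (A_eps q e)^-1 * c1.
have A10 : 0 < A1 by rewrite mulr_gt0// invr_gt0 A_eps_gt0.
(* The factors, with powers of [h] removed: the kink height, the lower bound of the kernel, and the
   area of the strip of half-width [h * kap / 2]. *)
pose K := kap / 2 * A1 * (c2 * (kap / 2)).
have kap2 : 0 < kap / 2 by rewrite divr_gt0.
have K0 : 0 < K by apply: mulr_gt0; exact: mulr_gt0.
apply: lt_le_trans K0 _; rewrite (hess_formE lbG).
apply: (@second_derive_ge _ (fun t : R => smoothed (x + t *: xi))
  (fun t : R => cnv (fun z => th (z - v0)) (Dmu q e xi) (x + t *: xi)) _ _ (h0 / (kap / 2))).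
- by move=> t; exact: is_derive_f.
- by have := is_derive_Df lbG x xi xi 0; rewrite scale0r addr0.
- by rewrite !divr_gt0.
move=> h /andP[hp hle].
have hk : h * (kap / 2) < h0 by rewrite -ltr_pdivlMr// divr_gt0.
have hkp : 0 < h * (kap / 2) by rewrite mulr_gt0// divr_gt0.
have [|S [mS measS SP]] := hS (h * (kap / 2)); first by rewrite hkp.
rewrite scale0r addr0 scaleNr.
apply: (@le_trans _ _ (h * (kap / 2) * A1 * fine (nu S))).
  have -> : K * h ^+ 2 = h * (kap / 2) * A1 * (c2 * (h * (kap / 2))) by rewrite /K; ring.
  by rewrite ler_wpM2l// ltW// mulr_gt0.
apply: (@smoothed_second_diff x (h *: xi) S (r + `|y0.1| + `|y0.2|)) => //.
- move=> y /SP[y1 y2 _]; apply/box2P.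
  have := ler_normD (y.1 - y0.1) y0.1; have := ler_normD (y.2 - y0.2) y0.2.
  rewrite !subrK; have := normr_ge0 y0.1; have := normr_ge0 y0.2.
  by split; lra.
- exact: ltW.
- exact: ltW.
move=> y /SP[y1 y2 yn]; split.
  have [_ hb] := hr1 y (le_trans y1 rr1) (le_trans y2 rr1).
  by rewrite /A1 /mu_eps ler_wpM2l// invr_ge0 ltW// A_eps_gt0.
pose z := y0 - y.
have zE : x - y - v0 = s *: a + z.
  by rewrite /z /y0; apply: vecP => /=; ring.
have eP : x + h *: xi - y - v0 = (s *: a + z) + h *: xi.
  by rewrite -zE; apply: vecP => /=; ring.
have eM : x - h *: xi - y - v0 = (s *: a + z) + (- h) *: xi.
  by rewrite -zE scaleNr; apply: vecP => /=; ring.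
rewrite eP eM zE.
have z1 : `|z.1| <= r by rewrite /z /= distrC.
have z2 : `|z.2| <= r by rewrite /z /= distrC.
have p1 z' : lin m1 z' <= th z' by exact: (piece_le fE sth).
have p2 z' : lin m2 z' <= th z' by exact: (piece_le fE sth).
have m1a : lin m1 a = lin m2 a by apply/eqP; rewrite -subr_eq0 -linn na.
rewrite mulrA.
apply: (@second_diff_kink _ (lin m1 (s *: a + z)) (lin m2 (s *: a + z))
  (h * lin m1 xi) (h * lin m2 xi)).
- by rewrite -linZ -linD.
- by rewrite -mulNr -linZ -linD.
- by rewrite -linZ -linD.
- by rewrite -mulNr -linZ -linD.
- by rewrite (linD m1 (s *: a) z) (linD m2 (s *: a) z) !linZ m1a opprD addrACA subrr add0r -linn -mulrA.
- have [xip|xin] := leP 0 (lin n xi).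
    by left; rewrite -mulrBr -linn /kap ger0_norm.
  by right; rewrite -mulrBr -opprB -linn /kap ltr0_norm.
- by case: (cone z z1 z2) => -[-> _]; [left|right].
Qed.

Lemma segment_closed_ball x :
  segment_closed [set z | normsq q (x - v0 - z) < e ^+ 2].
Proof.
move=> z w t /= hz hw /andP[t0 t1].
have [q1 qD] := hq.
set u1 := x - v0 - z in hz *; set u2 := x - v0 - w in hw *.
have -> : x - v0 - ((1 - t) *: z + t *: w) = (1 - t) *: u1 + t *: u2.
  by rewrite /u1 /u2; apply: vecP; rewrite /= /GRing.scale /=; ring.
have Qge0 u : 0 <= normsq q u.
  rewrite -(pmulr_rge0 _ q1).
  have -> : q.1.1 * normsq q u = (q.1.1 * u.1 + q.1.2 * u.2) ^+ 2 +
      (q.1.1 * q.2 - q.1.2 ^+ 2) * u.2 ^+ 2 by rewrite /normsq /inner_prod; ring.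
  by rewrite addr_ge0 ?sqr_ge0// mulr_ge0 ?sqr_ge0// ltW.
have key : normsq q ((1 - t) *: u1 + t *: u2) = (1 - t) * normsq q u1 + t * normsq q u2 -
    t * (1 - t) * normsq q (u1 - u2).
  by rewrite /normsq /inner_prod /= /GRing.scale /=; ring.
have k3 : 0 <= t * (1 - t) * normsq q (u1 - u2).
  by rewrite mulr_ge0// mulr_ge0// subr_ge0.
rewrite key.
(* At least one of the weights is positive; that term supplies the strict inequality. *)
have [t12|t12] := leP t 2^-1.
  have : (1 - t) * normsq q u1 < (1 - t) * e ^+ 2 by rewrite ltr_pM2l//; lra.
  have : t * normsq q u2 <= t * e ^+ 2 by rewrite ler_wpM2l// ltW.
  lra.
have : (1 - t) * normsq q u1 <= (1 - t) * e ^+ 2 by apply: ler_wpM2l; [lra|exact: ltW].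
have : t * normsq q u2 < t * e ^+ 2 by rewrite ltr_pM2l//; lra.
lra.
Qed.

(** Of two non-parallel rays, at least one is not parallel to a given [xi], and its kink makes the
    Hessian positive along [xi]. *)
Lemma hess_or_face x : hess_posdef smoothed x \/
  exists a b, (a, b) \in E /\ lin (dif smoothed x) a = th a.
Proof.
pose D := [set z | normsq q (x - v0 - z) < e ^+ 2].
have Dx : D (x - v0) by rewrite /D /= subrr normsq0 exprn_gt0.
have [[a [b [[c [s [ac s0 Ds]]] [d [t [bd t0 Dt]]] Dab]]]|[a [b [ab hD]]]] :=
  ray_dichotomy fE sth (@segment_closed_ball x) Dx; last first.
  right; exists a, b; split => //; apply: (grad_face ab) => y yQ; apply: hD => /=.
  by rewrite (_ : x - v0 - (x - y - v0) = y)//; apply: vecP => /=; ring.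
left => xi xi0.
(* The ray may be met at the apex [s' = 0], whereas [hess_ray] needs a positive parameter; the ball
   being open, a short move along the ray stays inside. *)
have pos a' c' s' : (a', c') \in E -> 0 <= s' -> D (s' *: a') ->
    exists2 u, 0 < u & normsq q (x - v0 - u *: a') < e ^+ 2.
  move=> ac' s'0 /level_nbhd[r [k [r0 _ hr]]].
  pose N := 1 + `|a'.1| + `|a'.2|.
  have N0 : 0 < N by rewrite /N; have := normr_ge0 a'.1; have := normr_ge0 a'.2; lra.
  have rN0 : 0 < r / N by rewrite divr_gt0.
  exists (s' + r / N); first by lra.
  have aux (p : R) : `|p| <= N -> `|r / N * p| <= r.
    move=> pN; rewrite normrM gtr0_norm// -[leRHS](divfK (lt0r_neq0 N0)).
    by rewrite ler_pM2l.
  have a1 := aux a'.1 _; have a2 := aux a'.2 _.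
  have {}a1 : `|r / N * a'.1| <= r.
    by apply: a1; rewrite /N; have := normr_ge0 a'.2; lra.
  have {}a2 : `|r / N * a'.2| <= r.
    by apply: a2; rewrite /N; have := normr_ge0 a'.1; lra.
  apply: (hr _ _ _).1; rewrite /= /GRing.scale /=.
    rewrite (_ : _ - _ = - (r / N * a'.1)) ?normrN//; ring.
  rewrite (_ : _ - _ = - (r / N * a'.2)) ?normrN//; ring.
have [Da|Da] := eqVneq (det2 a xi) 0; last first.
  have [u u0 Du] := pos _ _ _ ac s0 Ds.
  exact: (hess_ray ac u0 Du Da).
have [u u0 Du] := pos _ _ _ bd t0 Dt.
apply: (hess_ray bd u0 Du).
apply: contra xi0 => /eqP Db; apply/eqP; rewrite (coordE xi Dab).
have -> : det2 xi b = - det2 b xi by rewrite /det2; ring.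
by rewrite Da Db oppr0 !mul0r !scale0r addr0.
Qed.

End SmoothedSupport.

(** * The image of the gradient *)

Section Hull.
Variable R : realType.
Local Notation V := (R * R)%type.
Implicit Types (s : seq V) (x y m : V).

Lemma interior2P (A : set V) x : interior A x <->
  exists2 r : R, 0 < r & forall z : V, `|z.1| < r -> `|z.2| < r -> A (x + z).
Proof.
split.
  move=> /nbhs_ballP[r /= r0 hr]; exists r => // z z1 z2; apply: hr.
  by split; rewrite /ball /= opprD addNKr normrN.
move=> [r r0 hr]; apply/nbhs_ballP; exists r => // y [].
rewrite /ball /= => y1 y2.
by rewrite -(subrK x y) addrC; apply: hr => /=; rewrite distrC.
Qed.

Lemma conv_hull_mem s x : x \in s -> conv_hull s x.
Proof.
move=> xs; have i0 : (index x s < size s)%N by rewrite index_mem.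
exists (fun i => (i == index x s)%:R); split => [i _||]; first by [].
  rewrite (bigD1 (Ordinal i0)) //= eqxx big1 ?addr0// => i ne.
  by rewrite -val_eqE /= in ne; rewrite (negbTE ne).
rewrite (bigD1 (Ordinal i0)) //= eqxx scale1r big1 ?addr0 ?nth_index// => i ne.
by rewrite -val_eqE /= in ne; rewrite (negbTE ne) scale0r.
Qed.

Lemma conv_hull_convex s x y (t : R) : conv_hull s x -> conv_hull s y ->
  0 <= t <= 1 -> conv_hull s ((1 - t) *: x + t *: y).
Proof.
move=> [w [w0 w1 ->]] [w' [w'0 w'1 ->]] /andP[t0 t1].
exists (fun i => (1 - t) * w i + t * w' i); split => [i si||].
- by rewrite addr_ge0// mulr_ge0 ?w0 ?w'0// subr_ge0.
- by rewrite big_split /= -!mulr_sumr w1 w'1 !mulr1 subrK.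
- rewrite !scaler_sumr -big_split /=; apply: eq_bigr => i _.
  by rewrite [RHS]scalerDl !scalerA.
Qed.

Lemma exists_min_seq (T : eqType) (f : T -> R) (S : seq T) : S != [::] ->
  exists2 p, p \in S & forall p', p' \in S -> f p <= f p'.
Proof.
elim: S => // p S IH _; have [->|/IH[p1 p1S h1]] := eqVneq S [::].
  by exists p; rewrite ?mem_head// => p'; rewrite inE => /eqP ->.
have [le|lt] := leP (f p) (f p1).
  exists p; first exact: mem_head.
  by move=> p'; rewrite inE => /orP[/eqP ->|/h1]//; exact: le_trans.
exists p1; first by rewrite inE p1S orbT.
by move=> p'; rewrite inE => /orP[/eqP ->|/h1]//; exact: ltW.
Qed.

Lemma lin_sum (I : Type) (r : seq I) (w : I -> R) (F : I -> V) x :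
  lin (\sum_(i <- r) w i *: F i) x = \sum_(i <- r) w i * lin (F i) x.
Proof.
elim: r => [|i r IH]; first by rewrite !big_nil /lin /= !mul0r addr0.
by rewrite !big_cons linDl linZl IH.
Qed.

End Hull.

(** * The polygon [K] as the convex hull of the linear pieces *)

Section Polar.
Variable R : realType.
Local Notation V := (R * R)%type.
Variables (E : seq (V * V)) (th : V -> R).
Hypotheses (fE : fan E) (sth : strict_support E th).
Implicit Types (a b c x m u : V).

Let pieces := [seq piece th p.1 p.2 | p <- E].

Lemma ray_neq0 a b : (a, b) \in E -> a != 0.
Proof.
move=> /(fan_det fE); apply: contra => /eqP ->.
by rewrite /det2 /= !mul0r subrr.
Qed.

Lemma sqr_vec_gt0 a : a != 0 -> 0 < lin a a.
Proof.
move=> a0; rewrite /lin -!expr2 lt_neqAle addr_ge0 ?sqr_ge0// andbT eq_sym.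
apply: contra a0; rewrite paddr_eq0 ?sqr_ge0// !sqrf_eq0 => /andP[/eqP h1 /eqP h2].
by apply/eqP; exact: vecP.
Qed.

Lemma hull_polar m : conv_hull pieces m -> polar E th m.
Proof.
move=> [w [w0 w1 ->]] a b ab; rewrite lin_sum.
apply: (@le_trans _ _ (\sum_(i < size pieces) w i * th a)); last first.
  by rewrite -mulr_suml w1 mul1r.
apply: ler_sum => i _; apply: ler_wpM2l; first exact: w0.
have /mapP[[c d] /= cd ->] : pieces`_i \in pieces by exact: mem_nth.
exact: (piece_le fE sth).
Qed.

Lemma mem_pieces a b : (a, b) \in E -> piece th a b \in pieces.
Proof. by move=> ab; apply/mapP; exists (a, b). Qed.

Lemma face_hull m a b : (a, b) \in E -> polar E th m -> lin m a = th a ->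
  conv_hull pieces m.
Proof.
move=> ab Km ma; have [c ac D] := fan_opp fE ab.
have [t t01 ->] := face_segment fE sth ab ac D Km ma.
by apply: conv_hull_convex => //; apply: conv_hull_mem; exact: mem_pieces.
Qed.

(** Move from [m] along [u] until the first constraint becomes tight. One is eventually reached:
    writing [u] in a cone, [lin u u > 0] forces [u] to be positive on some generator. *)
Lemma polar_ray_shoot m u : polar E th m -> u != 0 -> exists t a b,
  [/\ 0 <= t, polar E th (m + t *: u), (a, b) \in E & lin (m + t *: u) a = th a].
Proof.
move=> Km u0.
pose S := [seq p <- E | 0 < lin u p.1].
have S0 : S != [::].
  have [a [b [s [t [ab s0 t0 uE]]]]] := fan_complete fE u.
  have := sqr_vec_gt0 u0; rewrite {2}uE linD !linZ => pos.
  have [ua|ua] := ltP 0 (lin u a).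
    have : (a, b) \in S by rewrite mem_filter ua ab.
    by case: S.
  have [ub|ub] := ltP 0 (lin u b).
    have : (b, a) \in S by rewrite mem_filter ub (fan_sym fE ab).
    by case: S.
  have := mulr_ge0_le0 s0 ua; have := mulr_ge0_le0 t0 ub; lra.
have [[a b]] := @exists_min_seq _ _ (fun p : V * V => (th p.1 - lin m p.1) / lin u p.1) _ S0.
rewrite mem_filter /= => /andP[ua ab] hmin.
exists ((th a - lin m a) / lin u a), a, b; split => //.
- by rewrite divr_ge0 ?(ltW ua)// subr_ge0; exact: Km ab.
- move=> c d cd; rewrite linDl linZl.
  have t0 : 0 <= (th a - lin m a) / lin u a.
    by rewrite divr_ge0 ?(ltW ua)// subr_ge0; exact: Km ab.
  have mc := Km _ _ cd.
  have [uc|uc] := ltP 0 (lin u c); last first.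
    by have := mulr_ge0_le0 t0 uc; lra.
  have : (c, d) \in S by rewrite mem_filter uc cd.
  by move=> /hmin /=; rewrite ler_pdivlMr//; lra.
- by rewrite linDl linZl divfK ?lt0r_neq0// addrC subrK.
Qed.

(** Shooting from [m] in two opposite directions places it between two points lying on edges, and
    edges are segments between pieces. *)
Lemma polar_hull m : polar E th m -> conv_hull pieces m.
Proof.
move=> Km.
pose u : V := (1, 0).
have u0 : u != 0 by rewrite -pair_eqE /= oner_eq0.
have nu0 : - u != 0 by rewrite oppr_eq0.
have [t [a [b [t0 Kt ab ta]]]] := polar_ray_shoot Km u0.
have [t' [a' [b' [t'0 Kt' ab' ta']]]] := polar_ray_shoot Km nu0.
have h1 := face_hull ab Kt ta; have h2 := face_hull ab' Kt' ta'.
have [tz|tp] := eqVneq t 0; first by move: h1; rewrite tz scale0r addr0.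
have tpos : 0 < t by rewrite lt_def tp.
have tt : 0 < t + t' by lra.
have -> : m = (1 - t / (t + t')) *: (m + t *: u) + (t / (t + t')) *: (m + t' *: - u).
  by apply: vecP; rewrite /= /GRing.scale /=; field; exact: lt0r_neq0.
apply: conv_hull_convex => //.
by rewrite divr_ge0 ?(ltW tt)//= ler_pdivrMr// mul1r lerDl.
Qed.

Lemma hull_eq_polar : conv_hull pieces = [set m | polar E th m].
Proof. by apply/seteqP; split => m; [exact: hull_polar|exact: polar_hull]. Qed.

Lemma polar_interiorP m : interior [set m | polar E th m] m <->
  forall a b, (a, b) \in E -> lin m a < th a.
Proof.
split.
  move=> /interior2P[r r0 hr] a b ab.
  have a0 := sqr_vec_gt0 (ray_neq0 ab).
  pose N := 1 + `|a.1| + `|a.2|.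
  have n1 := normr_ge0 a.1; have n2 := normr_ge0 a.2.
  have N0 : 0 < N by rewrite /N; lra.
  have rN0 : 0 < r / N by rewrite divr_gt0.
  have aux (p : R) : `|p| < N -> `|r / N * p| < r.
    move=> pN; rewrite normrM gtr0_norm// -[ltRHS](divfK (lt0r_neq0 N0)).
    by rewrite ltr_pM2l.
  have := hr ((r / N) *: a) _ _ a b ab; rewrite linDl linZl => h.
  apply: lt_le_trans (h _ _).
  - by rewrite ltrDl mulr_gt0.
  - by apply: aux; rewrite /N; lra.
  - by apply: aux; rewrite /N; lra.
move=> h; apply/interior2P.
have [[a b] /= ab|r r0 hr] := @finite_threshold _ _ E (fun p r => forall z : V,
    `|z.1| < r -> `|z.2| < r -> lin (m + z) p.1 <= th p.1); last first.
  by exists r => // z z1 z2 a b ab; apply: (hr _ ab r) => //=; rewrite r0 lexx.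
pose N := 1 + `|a.1| + `|a.2|.
have n1 := normr_ge0 a.1; have n2 := normr_ge0 a.2.
have N0 : 0 < N by rewrite /N; lra.
have d0 : 0 < th a - lin m a by rewrite subr_gt0; exact: h ab.
exists ((th a - lin m a) / N); first by rewrite divr_gt0.
move=> r /andP[r0 rle] z z1 z2; rewrite ler_pdivlMr// in rle.
rewrite linDl {2}/lin.
have h1 : z.1 * a.1 <= r * `|a.1|.
  by apply: le_trans (ler_norm _) _; rewrite normrM ler_wpM2r// ltW.
have h2 : z.2 * a.2 <= r * `|a.2|.
  by apply: le_trans (ler_norm _) _; rewrite normrM ler_wpM2r// ltW.
rewrite /N !mulrDr mulr1 in rle; lra.
Qed.

(** Constraints are made strict one at a time by averaging with a vertex off the edge of [a]: the
    piece on [(b, c)], with [c] across the ray of [b] from [a]. Averaging inside [K] preserves the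
    inequalities already strict. *)
Lemma polar_interior_nonempty : interior [set m | polar E th m] !=set0.
Proof.
suff [m Km hm] : exists2 m, polar E th m &
    forall p, p \in E -> lin m p.1 < th p.1.
  by exists m; apply/polar_interiorP => a b ab; exact: (hm _ ab).
have : {subset E <= E} by [].
elim: {1 4}E => [_|[a b] S IH sub].
  have [a [b [_ [_ [ab _ _ _]]]]] := fan_complete fE 0.
  by exists (piece th a b) => //; exact: polar_piece.
have [|m Km hm] := IH; first by move=> p pS; apply: sub; rewrite inE pS orbT.
have ab : (a, b) \in E by apply: sub; exact: mem_head.
have ba := fan_sym fE ab.
have [c bc D] := fan_opp fE ba.
have lt : lin (piece th b c) a < th a.
  by apply: (piece_lt fE sth bc ba); rewrite mulrC.
have Kp := polar_piece fE sth bc.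
exists (2^-1 *: m + 2^-1 *: piece th b c).
  move=> c' d' cd'; rewrite linDl !linZl.
  have := Km _ _ cd'; have := Kp _ _ cd'; lra.
move=> [c' d'] cd'; rewrite linDl !linZl /=.
have cE : (c', d') \in E by exact: sub.
move: cd'; rewrite inE => /orP[/eqP[-> _]|/hm /= ?].
  by have := Km _ _ ab; lra.
by have := Kp _ _ cE; lra.
Qed.

End Polar.

Lemma unit_IVT (R : realType) (g : R -> R) (y : R) : continuous g ->
  (g 0 <= y /\ y <= g 1) \/ (g 1 <= y /\ y <= g 0) ->
  exists2 u, 0 <= u <= 1 & g u = y.
Proof.
move=> cg h.
have [|u] := @IVT _ g 0 1 y ler01 (continuous_subspaceT cg).
  by case: h => -[h1 h2]; rewrite ge_min le_max h1 h2 ?orbT.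
by rewrite in_itv /= => u01 gu; exists u.
Qed.

(** * Image of the polygon and of its boundary under the gradient *)

Section Image.
Variable R : realType.
Local Notation V := (R * R)%type.
Variables (E : seq (V * V)) (th : V -> R) (q : R * R * R) (v0 : V).
Hypotheses (fE : fan E) (sth : strict_support E th) (hq : is_inner q).
Implicit Types (a b c x m u : V).

Definition star_set : set V := [set x | star_polygon E (x - v0)].

Definition bdry_point x := exists a b s t,
  [/\ (a, b) \in E, 0 <= t <= s, 2 * s + t = 1 & x = v0 + (s *: a + t *: b)].

Lemma bdryE : star_set `\` interior star_set = [set x | bdry_point x].
Proof.
apply/seteqP; split => x /=.
  move=> [[a [b [s [t [ab ts st xE]]]]] nint].
  have xE' : x = v0 + (s *: a + t *: b) by rewrite -xE addrC subrK.
  exists a, b, s, t; split => //; apply/eqP; rewrite eq_le st leNgt.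
  apply/negP => lt; apply: nint.
  have [r r0 hr] := star_polygon_interior fE ab ts lt.
  apply/interior2P; exists r => // z z1 z2.
  by rewrite /star_set /= xE' addrAC (addrC v0) addrK; exact: hr.
move=> [a [b [s [t [ab ts st ->]]]]].
split; first by exists a, b, s, t; rewrite (addrC v0) addrK st.
move=> /interior2P[r r0 hr].
set y := s *: a + t *: b in hr.
pose N := 1 + `|y.1| + `|y.2|.
have n1 := normr_ge0 y.1; have n2 := normr_ge0 y.2.
have N0 : 0 < N by rewrite /N; lra.
have rN0 : 0 < r / N by rewrite divr_gt0.
have aux (p : R) : `|p| < N -> `|r / N * p| < r.
  move=> pN; rewrite normrM gtr0_norm// -[ltRHS](divfK (lt0r_neq0 N0)).
  by rewrite ltr_pM2l.
apply: (star_polygon_bdry fE ab ts st rN0).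
have := hr ((r / N) *: y); rewrite /star_set /= addrAC (addrC v0) addrK.
rewrite scalerDl scale1r; apply.
- by apply: aux; rewrite /N; lra.
- by apply: aux; rewrite /N; lra.
Qed.

(** Polar-like coordinates on one triangular piece: [z.1] is the dilation about [v0], [z.2] the
    position on the boundary segment. Compactness follows from that of the unit square. *)
Definition wedge (p : V * V) (z : V) : V :=
  v0 + z.1 *: ((1 - z.2) *: (2^-1 *: p.1) + z.2 *: (3^-1 *: (p.1 + p.2))).

Lemma continuous_wedge p : continuous (wedge p).
Proof.
move=> z.
have cont (A B C : R) : continuous (fun z : V => A + z.1 * (B + z.2 * C)).
  move=> y; apply: cvgD; first exact: cvg_cst.
  apply: cvgM; first exact: cvg_fst.
  apply: cvgD; first exact: cvg_cst.
  by apply: cvgM; [exact: cvg_snd|exact: cvg_cst].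
rewrite (_ : wedge p = fun z : V =>
  (v0.1 + z.1 * (2^-1 * p.1.1 + z.2 * (3^-1 * (p.1.1 + p.2.1) - 2^-1 * p.1.1)),
   v0.2 + z.1 * (2^-1 * p.1.2 + z.2 * (3^-1 * (p.1.2 + p.2.2) - 2^-1 * p.1.2)))).
  have h := cvg_pair
    (cont v0.1 (2^-1 * p.1.1) (3^-1 * (p.1.1 + p.2.1) - 2^-1 * p.1.1) z)
    (cont v0.2 (2^-1 * p.1.2) (3^-1 * (p.1.2 + p.2.2) - 2^-1 * p.1.2) z).
  exact: h.
by apply/funext => y; apply: vecP; rewrite /wedge /= /GRing.scale /=; ring.
Qed.

Lemma compact_star_set : compact star_set.
Proof.
have -> : star_set = \big[setU/set0]_(p <- E) (wedge p @` (`[0, 1]%classic `*` `[0, 1]%classic)).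
  rewrite -bigcup_seq; apply/seteqP; split => x /=.
    move=> [a [b [s [t [ab /andP[t0 ts] st xE]]]]]; exists (a, b) => //.
    have s0 : 0 <= s by exact: le_trans ts.
    (* The inverse coordinates; at the apex [2 * s + t = 0] the quotient is [0] by convention. *)
    exists (2 * s + t, 3 * t / (2 * s + t)).
      rewrite /= !in_itv /=; split; first by rewrite st andbT; lra.
      have u0 : 0 <= 2 * s + t by lra.
      rewrite divr_ge0//= ?mulr_ge0//.
      have [->|un] := eqVneq (2 * s + t) 0; first by rewrite invr0 mulr0.
      by rewrite ler_pdivrMr ?lt_def ?un// mul1r; lra.
    have -> : x = v0 + (s *: a + t *: b) by rewrite -xE addrC subrK.
    rewrite /wedge /=; congr (_ + _).
    have [uz|un] := eqVneq (2 * s + t) 0.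
      have s00 : s = 0 by lra.
      have t00 : t = 0 by lra.
      by rewrite s00 t00 mulr0 addr0 !scale0r addr0.
    by apply: vecP; rewrite /= /GRing.scale /=; field.
  move=> [[a b] /= ab [[u r] [/=]]]; rewrite !in_itv /= => /andP[u0 u1] /andP[r0 r1] <-.
  exists a, b, (u * (1 - r) / 2 + u * r / 3), (u * r / 3).
  have ur : 0 <= u * r by rewrite mulr_ge0.
  have ur' : 0 <= u * (1 - r) by rewrite mulr_ge0// subr_ge0.
  split => //.
  - by apply/andP; split; lra.
  - lra.
  - by apply: vecP; rewrite /wedge /= /GRing.scale /=; field.
apply: bigsetU_compact => p _.
apply: continuous_compact; last by apply: compact_setX; exact: segment_compact.
by apply: continuous_subspaceT => z; exact: continuous_wedge.
Qed.

Variable e : R.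
Hypothesis e0 : 0 < e.
Let f := smoothed th q e v0.
Let lbG := loc_bounded_thv v0 fE sth.
Let df0 x xi := is_derive_lin0 hq e0 lbG x xi.

(** This is what the smallness of [e] provides. *)
Hypothesis bdry_face : forall a b (s t : R), (a, b) \in E -> 0 <= t <= s ->
  2 * s + t = 1 -> lin (dif f (v0 + (s *: a + t *: b))) a = th a.

Lemma grad_ge x xi (k r : R) : 0 < r ->
  (forall h, 0 < h < r -> f x + h * k <= f (x + h *: xi)) -> k <= lin (dif f x) xi.
Proof.
move=> r0 h; rewrite -lerN2.
apply: (is_derive_right_le (is_deriveN (df0 x xi)) r0) => t ht.
change (- f (x + t *: xi) <= - f (x + 0 *: xi) + t * - k).
rewrite scale0r addr0; have := h t ht; lra.
Qed.

(* The part of the boundary around the ray of [a] is mapped to the line [lin m a = th a];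
   its two end points go beyond the end points of the edge, so the intermediate value
   theorem applies. *)
Lemma face_covered a b m : (a, b) \in E -> polar E th m -> lin m a = th a ->
  exists2 x, bdry_point x & dif f x = m.
Proof.
move=> ab Km ma.
have [c ac D] := fan_opp fE ab.
have Dab := fan_det fE ab.
(* The path along the boundary from the barycenter of the triangle of [a] and [d], at [u = 0], to
   the midpoint of the edge of [a], at [u = 1]. *)
pose P (d : V) (u : R) : V := (v0 + (3^-1 *: a + 3^-1 *: d)) + u *: (6^-1 *: a - 3^-1 *: d).
have PE (d : V) (u : R) : P d u = v0 + ((3^-1 + u * 6^-1) *: a + ((1 - u) * 3^-1) *: d).
  by apply: vecP; rewrite /P /= /GRing.scale /=; ring.
have Pb (d : V) (u : R) : (a, d) \in E -> 0 <= u <= 1 -> bdry_point (P d u) /\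
    lin (dif f (P d u)) a = th a.
  move=> ad /andP[u0 u1]; rewrite PE; split.
    exists a, d, (3^-1 + u * 6^-1), ((1 - u) * 3^-1); split => //; last by field.
    by apply/andP; split; lra.
  by apply: bdry_face => //; [apply/andP; split; lra|field].
have cP (d : V) : continuous (fun u : R => lin (dif f (P d u)) b).
  by move=> u; exact: (continuous_lin_dif hq e0 lbG).
have conclude (d : V) (u : R) : (a, d) \in E -> 0 <= u <= 1 -> lin (dif f (P d u)) b = lin m b ->
    exists2 x, bdry_point x & dif f x = m.
  move=> ad u01 h; have [hb hl] := Pb d u ad u01; exists (P d u) => //.
  by apply: (lin_inj Dab); rewrite ?hl ?ma.
(* The barycenter of a triangle belongs to the boundary parts of both its rays, so the constraint at
   [d] is tight there too. *)
have P0 (d : V) : (a, d) \in E -> lin (dif f (P d 0)) d = th d.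
  move=> ad; have -> : P d 0 = v0 + (3^-1 *: d + 3^-1 *: a).
    by rewrite /P scale0r addr0 (addrC (_ *: a)).
  apply: bdry_face; [exact: (fan_sym fE ad)|by rewrite lexx andbT; lra|lra].
have Pbc : P b 1 = P c 1 by rewrite !PE subrr mul0r !scale0r.
have hb0 : lin m b <= lin (dif f (P b 0)) b by rewrite P0//; exact: Km (fan_sym fE ab).
have hc0 : lin (dif f (P c 0)) b <= lin m b.
  have [k [l [l0 bE]]] : exists k l : R, 0 < l /\ b = k *: a - l *: c.
    by apply: opp_coord; rewrite mulrC.
  have z01 : 0 <= (0 : R) <= 1 by rewrite lexx ler01.
  have [_ ha] := Pb c 0 ac z01.
  have hc := P0 c ac; have mc := Km _ _ (fan_sym fE ac).
  have lb m' : lin m' b = k * lin m' a - l * lin m' c.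
    by rewrite bE /lin /= /GRing.scale /=; ring.
  by rewrite !lb ha ma hc lerD2l lerN2 ler_pM2l.
(* The gradient at the common midpoint decides on which of the two halves, towards [b] or towards
   [c], the value is attained. *)
have [le|lt] := leP (lin (dif f (P b 1)) b) (lin m b).
  have [u u01] := unit_IVT (cP b) (or_intror (conj le hb0)).
  exact: conclude.
rewrite Pbc in lt.
have [u u01] := unit_IVT (cP c) (or_introl (conj hc0 (ltW lt))).
exact: conclude.
Qed.

Lemma bdry_image : dif f @` [set x | bdry_point x] =
  [set m | polar E th m] `\` interior [set m | polar E th m].
Proof.
apply/seteqP; split => m.
  move=> [x [a [b [s [t [ab ts st ->]]]]] <-]; split; first exact: grad_polar.
  move=> /polar_interiorP h; have := h fE _ _ ab.
  by rewrite bdry_face// ltxx.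
move=> [Km nint].
have [[a [b [ab ma]]]|none] := pselect (exists a b, (a, b) \in E /\ lin m a = th a).
  by have [x bx <-] := face_covered ab Km ma; exists x.
exfalso; apply: nint; apply/polar_interiorP => // a b ab.
rewrite lt_neqAle (Km _ _ ab) andbT; apply/eqP => h; apply: none.
by exists a, b.
Qed.

(** Moving along [- a] lowers [s]. If [t < s] the point stays in the same triangular piece; if
    [t = s] it passes at once to the piece of [(b, a)]. *)
Lemma star_polygon_shrink a b (s t : R) : (a, b) \in E -> 0 <= t <= s -> 2 * s + t = 1 ->
  exists2 r : R, 0 < r & forall h, 0 < h < r ->
    star_polygon E (s *: a + t *: b + h *: - a).
Proof.
move=> ab /andP[t0 ts] st.
have E1 h : s *: a + t *: b + h *: - a = (s - h) *: a + t *: b.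
  by apply: vecP; rewrite /= /GRing.scale /=; ring.
have [tE|tn] := eqVneq t s; last first.
  have lt : t < s by rewrite lt_neqAle tn.
  exists (s - t); first by rewrite subr_gt0.
  move=> h /andP[h0 hr]; exists a, b, (s - h), t; split => //.
  - by rewrite t0; lra.
  - lra.
rewrite tE in st *; have s0 : 0 < s by lra.
exists s => // h /andP[h0 hs]; exists b, a, s, (s - h); split.
- exact: (fan_sym fE ab).
- by apply/andP; split; lra.
- lra.
- by apply: vecP; rewrite /= /GRing.scale /=; ring.
Qed.

(* Minimize [f - m] over the polygon: a minimizer on the boundary could be moved inwards
   along [- a], where the directional derivative is [lin m a - th a < 0]. *)
Lemma interior_covered m : (forall a b, (a, b) \in E -> lin m a < th a) ->
  exists2 x, star_set x & dif f x = m.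
Proof.
move=> hm.
have star0 : star_set !=set0.
  have [a [b [_ [_ [ab _ _ _]]]]] := fan_complete fE 0.
  by exists v0, a, b, 0, 0; rewrite subrr !scale0r mulr0 !addr0 lexx; split.
pose g x := f x - lin m x.
have cg : continuous g.
  move=> x; apply: cvgB; first exact: (continuous_smoothed fE sth hq e0).
  rewrite /lin; apply: cvgD; apply: cvgM; try exact: cvg_cst.
    exact: cvg_fst.
  exact: cvg_snd.
have [x] := compact_EVT_min star0 compact_star_set (continuous_subspaceT cg).
rewrite inE => xS hx.
have step xi (r : R) : 0 < r -> (forall h, 0 < h < r -> star_set (x + h *: xi)) ->
    lin m xi <= lin (dif f x) xi.
  move=> r0 hr; apply: (grad_ge r0) => h hh.
  have := hx (x + h *: xi); rewrite inE => /(_ (hr _ hh)).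
  by rewrite /g linD linZ; lra.
have [xint|nint] := pselect (interior star_set x).
  exists x => //.
  move/interior2P : xint => [r r0 hr].
  have dir xi : `|xi.1| <= 1 -> `|xi.2| <= 1 -> lin m xi <= lin (dif f x) xi.
    move=> x1 x2; apply: (step _ r r0) => h /andP[h0 hlt]; apply: hr;
    rewrite /= /GRing.scale /= normrM gtr0_norm//; apply: le_lt_trans hlt;
    by rewrite ler_piMr// ltW.
  have d1 := dir (1, 0) _ _; have d2 := dir (-1, 0) _ _.
  have d3 := dir (0, 1) _ _; have d4 := dir (0, -1) _ _.
  move: d1 d2 d3 d4; rewrite /lin /= !normrN !normr1 !normr0.
  move=> /(_ (lexx 1) ler01) d1 /(_ (lexx 1) ler01) d2 /(_ ler01 (lexx 1)) d3 /(_ ler01 (lexx 1)) d4.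
  by apply: vecP; rewrite /dif /=; lra.
have : (star_set `\` interior star_set) x by split.
rewrite bdryE => -[a [b [s [t [ab ts st xE]]]]].
have [r r0 hr] := star_polygon_shrink ab ts st.
have := step (- a) r r0 _.
have linN m' : lin m' (- a) = - lin m' a by rewrite /lin /=; ring.
rewrite !linN xE bdry_face// => h.
have := hm _ _ ab; rewrite ltNge => /negP; case.
rewrite -lerN2; apply: h => h' hh'.
by rewrite /star_set /= addrAC (addrC v0) addrK; exact: hr.
Qed.

Lemma star_image : dif f @` star_set = [set m | polar E th m].
Proof.
apply/seteqP; split => m; first by move=> [x _ <-]; exact: grad_polar.
move=> Km; have [int|nint] := pselect (interior [set m | polar E th m] m).
  move/polar_interiorP : int => /(_ fE) hm.
  by have [x xS <-] := interior_covered hm; exists x.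
have : ([set m | polar E th m] `\` interior [set m | polar E th m]) m by split.
rewrite -bdry_image -bdryE => -[x [xS _] <-].
by exists x.
Qed.

End Image.

Lemma smoothed_support_image (R : realType) (E : seq ((R * R) * (R * R)))
    (th : R * R -> R) (q : R * R * R) (v0 : R * R) :
  fan E -> strict_support E th -> is_inner q ->
  exists2 e0 : R, 0 < e0 & forall e, 0 < e < e0 ->
    let f := smoothed th q e v0 in
    let gamma_img := dif f @` (star_set E v0 `\` interior (star_set E v0)) in
    (forall b, gamma_img (dif f b) \/ hess_posdef f b) /\
    (exists s : seq (R * R),
       [/\ dif f @` star_set E v0 = conv_hull s,
           interior (conv_hull s) !=set0 &
           conv_hull s `\` interior (conv_hull s) = gamma_img]).
Proof.
move=> fE sth hq.
have [r r0 hr] := additive_bdry fE sth.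
have [c c0 hc] := normsq_small hq.
(* For [e < r / c] the ball of radius [e] lies in the coordinate box of size [r] allowed by
   [additive_bdry]. *)
exists (r / c); first by rewrite divr_gt0.
move=> e /andP[e0 ee]; rewrite ltr_pdivlMr// in ee.
have face a b (s t : R) : (a, b) \in E -> 0 <= t <= s -> 2 * s + t = 1 ->
    lin (dif (smoothed th q e v0) (v0 + (s *: a + t *: b))) a = th a.
  move=> ab ts st; apply: (grad_face fE sth hq e0 ab) => y yQ.
  have [y1 y2] := hc _ _ e0 yQ.
  have -> : v0 + (s *: a + t *: b) - y - v0 = s *: a + t *: b - y.
    by apply: vecP => /=; ring.
  by apply: (hr a b s t y ab ts st); lra.
move=> f gamma_img.
have gE : gamma_img = [set m | polar E th m] `\` interior [set m | polar E th m].
  by rewrite /gamma_img bdryE//; exact: bdry_image.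
split.
  move=> b; have [h|[a [d [ad h]]]] := hess_or_face v0 fE sth hq e0 b; first by right.
  left; rewrite gE; split; first exact: grad_polar.
  by move=> /polar_interiorP => /(_ fE _ _ ad); rewrite h ltxx.
exists [seq piece th p.1 p.2 | p <- E]; rewrite (hull_eq_polar fE sth); split.
- exact: star_image.
- exact: polar_interior_nonempty.
- by rewrite gE.
Qed.

(** * The fan at a vertex of a unimodular triangulation *)

Section AbstractFan.
Variable R : realType.
Local Notation V := (R * R)%type.
Variable E : seq (V * V).
Implicit Types (a b c d x : V) (s t : R).

(* For small [r > 0] a cone containing [a - r *: b] also contains [a]; it is the
   neighbour of [(a, b)] across [a]. *)
Lemma fan_of_complete :
  (forall a b, (a, b) \in E -> (b, a) \in E) ->
  (forall a b, (a, b) \in E -> det2 a b != 0) ->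
  (forall x, exists a b s t, [/\ (a, b) \in E, 0 <= s, 0 <= t & x = s *: a + t *: b]) ->
  (forall a b c d s t s' t', (a, b) \in E -> (c, d) \in E ->
    0 < s -> 0 <= t -> 0 <= s' -> 0 <= t' ->
    s *: a + t *: b = s' *: c + t' *: d ->
    (a = c /\ s = s') \/ (a = d /\ s = t')) ->
  fan E.
Proof.
move=> Esym Edet Ecomp Eagree; split => // a b ab.
have [[c d] /= cd|r r0 hr] := @finite_threshold _ _ E (fun p r => forall s t,
    0 <= s -> 0 <= t -> a - r *: b = s *: p.1 + t *: p.2 ->
    exists s' t', [/\ 0 <= s', 0 <= t' & a = s' *: p.1 + t' *: p.2]).
  have D := Edet _ _ cd.
  move: (coordE a D) (coordE b D).
  set p := _ / _; set u := det2 c a / _; set p' := det2 b d / _; set u' := det2 c b / _.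
  move=> aE bE.
  have [[p0 u0]|neg] := pselect (0 <= p /\ 0 <= u).
    by exists 1 => // r _ s t s0 t0 _; exists p, u.
  (* When [a] is outside the cone, its most negative coordinate is [- g]; the threshold lets
     [r *: b] alter it by at most [g / 2]. *)
  pose g := - Num.min p u.
  have g0 : 0 < g.
    rewrite oppr_gt0 gt_min; have [p0|] := leP 0 p; last by [].
    by have [u0|] := leP 0 u; [case: neg|].
  have n1 := normr_ge0 p'; have n2 := normr_ge0 u'.
  pose N := 1 + `|p'| + `|u'|.
  have N0 : 0 < N by rewrite /N; lra.
  exists (g / 2 / N); first by rewrite !divr_gt0.
  move=> r /andP[r0 rle] s t s0 t0; rewrite ler_pdivlMr// in rle.
  have -> : a - r *: b = (p - r * p') *: c + (u - r * u') *: d.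
    rewrite {1}aE {1}bE; apply: vecP; rewrite /= /GRing.scale /=; ring.
  move=> /(coord_inj D)[sE tE].
  have h1 : - (r * p') <= r * `|p'|.
    by apply: le_trans (ler_norm _) _; rewrite normrN normrM gtr0_norm.
  have h2 : - (r * u') <= r * `|u'|.
    by apply: le_trans (ler_norm _) _; rewrite normrN normrM gtr0_norm.
  have h3 : 0 <= r * `|p'| by rewrite mulr_ge0// ltW.
  have h4 : 0 <= r * `|u'| by rewrite mulr_ge0// ltW.
  rewrite /N !mulrDr mulr1 in rle.
  have : - g = p \/ - g = u.
    by rewrite /g opprK /Num.min; case: ifP; [left|right].
  move=> gE; suff : (0 : R) < 0 by rewrite ltxx.
  by case: gE => ?; lra.
have Dab := Edet _ _ ab.
have key c d s t : (c, d) \in E -> 0 <= s -> 0 <= t -> a - r *: b = s *: c + t *: d ->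
    a = c -> det2 a b * det2 a d < 0.
  move=> cd s0 t0 xE ac.
  have Dad : det2 a d != 0 by rewrite ac Edet.
  (* Pairing with [a] isolates the other generators: [- r * det2 a b = t * det2 a d] with [t > 0],
     so [b] and [d] are on opposite sides. *)
  have h : det2 a (a - r *: b) = det2 a (s *: c + t *: d) by rewrite xE.
  have {}h : - r * det2 a b = t * det2 a d.
    by move: h; rewrite -ac /det2 /= /GRing.scale /= => h; lra.
  have t1 : 0 < t.
    rewrite lt_def t0 andbT; apply/eqP => tz; move: h; rewrite tz mul0r => /eqP.
    by rewrite mulf_eq0 oppr_eq0 (negbTE Dab) orbF gt_eqF.
  have -> : det2 a b * det2 a d = - (r / t * det2 a b ^+ 2).
    have -> : det2 a d = - r * det2 a b / t by rewrite h mulrC mulKf// lt0r_neq0.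
    by field; exact: lt0r_neq0.
  by rewrite oppr_lt0 mulr_gt0 ?divr_gt0// exprn_even_gt0.
have [c [d [s [t [cd s0 t0 xE]]]]] := Ecomp (a - r *: b).
have [|s' [t' [s'0 t'0 aE]]] := hr _ cd r _ s t s0 t0 xE; first by rewrite r0 lexx.
have aE' : 1 *: a + 0 *: b = s' *: c + t' *: d by rewrite scale1r scale0r addr0.
have [[ac _]|[ad _]] := Eagree _ _ _ _ _ _ _ _ ab cd ltr01 (lexx 0) s'0 t'0 aE'.
  by exists d; [rewrite ac|exact: (key c d s t)].
exists c; first by rewrite ad; exact: Esym.
apply: (key d c t s) => //; first exact: Esym.
by rewrite xE addrC.
Qed.

End AbstractFan.

Section Weights.
Variable R : realType.
Local Notation V := (R * R)%type.
Implicit Types (s : seq lpt) (z : V) (g : lpt -> R).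

(** Weights indexed by lattice points instead of positions, zero off the list, so that the weights
    on a common face can be read in either triangle. *)
Lemma conv_hull_weights s z : uniq s -> conv_hull (map (@toR R) s) z ->
  exists g, [/\ forall p, 0 <= g p, forall p, p \notin s -> g p = 0,
    \sum_(p <- s) g p = 1 & z = \sum_(p <- s) g p *: toR R p].
Proof.
move=> us [w [w0 w1 zE]]; rewrite size_map in w0 w1 zE.
exists (fun p => if p \in s then w (index p s) else 0); split.
- by move=> p; case: ifP => // ps; apply: w0; rewrite index_mem.
- by move=> p /negbTE ->.
- rewrite (big_nth (0, 0)) big_mkord -[RHS]w1; apply: eq_bigr => i _.
  by rewrite mem_nth// index_uniq.
- rewrite (big_nth (0, 0)) big_mkord zE; apply: eq_bigr => i _.
  by rewrite mem_nth// index_uniq// (nth_map (0, 0)).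
Qed.

Lemma weights_conv_hull s g : (forall p, p \in s -> 0 <= g p) ->
  \sum_(p <- s) g p = 1 ->
  conv_hull (map (@toR R) s) (\sum_(p <- s) g p *: toR R p).
Proof.
move=> g0 g1; exists (fun i => g (nth (0, 0) s i)); rewrite size_map; split.
- by move=> i si; apply: g0; exact: mem_nth.
- by rewrite -[RHS]g1 (big_nth (0, 0)) big_mkord.
- rewrite (big_nth (0, 0)) big_mkord; apply: eq_bigr => i _.
  by rewrite (nth_map (0, 0)).
Qed.

Lemma conv_hull3P (a b c x : V) : conv_hull [:: a; b; c] x <->
  exists u v w : R, [/\ 0 <= u, 0 <= v, 0 <= w, u + v + w = 1 &
    x = u *: a + v *: b + w *: c].
Proof.
split.
  move=> [w [w0 w1 ->]]; exists (w 0), (w 1), (w 2).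
  move: w1; rewrite !big_ord_recl !big_ord0 /= !addr0 !addrA => w1.
  by split => //; exact: w0.
move=> [u [v [w [u0 v0 w0 s1 ->]]]].
exists (fun i => nth 0 [:: u; v; w] i); split.
- by case=> [|[|[|i]]].
- by rewrite !big_ord_recl !big_ord0 /= !addr0 addrA.
- by rewrite !big_ord_recl !big_ord0 /= !addr0 !addrA.
Qed.

End Weights.

(** Lattice points of an elementary triangle are its vertices, in barycentric coordinates. *)
Lemma int_simplex (b c : int) : 0 <= b -> 0 <= c -> 0 <= 1 - b - c ->
  (b = 0 /\ c = 0) \/ (b = 1 /\ c = 0) \/ (b = 0 /\ c = 1).
Proof. lia. Qed.

Section Star.
Variables (R : realType) (P : set (R * R)) (Ts : seq ltri) (v : lpt).
Local Notation V := (R * R)%type.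
Hypothesis hT : unimodular_triangulation P Ts.
Implicit Types (w u p : lpt) (T : ltri) (x z : V).

Let ray w : V := toR R w - toR R v.

Lemma toR_inj : injective (@toR R).
Proof. by move=> [p1 p2] [q1 q2] [/intr_inj -> /intr_inj ->]. Qed.

Lemma ray_inj : injective ray.
Proof. by move=> w w' /addIr /toR_inj. Qed.

Definition tdet (p0 p1 p2 : lpt) : int :=
  Defs.detZ (p1.1 - p0.1, p1.2 - p0.2) (p2.1 - p0.1, p2.2 - p0.2).

Lemma det2_tdet (p0 p1 p2 : lpt) :
  det2 (toR R p1 - toR R p0) (toR R p2 - toR R p0) = (tdet p0 p1 p2)%:~R.
Proof. by rewrite /det2 /tdet /Defs.detZ /toR /= !(intrM, intrB). Qed.

Lemma perm3 (A : eqType) (x y z a b c : A) : perm_eq [:: x; y; z] [:: a; b; c] ->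
  [\/ [/\ x = a, y = b & z = c], [/\ x = a, y = c & z = b], [/\ x = b, y = a & z = c] |
   [\/ [/\ x = b, y = c & z = a], [/\ x = c, y = a & z = b] | [/\ x = c, y = b & z = a]]].
Proof.
have perm2 (x' y' a' b' : A) : perm_eq [:: x'; y'] [:: a'; b'] ->
    (x' = a' /\ y' = b') \/ (x' = b' /\ y' = a').
  move=> h; have := perm_mem h x'; rewrite !inE eqxx /= => /esym/orP[/eqP E|/eqP E].
    left; split => //; move: h; rewrite E perm_cons => /perm_mem /(_ y').
    by rewrite !inE eqxx => /esym/eqP.
  right; split => //; move: h; rewrite E (perm_sym _ [:: a'; b']) (perm_catC [:: a'] [:: b']) /=.
  by rewrite perm_cons => /perm_mem /(_ y'); rewrite !inE eqxx => /eqP.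
move=> h; have := perm_mem h x; rewrite !inE eqxx /= => /esym/or3P[] /eqP E.
- move: h; rewrite E perm_cons => /perm2[[-> ->]|[-> ->]].
    by constructor 1.
  by constructor 2.
- move: h; rewrite E perm_sym (perm_catCA [:: a] [:: b] [:: c]) /= perm_cons perm_sym.
  move=> /perm2[[-> ->]|[-> ->]]; first by constructor 3.
  by constructor 4; constructor 1.
- move: h; rewrite E perm_sym (perm_catC [:: a; b] [:: c]) /= perm_cons perm_sym.
  move=> /perm2[[-> ->]|[-> ->]]; first by constructor 4; constructor 2.
  by constructor 4; constructor 3.
Qed.

Lemma unimodular_tdet T p0 p1 p2 : unimodular_tri T ->
  perm_eq (tverts T) [:: p0; p1; p2] -> `|tdet p0 p1 p2| = 1.
Proof.
move=> uT; case: T uT => [[x y] z]; rewrite /unimodular_tri /tverts /= => uT h.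
have H (d d' : int) : (d = d' \/ d = - d') -> `|d'| = 1 -> `|d| = 1.
  by move=> [->|->]; rewrite ?normrN.
apply: (H _ _ _ uT); rewrite /tdet /Defs.detZ /=.
case: (perm3 h) => [[-> -> ->]|[-> -> ->]|[-> -> ->]|[[-> -> ->]|[-> -> ->]|[-> -> ->]]];
  solve [left; ring|right; ring].
Qed.

Lemma tdet_neq0 p0 p1 p2 : `|tdet p0 p1 p2| = 1 -> tdet p0 p1 p2 != 0.
Proof. by move=> h; rewrite -normr_eq0 h. Qed.

Lemma uniq3_tdet p0 p1 p2 : tdet p0 p1 p2 != 0 -> uniq [:: p0; p1; p2].
Proof.
move=> D; rewrite /= !inE negb_or andbT -andbA; apply/and3P; split;
  apply: contra D => /eqP ->; apply/eqP; rewrite /tdet /Defs.detZ /=; ring.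
Qed.

Lemma star_tdet w w' : star_tri Ts v w w' -> `|tdet v w w'| = 1.
Proof. by move=> [T TTs /unimodular_tdet]; apply; case: hT => _ + _; apply. Qed.

Lemma star_sym w w' : star_tri Ts v w w' -> star_tri Ts v w' w.
Proof.
move=> [T TTs h]; exists T => //; apply: perm_trans h _.
by rewrite perm_cons (perm_catC [:: w] [:: w']).
Qed.

Lemma common_face T T' z : T \in Ts -> T' \in Ts -> @tri_set R T z -> @tri_set R T' z ->
  conv_hull (map (@toR R) [seq p <- tverts T | p \in tverts T']) z.
Proof.
move=> TTs T'Ts zT zT'.
case: hT => _ _ hI.
have [ij|ij] := eqVneq (index T Ts) (index T' Ts).
  have -> : T' = T by rewrite -(nth_index T0 TTs) ij nth_index.
  by rewrite (_ : [seq p <- _ | _] = tverts T)//; apply/all_filterP/allP.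
have [] := hI (index T Ts) (index T' Ts); rewrite ?index_mem//; first exact/eqP.
rewrite !nth_index// => _ <-.
by [].
Qed.

Lemma star_point T w w' (s t : R) : star_tri Ts v w w' -> T \in Ts ->
  perm_eq (tverts T) [:: v; w; w'] -> 0 <= s -> 0 <= t -> s + t <= 1 ->
  @tri_set R T (toR R v + (s *: ray w + t *: ray w')).
Proof.
move=> st TTs pT s0 t0 st1.
have := uniq3_tdet (tdet_neq0 (star_tdet st)).
rewrite /= !inE negb_or andbT => /andP[/andP[vw vw'] ww'].
pose g p : R := if p == v then 1 - s - t else if p == w then s else t.
have g0 p : 0 <= g p by rewrite /g; case: ifP => _; [lra|case: ifP].
have gv : g v = 1 - s - t by rewrite /g eqxx.
have gw : g w = s by rewrite /g eq_sym (negbTE vw) eqxx.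
have gw' : g w' = t by rewrite /g !(eq_sym w') (negbTE vw') (negbTE ww').
have := @weights_conv_hull R (tverts T) g (fun p _ => g0 p).
rewrite !(perm_big _ pT) /= !big_cons !big_nil /= gv gw gw' !addr0 => h.
rewrite (_ : _ + _ = (1 - s - t) *: toR R v + (s *: toR R w + t *: toR R w')).
  by apply: h; ring.
by rewrite /ray; apply: vecP; rewrite /= /GRing.scale /=; ring.
Qed.

Lemma weights_star w w' g (s t : R) : star_tri Ts v w w' ->
  \sum_(p <- [:: v; w; w']) g p = 1 ->
  toR R v + (s *: ray w + t *: ray w') = \sum_(p <- [:: v; w; w']) g p *: toR R p ->
  g w = s /\ g w' = t.
Proof.
move=> st; rewrite !big_cons !big_nil !addr0 => g1 h.
have D : det2 (ray w) (ray w') != 0.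
  by rewrite det2_tdet intr_eq0 tdet_neq0// star_tdet.
have gv : g v = 1 - g w - g w' by rewrite -g1; ring.
apply: (coord_inj D); apply: (addrI (toR R v)); rewrite h gv /ray.
by apply: vecP; rewrite /= /GRing.scale /=; ring.
Qed.

(** Shrunk towards [v], the common vector gives a point of both triangles, hence of their common
    face. Barycentric weights on that face are the coefficients in both triangles, and [w], having
    positive weight, is a vertex of the second one. *)
Lemma star_agree w w' u u' (s t s' t' : R) : star_tri Ts v w w' -> star_tri Ts v u u' ->
  0 < s -> 0 <= t -> 0 <= s' -> 0 <= t' ->
  s *: ray w + t *: ray w' = s' *: ray u + t' *: ray u' ->
  (w = u /\ s = s') \/ (w = u' /\ s = t').
Proof.
move=> ww uu s0 t0 s'0 t'0 h.
have [T TTs pT] := ww; have [T' T'Ts pT'] := uu.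
(* A scale for which both coefficient sums are at most [1]. *)
pose l := (1 + s + t + s' + t')^-1.
have L0 : 0 < 1 + s + t + s' + t' by lra.
have l0 : 0 < l by rewrite invr_gt0.
have lL : l * (1 + s + t + s' + t') = 1 by rewrite mulVf// lt0r_neq0.
have ls := mulr_gt0 l0 s0; have lt := mulr_ge0 (ltW l0) t0.
have ls' := mulr_ge0 (ltW l0) s'0; have lt' := mulr_ge0 (ltW l0) t'0.
pose z := toR R v + ((l * s) *: ray w + (l * t) *: ray w').
have zE : z = toR R v + ((l * s') *: ray u + (l * t') *: ray u').
  by rewrite /z -!scalerA -!scalerDr h.
have zT : @tri_set R T z by apply: star_point => //; [exact: ltW|lra].
have zT' : @tri_set R T' z by rewrite zE; apply: star_point => //; lra.
have uT : uniq (tverts T).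
  by rewrite (perm_uniq pT) uniq3_tdet// tdet_neq0// star_tdet.
have uT' : uniq (tverts T').
  by rewrite (perm_uniq pT') uniq3_tdet// tdet_neq0// star_tdet.
have [g [g0 gout g1 gz]] := conv_hull_weights (filter_uniq _ uT) (common_face TTs T'Ts zT zT').
have sumT (W : lmodType R) (F : lpt -> W) :
    \sum_(p <- [seq p <- tverts T | p \in tverts T']) g p *: F p =
    \sum_(p <- [:: v; w; w']) g p *: F p.
  rewrite -(perm_big _ pT) big_filter big_mkcond /=; apply: eq_big_seq => p pT1.
  by case: ifPn => // pn; rewrite gout ?scale0r// mem_filter negb_and pn.
have sumT' (W : lmodType R) (F : lpt -> W) :
    \sum_(p <- [seq p <- tverts T | p \in tverts T']) g p *: F p =
    \sum_(p <- [:: v; u; u']) g p *: F p.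
  have pp : perm_eq [seq p <- tverts T | p \in tverts T']
      [seq p <- tverts T' | p \in tverts T].
    apply: uniq_perm; rewrite ?filter_uniq// => p.
    by rewrite !mem_filter andbC.
  rewrite -(perm_big _ pT') (perm_big _ pp).
  rewrite big_filter big_mkcond /=; apply: eq_big_seq => p pT1.
  by case: ifPn => // pn; rewrite gout ?scale0r// mem_filter negb_and pn orbT.
(* Reads the total weight as a weighted sum of the constant [1], so that [sumT] and [sumT'] apply to
   it as well. *)
have one r : \sum_(p <- r) g p = \sum_(p <- r) g p *: (1 : R^o).
  by apply: eq_bigr => p _; rewrite /GRing.scale /= mulr1.
have [gw gw'] : g w = l * s /\ g w' = l * t.
  by apply: weights_star ww _ _; rewrite ?one -sumT// -one.
have [gu gu'] : g u = l * s' /\ g u' = l * t'.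
  by apply: weights_star uu _ _; rewrite ?one -sumT' -?one// -zE.
have wT' : w \in tverts T'.
  have : w \in [seq p <- tverts T | p \in tverts T'].
    by apply: contraLR ls => /gout; rewrite gw => ->; rewrite ltxx.
  by rewrite mem_filter => /andP[].
have ln : l != 0 by exact: lt0r_neq0.
move: wT'; rewrite (perm_mem pT') !inE => /or3P[] /eqP E.
- by have := uniq3_tdet (tdet_neq0 (star_tdet ww)); rewrite E /= !inE eqxx.
- by left; split => //; apply: (mulfI ln); rewrite -gw -gu E.
- by right; split => //; apply: (mulfI ln); rewrite -gw -gu' E.
Qed.

Lemma int_gtN1 (n : int) : (-1 : R) < n%:~R -> 0 <= n.
Proof.
rewrite (_ : (-1 : R) = (-1)%:~R) ?ltr_int; last by rewrite mulrNz.
by lia.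
Qed.

(* By unimodularity the barycentric coordinates of [v] in [T] are integers; if [T] has
   points close enough to [v] they are nonnegative, so that [v] is a vertex of [T]. *)
Lemma tri_germ T x : T \in Ts -> exists2 r : R, 0 < r & forall d, 0 < d <= r ->
  @tri_set R T (toR R v + d *: x) ->
  exists w w' (s t : R), [/\ star_tri Ts v w w', 0 <= s, 0 <= t & x = s *: ray w + t *: ray w'].
Proof.
move=> TTs; have uT : unimodular_tri T by case: hT => _ + _; apply.
case: T TTs uT => [[p0 p1] p2] TTs uT.
have D1 := unimodular_tdet uT (perm_refl _).
rewrite /= in D1.
have D0 := tdet_neq0 D1.
have DR : det2 (toR R p1 - toR R p0) (toR R p2 - toR R p0) != 0.
  by rewrite det2_tdet intr_eq0.
pose D := tdet p0 p1 p2.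
have DD : D * D = 1.
  by rewrite -expr2 -real_normK ?num_real// D1 expr1n.
(* As [D] is [1] or [-1] it is its own inverse, and Cramer's rule has integer values. *)
pose bz := D * tdet p0 v p2; pose cz := D * tdet p0 p1 v.
have vE : toR R v = toR R p0 + (bz%:~R *: (toR R p1 - toR R p0) + cz%:~R *: (toR R p2 - toR R p0)).
  have h1 : v.1 = p0.1 + (bz * (p1.1 - p0.1) + cz * (p2.1 - p0.1)).
    transitivity (p0.1 + (D * D) * (v.1 - p0.1)); first by rewrite DD; ring.
    by rewrite /bz /cz /D /tdet /Defs.detZ /=; ring.
  have h2 : v.2 = p0.2 + (bz * (p1.2 - p0.2) + cz * (p2.2 - p0.2)).
    transitivity (p0.2 + (D * D) * (v.2 - p0.2)); first by rewrite DD; ring.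
    by rewrite /bz /cz /D /tdet /Defs.detZ /=; ring.
  clearbody bz cz; apply: vecP; rewrite /= /GRing.scale /=.
    by rewrite -!rmorphB -!rmorphM -!rmorphD /= -h1.
  by rewrite -!rmorphB -!rmorphM -!rmorphD /= -h2.
move: (coordE x DR); set bx := _ / _; set cx := det2 (_ - _) x / _ => xE.
clearbody bz cz bx cx.
have n1 := normr_ge0 bx; have n2 := normr_ge0 cx.
(* Along [d *: x] each barycentric coordinate moves by less than [1]; being nonnegative afterwards,
   the integer coordinate of [v] exceeds [-1], so it is nonnegative. *)
pose N := 2 + 2 * `|bx| + 2 * `|cx|.
have N0 : 0 < N by rewrite /N; lra.
exists N^-1; first by rewrite invr_gt0.
move=> d /andP[d0 dle].
have dN : d * N <= 1 by rewrite -(mulVf (lt0r_neq0 N0)) ler_pM2r.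
have dbx : `|d * bx| = d * `|bx| by rewrite normrM gtr0_norm.
have dcx : `|d * cx| = d * `|cx| by rewrite normrM gtr0_norm.
have db0 : 0 <= d * `|bx| by rewrite mulr_ge0// ltW.
have dc0 : 0 <= d * `|cx| by rewrite mulr_ge0// ltW.
have [] : d * `|bx| < 2^-1 /\ d * `|cx| < 2^-1.
  by rewrite /N !mulrDr in dN; split; lra.
rewrite -dbx -dcx !ltr_norml => /andP[b1 b2] /andP[c1 c2].
rewrite /tri_set /tverts /= => /conv_hull3P[al [be [ga [al0 be0 ga0 sum1 zE]]]].
have hbc : (bz%:~R + d * bx) *: (toR R p1 - toR R p0) +
     (cz%:~R + d * cx) *: (toR R p2 - toR R p0) =
     be *: (toR R p1 - toR R p0) + ga *: (toR R p2 - toR R p0).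
  apply: (addrI (toR R p0)).
  transitivity (toR R v + d *: x).
    by rewrite vE xE; apply: vecP; rewrite /= /GRing.scale /=; ring.
  have -> : toR R v + d *: x = al *: toR R p0 + be *: toR R p1 + ga *: toR R p2 by exact: zE.
  have -> : al = 1 - be - ga by rewrite -sum1; ring.
  by apply: vecP; rewrite /= /GRing.scale /=; ring.
have [hb hc] := coord_inj DR hbc.
have bz0 : 0 <= bz by apply: int_gtN1; lra.
have cz0 : 0 <= cz by apply: int_gtN1; lra.
have az0 : 0 <= 1 - bz - cz.
  by apply: int_gtN1; rewrite !intrB; lra.
have dx (y : V) : d *: x = y -> x = d^-1 *: y.
  by move=> <-; rewrite scalerA mulVf ?scale1r// lt0r_neq0.
have di : 0 <= d^-1 by rewrite invr_ge0 ltW.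
have dxE : d *: x = al *: toR R p0 + be *: toR R p1 + ga *: toR R p2 - toR R v.
  by rewrite -zE addrC addKr.
have alE : al = 1 - be - ga by rewrite -sum1; ring.
have fin w w' (s t : R) : perm_eq [:: p0; p1; p2] [:: v; w; w'] -> 0 <= s -> 0 <= t ->
    d *: x = s *: ray w + t *: ray w' ->
    exists w w' (s t : R), [/\ star_tri Ts v w w', 0 <= s, 0 <= t & x = s *: ray w + t *: ray w'].
  move=> pw s0 t0 /dx xE'; exists w, w', (d^-1 * s), (d^-1 * t); split.
  - by exists (p0, p1, p2).
  - by rewrite mulr_ge0.
  - by rewrite mulr_ge0.
  - by rewrite xE' scalerDr !scalerA.
have [[bzE czE]|[[b1' czE]|[bzE c1']]] := int_simplex bz0 cz0 az0.
- have vp : v = p0 by apply: toR_inj; rewrite vE bzE czE !scale0r !addr0.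
  apply: (fin p1 p2 be ga) => //; first by rewrite vp.
  by rewrite dxE /ray vp alE; apply: vecP; rewrite /= /GRing.scale /=; ring.
- have vp : v = p1.
    by apply: toR_inj; rewrite vE b1' czE scale1r scale0r addr0 addrC subrK.
  apply: (fin p0 p2 al ga) => //.
    by rewrite vp (perm_catCA [:: p0] [:: p1] [:: p2]).
  rewrite dxE /ray vp (_ : be = 1 - al - ga); last by rewrite -sum1; ring.
  by apply: vecP; rewrite /= /GRing.scale /=; ring.
- have vp : v = p2.
    by apply: toR_inj; rewrite vE c1' bzE scale1r scale0r add0r addrC subrK.
  apply: (fin p0 p1 al be) => //.
    by rewrite vp (perm_catC [:: p0; p1] [:: p2]).
  rewrite dxE /ray vp (_ : ga = 1 - al - be); last by rewrite -sum1; ring.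
  by apply: vecP; rewrite /= /GRing.scale /=; ring.
Qed.

Hypothesis hv : interior P (toR R v).

Lemma star_complete x : exists w w' (s t : R),
  [/\ star_tri Ts v w w', 0 <= s, 0 <= t & x = s *: ray w + t *: ray w'].
Proof.
have /interior2P[r r0 hr] := hv.
have [T TTs|r1 r10 hr1] := @finite_threshold _ _ Ts (fun T d =>
    @tri_set R T (toR R v + d *: x) ->
    exists w w' (s t : R), [/\ star_tri Ts v w w', 0 <= s, 0 <= t & x = s *: ray w + t *: ray w']).
  exact: tri_germ.
pose N := 1 + `|x.1| + `|x.2|.
have n1 := normr_ge0 x.1; have n2 := normr_ge0 x.2.
have N0 : 0 < N by rewrite /N; lra.
pose d := Num.min r1 (r / N).
have d0 : 0 < d by rewrite lt_min r10 divr_gt0.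
have dr1 : d <= r1 by rewrite ge_min lexx.
have dN : d * N <= r by rewrite -ler_pdivlMr// ge_min lexx orbT.
have aux (p : R) : `|p| < N -> `|d * p| < r.
  by move=> pN; rewrite normrM gtr0_norm//; apply: lt_le_trans dN; rewrite ltr_pM2l.
have := hr (d *: x) _ _.
case: hT => -> _ _ /= h.
have [||T TTs hz] := h.
- by apply: aux; rewrite /N; lra.
- by apply: aux; rewrite /N; lra.
by apply: (hr1 T TTs d _ hz); rewrite d0.
Qed.

Definition star_vertices : seq lpt := flatten [seq tverts T | T <- Ts].

Definition star_fan : seq (V * V) :=
  [seq (toR R p.1 - toR R v, toR R p.2 - toR R v) |
    p : lpt * lpt <- [seq (w, w') | w <- star_vertices, w' <- star_vertices] &
    `[< star_tri Ts v p.1 p.2 >]].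

Lemma star_fanP a b : reflect
  (exists w w', [/\ star_tri Ts v w w', a = ray w & b = ray w']) ((a, b) \in star_fan).
Proof.
apply: (iffP mapP) => [[[w w']]|[w [w' [st -> ->]]]].
  by rewrite mem_filter => /andP[/asboolP st _] [-> ->]; exists w, w'.
exists (w, w') => //; rewrite mem_filter /=; apply/andP; split; first exact/asboolP.
have [T TTs pT] := st.
have mem p : p \in [:: v; w; w'] -> p \in star_vertices.
  rewrite -(perm_mem pT) => pT'; apply/flattenP; exists (tverts T) => //.
  exact: map_f.
by apply/allpairsP; exists (w, w'); split => //; apply: mem; rewrite !inE eqxx ?orbT.
Qed.

Lemma fan_star_fan : fan star_fan.
Proof.
apply: fan_of_complete.
- move=> a b /star_fanP[w [w' [st -> ->]]]; apply/star_fanP; exists w', w.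
  by split => //; exact: star_sym.
- move=> a b /star_fanP[w [w' [st -> ->]]].
  by rewrite det2_tdet intr_eq0 tdet_neq0// star_tdet.
- move=> x; have [w [w' [s [t [st s0 t0 ->]]]]] := star_complete x.
  by exists (ray w), (ray w'), s, t; split => //; apply/star_fanP; exists w, w'.
- move=> a b c d s t s' t' /star_fanP[w [w' [st -> ->]]] /star_fanP[u [u' [st' -> ->]]].
  move=> s0 t0 s'0 t'0 h.
  by case: (star_agree st st' s0 t0 s'0 t'0 h) => -[-> ->]; [left|right].
Qed.

Lemma strict_support_star_fan th :
  (forall w w', star_tri Ts v w w' ->
    exists m : V, forall x, @tcone R v w w' x -> th x = lin m x) ->
  strictly_convex_support Ts v th -> strict_support star_fan th.
Proof.
move=> hlin [cth sth].
have cone w w' (s t : R) : 0 <= s -> 0 <= t ->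
    @tcone R v w w' (s *: ray w + t *: ray w') by move=> s0 t0; exists s, t.
have conel w w' : @tcone R v w w' (ray w).
  by have := cone w w' 1 0 ler01 (lexx 0); rewrite scale1r scale0r addr0.
have coner w w' : @tcone R v w w' (ray w').
  by have := cone w w' 0 1 (lexx 0) ler01; rewrite scale1r scale0r add0r.
have pieceE w w' x : star_tri Ts v w w' -> @tcone R v w w' x ->
    th x = lin (piece th (ray w) (ray w')) x.
  move=> st cx; have [m hm] := hlin _ _ st.
  have D : det2 (ray w) (ray w') != 0.
    by rewrite det2_tdet intr_eq0 tdet_neq0// star_tdet.
  rewrite (hm _ cx); congr lin; apply: (lin_inj D).
    by rewrite /piece cramerl// hm.
  by rewrite /piece cramerr// hm.
split => //.
- move=> a b s t /star_fanP[w [w' [st -> ->]]] s0 t0.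
  have [m hm] := hlin _ _ st.
  by rewrite (hm _ (cone w w' s t s0 t0)) (hm _ (conel w w')) (hm _ (coner w w')) linD !linZ.
- move=> a b c /star_fanP[w [w1 [st1 -> ->]]] /star_fanP[w0 [w2 [st2 /ray_inj E ->]]].
  rewrite -{}E in st2 *.
  (* Equal neighbours would turn the product of determinants into a square. *)
  have [->|/eqP ne] := eqVneq w1 w2; first by rewrite -expr2 ltNge sqr_ge0.
  by move=> _; apply: (sth w w1 w2 st1 st2 ne) => x cx; exact: pieceE.
Qed.

(** Weights [b], [c] on the two barycenters correspond to [s = b / 2 + c / 3] and [t = c / 3], so
    that [s - t = b / 2] and [2 * s + t = b + c]. *)
Lemma Cbar_star_set : Cbar Ts v = star_set star_fan (toR R v).
Proof.
have vE w w' (b c : R) : (1 - b - c) *: toR R v + b *: (2^-1 *: (toR R v + toR R w)) +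
    c *: (3^-1 *: (toR R v + toR R w + toR R w')) - toR R v =
    (b / 2 + c / 3) *: ray w + (c / 3) *: ray w'.
  by rewrite /ray; apply: vecP; rewrite /= /GRing.scale /=; field.
apply/seteqP; split => x.
  move=> [w [w' [st /conv_hull3P[a [b [c [a0 b0 c0 sum1 ->]]]]]]].
  exists (ray w), (ray w'), (b / 2 + c / 3), (c / 3); split.
  - by apply/star_fanP; exists w, w'.
  - by apply/andP; split; lra.
  - lra.
  - by rewrite -vE; congr (_ *: _ + _ + _ - _); rewrite -sum1; ring.
move=> [a [b [s [t [/star_fanP[w [w' [st -> ->]]] /andP[t0 ts] st1 xE]]]]].
exists w, w'; split => //; apply/conv_hull3P.
exists (1 - 2 * (s - t) - 3 * t), (2 * (s - t)), (3 * t); split; [lra|lra|lra|ring|].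
apply: (addIr (- toR R v)); rewrite xE vE.
by congr (_ *: _ + _ *: _); field.
Qed.

End Star.

(** * Transfer of the conclusion under a change of sign *)

Section Negation.
Variable R : realType.
Local Notation V := (R * R)%type.
Implicit Types (A : set V) (s : seq V).

Lemma interior_opp A : interior (-%R @` A) = -%R @` interior A.
Proof.
have h A' x : interior A' x -> interior (-%R @` A') (- x).
  move=> /interior2P[r r0 hr]; apply/interior2P; exists r => // z z1 z2.
  exists (x - z); last by rewrite opprB addrC.
  by apply: hr => /=; rewrite normrN.
have oppK A' : -%R @` (-%R @` A') = A'.
  apply/seteqP; split => [x [_ [y Ay <-] <-]|x Ax]; first by rewrite opprK.
  by exists (- x); [exists x|rewrite opprK].
apply/seteqP; split => [x|_ [x Ax <-]]; last exact: h.
by move=> /h; rewrite oppK => Ax; exists (- x) => //; rewrite opprK.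
Qed.

Lemma conv_hull_opp s : conv_hull (map -%R s) = -%R @` conv_hull s.
Proof.
have sumN (w : nat -> R) : \sum_(i < size s) w i *: (map -%R s)`_i =
    - \sum_(i < size s) w i *: s`_i.
  rewrite -sumrN; apply: eq_bigr => i _.
  by rewrite (nth_map 0)// scalerN.
apply/seteqP; split => x.
  move=> [w []]; rewrite size_map => w0 w1 ->; rewrite sumN.
  by exists (\sum_(i < size s) w i *: s`_i) => //; exists w.
move=> [_ [w [w0 w1 ->]] <-]; by exists w; rewrite size_map; split.
Qed.

Lemma image_opp (T : Type) (f g : T -> V) (A : set T) : (forall x, f x = - g x) ->
  f @` A = -%R @` (g @` A).
Proof.
move=> fg; apply/seteqP; split => [_ [x Ax <-]|_ [_ [x Ax <-] <-]].
  by exists (g x); [exists x|rewrite fg].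
by exists x => //; rewrite fg.
Qed.

Lemma setD_opp A B : -%R @` A `\` -%R @` B = -%R @` (A `\` B).
Proof.
apply/seteqP; split => [_ [[x Ax <-] nB]|_ [x [Ax nB] <-]].
  by exists x => //; split => // Bx; apply: nB; exists x.
split; first by exists x.
by move=> [y By /oppr_inj yx]; apply: nB; rewrite -yx.
Qed.

Lemma hess_transfer (f g : V -> R) (A B C : set V) :
  (forall b, dif f b = - dif g b) ->
  (forall b xi, hess_form f b xi = - hess_form g b xi) ->
  (forall b, A b -> (dif g @` B) (dif g b) \/ hess_posdef g b) /\
  (exists s, [/\ dif g @` C = conv_hull s, interior (conv_hull s) !=set0 &
    conv_hull s `\` interior (conv_hull s) = dif g @` B]) ->
  (forall b, A b -> (dif f @` B) (dif f b) \/ hess_negdef f b) /\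
  (exists s, [/\ dif f @` C = conv_hull s, interior (conv_hull s) !=set0 &
    conv_hull s `\` interior (conv_hull s) = dif f @` B]).
Proof.
move=> difN hessN [H1 [s [S1 S2 S3]]]; split.
  move=> b /H1[[x Bx hx]|h]; first by left; exists x; rewrite // (difN x) (difN b) hx.
  by right => xi xi0; rewrite hessN oppr_lt0; exact: h.
exists (map -%R s); rewrite conv_hull_opp interior_opp; split.
- by rewrite (image_opp _ difN) S1.
- by have [x hx] := S2; exists (- x); exists x.
- by rewrite setD_opp S3 (image_opp _ difN).
Qed.

End Negation.

Lemma posdef_conclusion (R : realType) (P : set (R * R)) (Ts : seq ltri) (v : lpt)
    (q : R * R * R) (th : R * R -> R) :
  is_inner q -> unimodular_triangulation P Ts -> interior_vertex P Ts v ->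
  support_fun Ts v th -> strictly_convex_support Ts v th ->
  thm_conclusion Ts v q th (@hess_posdef R).
Proof.
move=> hq hT [_ hv] [_ lth] sth.
have fE := fan_star_fan hT hv.
have sE := strict_support_star_fan hT lth sth.
have [e0 e00 H] := smoothed_support_image (toR R v) fE sE hq.
exists e0 => // e ee; have [H1 H2] := H e ee.
rewrite /Cbdry /Copen (Cbar_star_set R Ts v).
by split => // b _; exact: H1.
Qed.

Theorem theorem6p2 (R : realType) (P : set (R * R)) (Ts : seq ltri) (v : lpt)
    (q : R * R * R) (th : R * R -> R) :
  is_inner q ->
  convex_set P ->
  unimodular_triangulation P Ts ->
  interior_vertex P Ts v ->
  semi_integral_support Ts v th ->
  (strictly_convex_support Ts v th ->
     thm_conclusion Ts v q th (@hess_posdef R)) /\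
  (strictly_convex_support Ts v (fun x => - th x) ->
     thm_conclusion Ts v q th (@hess_negdef R)).
Proof.
move=> hq _ hT hv [sth _]; split; first exact: (posdef_conclusion hq hT hv sth).
move=> scv; have [cth lth] := sth.
pose nth x := - th x.
have lnth w w' : star_tri Ts v w w' ->
    exists m : R * R, forall x, tcone v w w' x -> nth x = lin m x.
  by move=> /lth[m hm]; exists (- m) => x /hm thx; rewrite linNl -thx.
have snth : support_fun Ts v nth.
  by split => // x; apply: cvgN; exact: cth.
have [e0 e00 H] := posdef_conclusion hq hT hv snth scv.
exists e0; first exact: e00.
move=> e ee; have /andP[ep _] := ee.
have fE := fan_star_fan hT hv.2.
(* Local boundedness comes from the convex function [nth], a maximum of linear pieces; [th] then
   inherits it by sign change. *)
have bG : loc_bounded (fun z => nth (z - toR R v)).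
  exact: loc_bounded_thv fE (strict_support_star_fan hT lnth scv).
have fN : theta_tilde q e th v = cnv (fun z => - nth (z - toR R v)) (mu_eps q e).
  by apply/funext => x; rewrite /theta_tilde /cnv /nth; apply: eq_Rintegral => y _; rewrite opprK.
have bN : loc_bounded (fun z => - nth (z - toR R v)).
  have -> : (fun z => - nth (z - toR R v)) = fun z => -1 * nth (z - toR R v).
    by apply/funext => z; rewrite mulN1r.
  exact: (loc_boundedM (loc_bounded_cst (-1)) bG).
have difN b : dif (theta_tilde q e th v) b = - dif (theta_tilde q e nth v) b.
  rewrite fN; apply: vecP; rewrite /= ?(d1f hq ep bN) ?(d2f hq ep bN).
    by rewrite (cnvN _ bG (kernel_Dmu hq ep _)) -(d1f hq ep bG).
  by rewrite (cnvN _ bG (kernel_Dmu hq ep _)) -(d2f hq ep bG).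
have hessN b xi : hess_form (theta_tilde q e th v) b xi =
    - hess_form (theta_tilde q e nth v) b xi.
  rewrite fN (hess_formE hq ep bN) (cnvN _ bG (kernel_DDmu hq ep _ _)).
  by rewrite -(hess_formE hq ep bG).
exact: (hess_transfer difN hessN (H e ee)).
Qed.
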